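(* Suppose $\mathbb{P}(D\ge p)>0$ and $\mathbb{E}[D^p]<\infty$, and $F_S$ is Lipschitz continuous. Then there exist constants $0<c<C<\infty$ such that $$cK_\otimes\preceq k_{\mathrm{BART}}\preceq CK_\otimes ,$$ where $K_\otimes(u,u'):=\prod_{v=1}^p\exp(-|u_v-u'_v|)$ is the $\ell_1$-Laplacian kernel on $[0,1]^p$, and the constants $c,C$ depend on the variance $\sigma_\mu^2$, the dimension $p$ and the depth distribution $f_D$. Consequently, the reproducing kernel Hilbert space $\mathcal{H}_{\mathrm{BART}}$ corresponding to $k_{\mathrm{BART}}$ is norm-equivalent to the tensor product Sobolev space $S_1([0,1]^p)$.
   Context: Symmetric tree prior. Fix an integer $p\ge1$, a variance $\sigma_\mu^2>0$ (the prior variance of the Gaussian leaf parameters), a probability mass function $f_D$ on the positive integers, a probability mass function $f_V$ on $\{1,\dots,p\}$ with $f_V(v)>0$ for all $v$, and a continuous, strictly positive probability density $f_S$ on $[0,1]$ with distribution function $F_S$. Draw the depth $D\sim f_D$; given $D$ draw independently $V_1,\dots,V_D$ i.i.d. from $f_V$ and $S_1,\dots,S_D$ i.i.d. from $f_S$. Points $x,x'\in[0,1]^p$ are in the same leaf of the resulting symmetric tree $h$, written $x\sim_h x'$, if for every $k\le D$ either both $x_{V_k},x'_{V_k}<S_k$ or both $x_{V_k},x'_{V_k}\ge S_k$. The BART kernel is $k_{\mathrm{BART}}(x,x')=\sigma_\mu^2\,\mathbb{P}[x\sim_h x']$, a positive semidefinite kernel on $[0,1]^p$. For kernels $k_1,k_2$,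 $k_1\preceq k_2$ means that $k_2-k_1$ is a positive semidefinite kernel (Loewner order). $S_1([0,1]^p)=\bigotimes_{v=1}^pW_1([0,1])=\{f\in L^2([0,1]^p): D^{a}f\in L^2([0,1]^p)\text{ for all multi-indices }a\text{ with }\|a\|_\infty\le1\}$, where $D^a$ is the weak partial derivative along the variables indexed by $a$, with the norm $\|f\|^2=\sum_{a\in\{0,1\}^p}\|D^af\|_{L^2}^2$, and $W_1([0,1])=\{f\in L^2([0,1]): Df\text{ exists and }Df\in L^2([0,1])\}$ with $Df$ the weak derivative. Norm-equivalent means that the two spaces coincide as sets of functions (identifying elements of $S_1$ with their continuous representatives) and their norms are equivalent. *)

(* Defs.v *)
From HB Require Import structures.
From mathcomp Require Import all_boot all_order all_algebra.
From mathcomp Require Import all_classical all_reals all_analysis.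

Set Implicit Arguments.
Unset Strict Implicit.
Unset Printing Implicit Defensive.

Import Order.TTheory GRing.Theory Num.Theory.
Import numFieldNormedType.Exports.

Local Open Scope classical_set_scope.
Local Open Scope ring_scope.

Definition psd_kernel (R : realType) (X : Type) (k : X -> X -> R) : Prop :=
  (forall x y, k x y = k y x) /\
  forall (n : nat) (x : 'I_n -> X) (a : 'I_n -> R),
    0 <= \sum_(i < n) \sum_(j < n) a i * a j * k (x i) (x j).

Definition loewner_le (R : realType) (X : Type) (k1 k2 : X -> X -> R) : Prop :=
  psd_kernel (fun x y => k2 x y - k1 x y).

(* The Hilbert space is given by its carrier [H], a set of functions on [X],
   and its inner product [ip], whose values outside [H] are irrelevant. *)

Definition ip_norm (R : realType) (X : Type)
    (ip : (X -> R) -> (X -> R) -> R) (f : X -> R) : R :=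
  Num.sqrt (ip f f).

Record hilbert_function_space (R : realType) (X : Type)
    (H : set (X -> R)) (ip : (X -> R) -> (X -> R) -> R) : Prop := {
  hfs_zero : H (fun=> 0) ;
  hfs_lin : forall (a : R) f g, H f -> H g -> H (fun x => a * f x + g x) ;
  hfs_ip_sym : forall f g, H f -> H g -> ip f g = ip g f ;
  hfs_ip_lin : forall (a : R) f g h, H f -> H g -> H h ->
    ip (fun x => a * f x + g x) h = a * ip f h + ip g h ;
  hfs_ip_ge0 : forall f, H f -> 0 <= ip f f ;
  hfs_ip_eq0 : forall f, H f -> ip f f = 0 -> f = (fun=> 0) ;
  hfs_complete : forall u : nat -> X -> R, (forall n, H (u n)) ->
    (forall e : R, 0 < e -> exists N : nat, forall m n : nat,
       (N <= m)%N -> (N <= n)%N ->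
       ip_norm ip (fun x => u m x - u n x) < e) ->
    exists2 f, H f & (fun n => ip_norm ip (fun x => u n x - f x)) @ \oo --> 0
}.

Record rkhs_of (R : realType) (X : Type) (k : X -> X -> R)
    (H : set (X -> R)) (ip : (X -> R) -> (X -> R) -> R) : Prop := {
  rkhs_hilbert : hilbert_function_space H ip ;
  rkhs_section : forall x, H (k x) ;
  rkhs_reproducing : forall f x, H f -> ip f (k x) = f x
}.

Definition unit_cube (R : realType) (p : nat) : set 'rV[R]_p :=
  [set x | forall v : 'I_p, 0 <= x 0 v <= 1].
Arguments unit_cube : clear implicits.

Definition laplace_kernel (R : realType) (p : nat)
    (u u' : unit_cube R p) : R :=
  \prod_(v < p) expR (- `|\val u 0 v - \val u' 0 v|).

Definition depth_pmf (R : realType) (fD : nat -> R) : Prop :=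
  [/\ forall n, 0 <= fD n, fD 0%N = 0
    & (\sum_(0 <= n <oo) (fD n)%:E = 1)%E].

Definition variable_pmf (R : realType) (p : nat) (fV : 'I_p -> R) : Prop :=
  (forall v, 0 < fV v) /\ \sum_(v < p) fV v = 1.

Definition split_density (R : realType) (fS : R -> R) : Prop :=
  [/\ {within `[0, 1], continuous fS},
      forall s, s \in `[0, 1] -> 0 < fS s
    & (\int[lebesgue_measure]_(s in `[0%R, 1%R]) (fS s)%:E = 1)%E].

Definition split_cdf (R : realType) (fS : R -> R) (t : R) : R :=
  \int[lebesgue_measure]_(s in `[0, t]) fS s.

(* [P(D >= m)] and [E[D^m]] for [D] distributed according to [fD] *)
Definition depth_tail (R : realType) (fD : nat -> R) (m : nat) : \bar R :=
  (\sum_(m <= n <oo) (fD n)%:E)%E.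

Definition depth_moment (R : realType) (fD : nat -> R) (m : nat) : \bar R :=
  (\sum_(0 <= n <oo) (n%:R ^+ m * fD n)%:E)%E.

(* The variables are numbered from 0: at depth [n] the tree is made of
   [(V k, S k)] for [k < n]. The law of the remaining [(V k, S k)], [n <= k],
   is left unspecified on the event [D = n]. *)
Record symmetric_tree_draw (R : realType) (p : nat)
    (fD : nat -> R) (fV : 'I_p -> R) (fS : R -> R)
    (d : measure_display) (T : measurableType d) (P : probability T R)
    (D : T -> nat) (V : nat -> T -> 'I_p) (S : nat -> T -> R) : Prop := {
  draw_depth_measurable : measurable_fun setT D ;
  draw_variable_measurable :
    forall k (v : 'I_p), measurable (V k @^-1` [set v]) ;
  draw_split_measurable : forall k, measurable_fun setT (S k) ;
  draw_law : forall (n : nat) (v : 'I_n -> 'I_p) (B : 'I_n -> set R),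
    (forall k, measurable (B k)) ->
    P [set w | D w = n /\ forall k : 'I_n, V k w = v k /\ B k (S k w)] =
    (fD n * \prod_(k < n)
       (fV (v k) * \int[lebesgue_measure]_(s in B k `&` `[0, 1]) fS s))%:E
}.

Definition same_leaf (R : realType) (p : nat)
    (n : nat) (v : nat -> 'I_p) (s : nat -> R) (x x' : 'rV[R]_p) : Prop :=
  forall k, (k < n)%N ->
    (x 0 (v k) < s k /\ x' 0 (v k) < s k) \/
    (s k <= x 0 (v k) /\ s k <= x' 0 (v k)).

Definition bart_kernel (R : realType) (p : nat) (sigma2 : R)
    (d : measure_display) (T : measurableType d) (P : probability T R)
    (D : T -> nat) (V : nat -> T -> 'I_p) (S : nat -> T -> R)
    (x x' : unit_cube R p) : R :=
  sigma2 *
  fine (P [set w | same_leaf (D w) (V ^~ w) (S ^~ w) (\val x) (\val x')]).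

Section unit_interval_measure.
Variable R : realType.

Definition unit_interval_measure : set (measurableTypeR R) -> \bar R :=
  mrestr lebesgue_measure (measurable_itv `[0%R : R, 1%R]).

HB.instance Definition _ := Measure.on unit_interval_measure.

Let unit_interval_measureT : unit_interval_measure setT = 1%E.
Proof.
by rewrite /unit_interval_measure /mrestr setTI lebesgue_measure_itv/= lte01
  oppr0 adde0.
Qed.

HB.instance Definition _ := Measure_isProbability.Build _ _ _
  unit_interval_measure unit_interval_measureT.

End unit_interval_measure.
Arguments unit_interval_measure : clear implicits.

Section cube_measure.
Variable R : realType.
Let X := measurableTypeR R.

Definition tuple_cons (n : nat) (xt : X * n.-tuple X) : n.+1.-tuple X :=
  [tuple of xt.1 :: xt.2].

Lemma measurable_tuple_cons n : measurable_fun setT (@tuple_cons n).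
Proof. exact: measurable_cons. Qed.

HB.instance Definition _ n :=
  isMeasurableFun.Build _ _ _ _ (@tuple_cons n) (@measurable_tuple_cons n).

(* The library has the Borel structure of R^n on tuples and its norm on row
   vectors: measures live on tuples and are read through [row_of_tuple]. *)
Fixpoint cube_measure (n : nat) : probability (n.-tuple X) R :=
  match n with
  | 0 => \d_([tuple] : 0.-tuple X)
  | m.+1 => distribution (unit_interval_measure R \x cube_measure m)%E
              (@tuple_cons m)
  end.

End cube_measure.
Arguments cube_measure : clear implicits.

Definition row_of_tuple (R : realType) (p : nat)
    (t : p.-tuple (measurableTypeR R)) : 'rV[R]_p :=
  \row_v tnth t v.

Section sobolev.
Variables (R : realType) (p : nat).
Implicit Types (f g phi : 'rV[R]_p -> R) (a : {set 'I_p}).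

Definition partial (v : 'I_p) phi : 'rV[R]_p -> R :=
  fun x => 'D_(delta_mx 0 v) phi x.

Definition iter_partial (s : seq 'I_p) phi : 'rV[R]_p -> R :=
  foldr partial phi s.

Definition smooth phi : Prop :=
  forall s : seq 'I_p, continuous (iter_partial s phi) /\
    forall x v, derivable (iter_partial s phi) x (delta_mx 0 v).

Definition open_cube : set 'rV[R]_p :=
  [set x | forall v : 'I_p, 0 < x 0 v < 1].

Definition test_function phi : Prop :=
  smooth phi /\
  exists K : set 'rV[R]_p, [/\ compact K, K `<=` open_cube
    & forall x, ~ K x -> phi x = 0].

Definition L2_cube f : Prop :=
  f \o @row_of_tuple R p \in Lfun (cube_measure R p) 2%:E.

Definition L2_norm f : R :=
  fine ('N[cube_measure R p]_2%:E[EFin \o (f \o @row_of_tuple R p)])%E.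

Definition cube_integral f : R :=
  \int[cube_measure R p]_t f (row_of_tuple t).

(* The multi-index a in {0,1}^p is the set of the variables [v] with a_v = 1. *)
Definition is_weak_partial a f g : Prop :=
  forall phi, test_function phi ->
    cube_integral (fun x => f x * iter_partial (enum a) phi x) =
    (-1) ^+ #|a| * cube_integral (fun x => g x * phi x).

Definition sobolev_S1 : set ('rV[R]_p -> R) :=
  [set f | L2_cube f /\
    forall a, exists g, L2_cube g /\ is_weak_partial a f g].

(* Weak derivatives are unique up to null sets, so the choice made here does
   not affect [S1_norm]. *)
Definition weak_partial a f : 'rV[R]_p -> R :=
  xget (fun=> 0) [set g | L2_cube g /\ is_weak_partial a f g].

Definition S1_norm f : R :=
  Num.sqrt (\sum_(a : {set 'I_p}) L2_norm (weak_partial a f) ^+ 2).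

Definition continuous_representative f (h : unit_cube R p -> R) : Prop :=
  continuous h /\
  {ae cube_measure R p, forall t, forall x : unit_cube R p,
     \val x = row_of_tuple t -> f (row_of_tuple t) = h x}.

Definition norm_equivalent_S1
    (H : set (unit_cube R p -> R))
    (ip : (unit_cube R p -> R) -> (unit_cube R p -> R) -> R) : Prop :=
  [/\ forall f, sobolev_S1 f ->
        exists2 h, H h & continuous_representative f h,
      forall h, H h ->
        exists2 f, sobolev_S1 f & continuous_representative f h
    & exists c1 c2 : R, [/\ 0 < c1, 0 < c2
        & forall f h, sobolev_S1 f -> H h -> continuous_representative f h ->
            c1 * S1_norm f <= ip_norm ip h <= c2 * S1_norm f]].

End sobolev.

(* Main.v *)
Require Import Defs.
From HB Require Import structures.
From mathcomp Require Import all_boot all_order all_algebra.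
From mathcomp Require Import all_classical all_reals all_analysis.
From mathcomp Require Import measurable_realfun ring lra.

Set Implicit Arguments.
Unset Strict Implicit.
Unset Printing Implicit Defensive.

Import Order.TTheory GRing.Theory Num.Theory.
Import numFieldNormedType.Exports.

Local Open Scope classical_set_scope.
Local Open Scope ring_scope.

(** All kernels are compared with one pivot, the product kernel
    [min_kernel x y = \prod_v (1 + min (x_v, y_v))], in the Loewner order. By
    Schur's product theorem (Lemma [psd_mul]) the Loewner order is compatible
    with products, so that the comparisons are made one variable at a time.

    Loewner bounds. Let [l_v = 1 - |F (x_v) - F (y_v)|] be the probability that a
    split along [v] does not separate [x] from [y], where [F] is the
    distribution function of the splits. Conditioning on the depth,
    [k_BART = sigma2 * \sum_n fD n * q ^ n] with [q = \sum_v fV v * l_v]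
    ([bart_series]). On [0, 1] a nonnegative convex nonincreasing function of
    [|s - t|] is, on any finite set of points, a nonnegative constant plus a
    nonnegative combination of triangle functions [max (0, a - |s - t|)], and
    each of these is a positive semidefinite second difference of [min]; the total weight of the combination is at most the
    slope at 0 ([convex_form]). This bounds [l_v ^ m] by a multiple of
    [(m + 1) (1 + min)] and makes [exp (- |s - t|)] comparable with [1 + min].
    Passing between [min (F s, F t)] and [min (s, t)] is possible because [F] is
    Lipschitz with a slope bounded away from 0. In the expansion of [q ^ n],
    every term is a product of at most [p] different powers [l_v ^ m] with
    [m <= n], hence [q ^ n] is at most [(C (n + 1)) ^ p] times the pivot, which
    the moment of order [p] makes summable ([split_power_le]); and for some
    [n >= p] with [fD n > 0] the term that uses every variable bounds the series
    from below ([split_power_ge]).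

    Norm equivalence. A function [h] lies in the space of a kernel [k] with
    squared norm of order [M] iff [(\sum_i a_i h (x_i)) ^ 2] is at most
    [M \sum_i \sum_j a_i a_j k (x_i, x_j)] for all finite families
    ([rkhs_dominated], [dominated_rkhs]). This condition is transported by
    Loewner inequalities, so that the space of the BART kernel may be replaced
    by that of the pivot.

    From Sobolev functions to the pivot: for a smooth weight [rho] of integral 1
    on [0, 1], [psi x] is the integral of [rho psi] plus that of
    [chi_x psi'], where [chi_x u = 1_(u < x) - \int_u^1 rho]. The tensor power of
    this identity expresses a function by its mixed weak derivatives [D^a f];
    it defines a function dominated by the pivot, by the Cauchy-Schwarz
    inequality and because the sum over [a] of the Gram matrices is a product of
    one variable Gram matrices ([bridge_sum_dominated]), and this function is
    [f] almost everywhere, since it has the same integrals against products of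
    test functions ([bridge_sum_ae]).

    From the pivot to Sobolev functions: a dominated function is a uniform limit
    of finite combinations of sections of the pivot whose coefficients form a
    Cauchy sequence for the kernel form ([dominated_approximation]). The mixed
    weak derivatives of a section are explicit products of indicators and of
    functions [1 + min], with Gram matrices at most [2 ^ p] times the pivot.
    Hence the mixed derivatives of the approximations converge in [L^2], and
    their limits are the weak derivatives of the function ([kappa_sum_limit]). *)

(** * Positive semidefinite kernels and the Loewner order *)

Section KernelForms.
Variables (R : realType) (X : Type).
Implicit Types (k : X -> X -> R) (W : seq (R * X)).

Definition kernel_pairing k W W' : R :=
  \sum_(w <- W) \sum_(w' <- W') w.1 * w'.1 * k w.2 w'.2.

Definition kernel_form k W : R := kernel_pairing k W W.

Definition scale_points (c : R) W : seq (R * X) :=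
  [seq (c * w.1, w.2) | w <- W].

Definition eval_points (h : X -> R) W : R := \sum_(w <- W) w.1 * h w.2.

Lemma kernel_pairing_catl k W1 W2 W' : kernel_pairing k (W1 ++ W2) W' =
  kernel_pairing k W1 W' + kernel_pairing k W2 W'.
Proof. by rewrite /kernel_pairing big_cat. Qed.

Lemma kernel_pairing_catr k W1 W2 W' : kernel_pairing k W' (W1 ++ W2) =
  kernel_pairing k W' W1 + kernel_pairing k W' W2.
Proof.
rewrite /kernel_pairing -big_split/=.
by apply: eq_bigr => w _; rewrite big_cat.
Qed.

Lemma kernel_pairing_scalel k c W W' :
  kernel_pairing k (scale_points c W) W' = c * kernel_pairing k W W'.
Proof.
rewrite /kernel_pairing big_map mulr_sumr; apply: eq_bigr => w _.
by rewrite mulr_sumr; apply: eq_bigr => w' _ /=; rewrite !mulrA.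
Qed.

Lemma kernel_pairing_scaler k c W W' :
  kernel_pairing k W (scale_points c W') = c * kernel_pairing k W W'.
Proof.
rewrite /kernel_pairing mulr_sumr; apply: eq_bigr => w _.
rewrite big_map mulr_sumr; apply: eq_bigr => w' _ /=; ring.
Qed.

Lemma eval_points_cat h W W' :
  eval_points h (W ++ W') = eval_points h W + eval_points h W'.
Proof. by rewrite /eval_points big_cat. Qed.

Lemma eval_points_scale h c W :
  eval_points h (scale_points c W) = c * eval_points h W.
Proof.
rewrite /eval_points big_map mulr_sumr.
by apply: eq_bigr => w _ /=; rewrite mulrA.
Qed.

Lemma eval_points1 h a x : eval_points h [:: (a, x)] = a * h x.
Proof. by rewrite /eval_points big_seq1. Qed.

Lemma kernel_pairingC k W W' : (forall x y, k x y = k y x) ->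
  kernel_pairing k W W' = kernel_pairing k W' W.
Proof.
move=> sk; rewrite /kernel_pairing exchange_big; apply: eq_bigr => w _.
by apply: eq_bigr => w' _; rewrite sk (mulrC w'.1).
Qed.

Lemma kernel_pairing_evall k W x a :
  kernel_pairing k [:: (a, x)] W = a * eval_points (k x) W.
Proof.
rewrite /kernel_pairing big_seq1 /eval_points mulr_sumr.
by apply: eq_bigr => w _ /=; rewrite mulrA.
Qed.

Lemma kernel_form1 k a x : kernel_form k [:: (a, x)] = a ^+ 2 * k x x.
Proof. by rewrite /kernel_form kernel_pairing_evall eval_points1 mulrA. Qed.

Lemma kernel_pairing_eval k W W' : kernel_pairing k W W' =
  \sum_(w <- W) w.1 * eval_points (k w.2) W'.
Proof.
apply: eq_bigr => w _; rewrite /eval_points mulr_sumr.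
by apply: eq_bigr => w' _; rewrite mulrA.
Qed.

Lemma kernel_formD k k' W :
  kernel_form (fun x y => k x y + k' x y) W = kernel_form k W + kernel_form k' W.
Proof.
rewrite /kernel_form /kernel_pairing -big_split; apply: eq_bigr => w _ /=.
by rewrite -big_split; apply: eq_bigr => w' _ /=; rewrite mulrDr.
Qed.

Lemma kernel_formZ k c W :
  kernel_form (fun x y => c * k x y) W = c * kernel_form k W.
Proof.
rewrite /kernel_form /kernel_pairing mulr_sumr; apply: eq_bigr => w _.
rewrite mulr_sumr; apply: eq_bigr => w' _ /=; ring.
Qed.

Lemma kernel_formB k k' W :
  kernel_form (fun x y => k x y - k' x y) W = kernel_form k W - kernel_form k' W.
Proof.
rewrite -mulN1r -kernel_formZ -kernel_formD; congr kernel_form.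
by apply/funext => x; apply/funext => y; rewrite mulN1r.
Qed.

Lemma kernel_form_rank1 u W :
  kernel_form (fun x y => u x * u y) W = eval_points u W ^+ 2.
Proof.
rewrite /kernel_form kernel_pairing_eval expr2 {2}/eval_points mulr_suml.
apply: eq_bigr => w _; rewrite -mulrA; congr (_ * _).
by rewrite /eval_points mulr_sumr; apply: eq_bigr => w' _; ring.
Qed.

Lemma kernel_form_sum (I : Type) (r : seq I) (P : pred I) (K : I -> X -> X -> R) W :
  kernel_form (fun x y => \sum_(i <- r | P i) K i x y) W =
  \sum_(i <- r | P i) kernel_form (K i) W.
Proof.
rewrite /kernel_form /kernel_pairing [RHS]exchange_big/=; apply: eq_bigr => w _.
by rewrite [RHS]exchange_big/=; apply: eq_bigr => w' _; rewrite mulr_sumr.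
Qed.

Lemma eval_points_sum (I : Type) (r : seq I) (P : pred I) (h : I -> X -> R) W :
  eval_points (fun x => \sum_(i <- r | P i) h i x) W =
  \sum_(i <- r | P i) eval_points (h i) W.
Proof.
rewrite /eval_points [RHS]exchange_big/=.
by apply: eq_bigr => w _; rewrite mulr_sumr.
Qed.

Lemma psd_kernel_form k : psd_kernel k <->
  (forall x y, k x y = k y x) /\ forall W, 0 <= kernel_form k W.
Proof.
split=> -[sk pk]; split=> //.
- move=> W; have := pk (size W) (fun i => (tnth (in_tuple W) i).2)
    (fun i => (tnth (in_tuple W) i).1).
  suff -> : kernel_form k W = \sum_(i < size W) \sum_(j < size W)
    (tnth (in_tuple W) i).1 * (tnth (in_tuple W) j).1 *
    k (tnth (in_tuple W) i).2 (tnth (in_tuple W) j).2 by [].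
  rewrite /kernel_form /kernel_pairing big_tnth; apply: eq_bigr => i _.
  by rewrite big_tnth.
- move=> n x a; have := pk [seq (a i, x i) | i <- enum 'I_n].
  suff -> : kernel_form k [seq (a i, x i) | i <- enum 'I_n] =
    \sum_(i < n) \sum_(j < n) a i * a j * k (x i) (x j) by [].
  rewrite /kernel_form /kernel_pairing big_map/= big_enum/=.
  by apply: eq_bigr => i _; rewrite big_map/= big_enum.
Qed.

Lemma psd_form_ge0 k W : psd_kernel k -> 0 <= kernel_form k W.
Proof. by move=> /psd_kernel_form[_]; exact. Qed.

Lemma loewner_leP k k' : loewner_le k k' <->
  (forall x y, k' x y - k x y = k' y x - k y x) /\
  forall W, kernel_form k W <= kernel_form k' W.
Proof.
rewrite /loewner_le psd_kernel_form; split=> -[sk pk]; split=> // W.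
  by have := pk W; rewrite kernel_formB subr_ge0.
by rewrite kernel_formB subr_ge0.
Qed.

Lemma loewner_form k k' W : loewner_le k k' -> kernel_form k W <= kernel_form k' W.
Proof. by move=> /loewner_leP[_]; exact. Qed.

Lemma kernel_form_cat k W W' : (forall x y, k x y = k y x) ->
  kernel_form k (W ++ W') =
  kernel_form k W + 2 * kernel_pairing k W W' + kernel_form k W'.
Proof.
move=> sk; rewrite /kernel_form kernel_pairing_catl !kernel_pairing_catr.
by rewrite (kernel_pairingC W' W sk); ring.
Qed.

Lemma kernel_form_scale k c W :
  kernel_form k (scale_points c W) = c ^+ 2 * kernel_form k W.
Proof. by rewrite /kernel_form kernel_pairing_scalel kernel_pairing_scaler; ring. Qed.

End KernelForms.

(** A quadratic polynomial in [t] that never goes negative has a nonpositive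
    discriminant: every Cauchy-Schwarz inequality below is this. *)
Lemma discriminant_le (R : realType) (a b c : R) :
  (forall t, 0 <= a + 2 * t * b + t ^+ 2 * c) -> b ^+ 2 <= a * c.
Proof.
move=> H; have a0 : 0 <= a by have := H 0; rewrite mulr0 mul0r expr0n mul0r !addr0.
have [c0|c0|c0] := ltrgtP c 0.
- exfalso.
  have := H ((a + 2 * `|b| + 1) / (- c) + 1); set t := _ + 1.
  have t1 : 1 <= t by rewrite /t lerDr divr_ge0// ?addr_ge0// ?mulr_ge0// oppr_ge0 ltW.
  have tc : (t - 1) * (- c) = a + 2 * `|b| + 1 by rewrite /t addrK divfK// oppr_eq0 lt_eqF.
  have bb : b <= `|b| by exact: ler_norm.
  have := normr_ge0 b.
  nra.
- have := H ((- b) / c).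
  have -> : a + 2 * (- b / c) * b + (- b / c) ^+ 2 * c = (a * c - b ^+ 2) / c.
    by field; rewrite gt_eqF.
  by rewrite pmulr_lge0 ?invr_gt0// subr_ge0.
- rewrite c0 mulr0; have [->|b0] := eqVneq b 0; first by rewrite expr0n.
  exfalso; have := H (- (a + 1) / (2 * b)).
  rewrite c0 mulr0 addr0.
  have -> : a + 2 * (- (a + 1) / (2 * b)) * b = -1 by field.
  by rewrite ler0N1.
Qed.

Section PsdCalculus.
Variables (R : realType) (X : Type).
Implicit Types (k : X -> X -> R) (W : seq (R * X)).

Lemma kernel_cauchy_schwarz k W W' : psd_kernel k ->
  kernel_pairing k W W' ^+ 2 <= kernel_form k W * kernel_form k W'.
Proof.
move=> pk; have [sk _] := pk; apply: discriminant_le => t.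
have := psd_form_ge0 (W ++ scale_points t W') pk.
rewrite kernel_form_cat// kernel_pairing_scaler kernel_form_scale.
by rewrite [2 * (t * _)]mulrA.
Qed.

Lemma psd_diag_ge0 k x : psd_kernel k -> 0 <= k x x.
Proof.
move=> /(psd_form_ge0 [:: (1, x)]).
by rewrite /kernel_form /kernel_pairing !big_seq1/= !mul1r.
Qed.

Lemma psd_diag_cauchy_schwarz k x y : psd_kernel k ->
  k x y ^+ 2 <= k x x * k y y.
Proof.
move=> /(kernel_cauchy_schwarz [:: (1, x)] [:: (1, y)]).
by rewrite /kernel_form /kernel_pairing !big_seq1/= !mul1r.
Qed.

Lemma psd_add k k' : psd_kernel k -> psd_kernel k' ->
  psd_kernel (fun x y => k x y + k' x y).
Proof.
move=> /psd_kernel_form[sk pk] /psd_kernel_form[sk' pk']; apply/psd_kernel_form.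
by split=> [x y|W]; [rewrite sk sk'|rewrite kernel_formD addr_ge0].
Qed.

Lemma psd_scale c k : 0 <= c -> psd_kernel k -> psd_kernel (fun x y => c * k x y).
Proof.
move=> c0 /psd_kernel_form[sk pk]; apply/psd_kernel_form.
by split=> [x y|W]; [rewrite sk|rewrite kernel_formZ mulr_ge0].
Qed.

Lemma psd_rank1 (u : X -> R) : psd_kernel (fun x y => u x * u y).
Proof.
apply/psd_kernel_form; split=> [x y|W]; first exact: mulrC.
by rewrite kernel_form_rank1 sqr_ge0.
Qed.

Lemma psd_cst (c : R) : 0 <= c -> psd_kernel (fun _ _ : X => c).
Proof.
move=> c0; have := psd_scale c0 (psd_rank1 (fun=> 1)).
by congr psd_kernel; apply/funext => x; apply/funext => y; rewrite !mulr1.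
Qed.

(** The Schur product theorem by elimination: a psd kernel [k] splits at a
    point [z] into a rank one part and a psd remainder vanishing at [z], and a
    psd kernel stays psd when it is multiplied by a rank one kernel. *)
Lemma psd_mul k k' : psd_kernel k -> psd_kernel k' ->
  psd_kernel (fun x y => k x y * k' x y).
Proof.
move=> pk pk'; apply/psd_kernel_form; split=> [x y|W].
  by rewrite pk.1 pk'.1.
elim: W k pk => [|z W IH] k pk.
  by rewrite /kernel_form /kernel_pairing big_nil.
(* terms through [z] disappear once [k z _] is zero *)
have vanish j : psd_kernel j -> (forall x, j z.2 x = 0) ->
    0 <= kernel_form (fun x y => j x y * k' x y) (z :: W).
  move=> pj jz; rewrite /kernel_form /kernel_pairing !big_cons jz mul0r mulr0 add0r.
  rewrite big1 ?add0r; last by move=> w _; rewrite jz mul0r mulr0.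
  have := IH j pj; rewrite /kernel_form /kernel_pairing.
  congr (0 <= _); apply: eq_bigr => w _.
  by rewrite big_cons pj.1 jz mul0r mulr0 add0r.
have [kz|kz] := eqVneq (k z.2 z.2) 0.
  apply: vanish => // x; have := psd_diag_cauchy_schwarz z.2 x pk.
  by rewrite kz mul0r => h; apply/eqP; rewrite -sqrf_eq0 eq_le h sqr_ge0.
have kz0 : 0 < k z.2 z.2 by rewrite lt_neqAle eq_sym kz psd_diag_ge0.
pose j x y := k x y - (k z.2 z.2)^-1 * (k z.2 x * k z.2 y).
have pj : psd_kernel j.
  apply/psd_kernel_form; split=> [x y|V]; first by rewrite /j pk.1 (mulrC (k _ x)).
  rewrite kernel_formB kernel_formZ kernel_form_rank1 subr_ge0.
  rewrite ler_pdivrMl//.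
  have := kernel_cauchy_schwarz [:: (1, z.2)] V pk.
  rewrite kernel_pairing_evall mul1r.
  by rewrite kernel_form1 expr1n mul1r.
have -> : (fun x y => k x y * k' x y) = (fun x y => j x y * k' x y +
   (k z.2 z.2)^-1 * (k z.2 x * k z.2 y * k' x y)).
  by apply/funext => x; apply/funext => y; rewrite /j; ring.
rewrite kernel_formD kernel_formZ addr_ge0//.
  by apply: vanish => // x; rewrite /j mulrA mulVf// mul1r subrr.
apply: mulr_ge0; first by rewrite invr_ge0 ltW.
have := psd_form_ge0 [seq (w.1 * k z.2 w.2, w.2) | w <- z :: W] pk'.
rewrite /kernel_form /kernel_pairing big_map.
congr (0 <= _); apply: eq_bigr => w _; rewrite big_map.
by apply: eq_bigr => w' _ /=; ring.
Qed.

Lemma psd_prod (I : Type) (r : seq I) (P : pred I) (K : I -> X -> X -> R) :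
  (forall i, P i -> psd_kernel (K i)) ->
  psd_kernel (fun x y => \prod_(i <- r | P i) K i x y).
Proof.
move=> pK; elim: r => [|i r IH].
  have := psd_cst (@ler01 R); congr psd_kernel.
  by apply/funext => x; apply/funext => y; rewrite big_nil.
have [Pi|Pi] := boolP (P i).
  have := psd_mul (pK i Pi) IH; congr psd_kernel.
  by apply/funext => x; apply/funext => y; rewrite big_cons Pi.
move: IH; congr psd_kernel.
by apply/funext => x; apply/funext => y; rewrite big_cons (negbTE Pi).
Qed.

Lemma psd_sum (I : Type) (r : seq I) (P : pred I) (K : I -> X -> X -> R) :
  (forall i, P i -> psd_kernel (K i)) ->
  psd_kernel (fun x y => \sum_(i <- r | P i) K i x y).
Proof.
move=> pK; apply/psd_kernel_form; split=> [x y|W].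
  by apply: eq_bigr => i Pi; rewrite (pK i Pi).1.
by rewrite kernel_form_sum sumr_ge0// => i Pi; exact: psd_form_ge0 (pK i Pi).
Qed.

Lemma psd_comp (Y : Type) (f : Y -> X) k : psd_kernel k ->
  psd_kernel (fun x y => k (f x) (f y)).
Proof. by move=> [sk pk]; split=> // n x a; exact: pk. Qed.

Lemma kernel_pairing_map (Y : Type) (f g : Y -> X) k (V V' : seq (R * Y)) :
  kernel_pairing k [seq (w.1, f w.2) | w <- V] [seq (w.1, g w.2) | w <- V'] =
  kernel_pairing (fun x y => k (f x) (g y)) V V'.
Proof.
rewrite /kernel_pairing big_map; apply: eq_bigr => w _.
by rewrite big_map.
Qed.

(** Evaluating the form of [k] at the combinations [f x + c g x] of point
    masses; with [c = -1] and [k = min] this is the second difference that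
    gives the triangle functions. *)
Lemma psd_pullback (Y : Type) (f g : Y -> X) (c : R) k : psd_kernel k ->
  psd_kernel (fun x y => k (f x) (f y) + c * (k (f x) (g y) + k (g x) (f y)) +
                         c ^+ 2 * k (g x) (g y)).
Proof.
move=> pk; apply/psd_kernel_form; split=> [x y|W].
  by rewrite pk.1 (pk.1 (g x) (g y)) (pk.1 (f x) (g y)) (pk.1 (g x)); ring.
have := psd_form_ge0 ([seq (w.1, f w.2) | w <- W] ++
  scale_points c [seq (w.1, g w.2) | w <- W]) pk.
rewrite kernel_form_cat ?kernel_pairing_scaler ?kernel_form_scale; last by case: pk.
rewrite kernel_formD kernel_formD !kernel_formZ kernel_formD.
rewrite /kernel_form !kernel_pairing_map.
have -> : kernel_pairing (fun x y => k (g x) (f y)) W W =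
          kernel_pairing (fun x y => k (f x) (g y)) W W.
  rewrite /kernel_pairing exchange_big; apply: eq_bigr => i _.
  by apply: eq_bigr => j _; rewrite pk.1 (mulrC j.1).
by congr (0 <= _); ring.
Qed.

Lemma loewner_refl k : (forall x y, k x y = k y x) -> loewner_le k k.
Proof. by move=> sk; apply/loewner_leP; split=> // x y; rewrite !subrr. Qed.

Lemma loewner_trans k2 k1 k3 : loewner_le k1 k2 -> loewner_le k2 k3 ->
  loewner_le k1 k3.
Proof.
move=> h12 h23; have := psd_add h12 h23; congr psd_kernel.
by apply/funext => x; apply/funext => y; ring.
Qed.

Lemma loewner_add k1 k2 k3 k4 : loewner_le k1 k2 -> loewner_le k3 k4 ->
  loewner_le (fun x y => k1 x y + k3 x y) (fun x y => k2 x y + k4 x y).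
Proof.
move=> h12 h34; have := psd_add h12 h34; congr psd_kernel.
by apply/funext => x; apply/funext => y; ring.
Qed.

Lemma loewner_scale c k1 k2 : 0 <= c -> loewner_le k1 k2 ->
  loewner_le (fun x y => c * k1 x y) (fun x y => c * k2 x y).
Proof.
move=> c0 h; have := psd_scale c0 h; congr psd_kernel.
by apply/funext => x; apply/funext => y; ring.
Qed.

Lemma loewner_scalel c c' k : c <= c' -> psd_kernel k ->
  loewner_le (fun x y => c * k x y) (fun x y => c' * k x y).
Proof.
rewrite -subr_ge0 => cc pk; have := psd_scale cc pk; congr psd_kernel.
by apply/funext => x; apply/funext => y; ring.
Qed.

Lemma loewner_psd k1 k2 : psd_kernel k1 -> loewner_le k1 k2 -> psd_kernel k2.
Proof.
move=> p1 h; have := psd_add p1 h; congr psd_kernel.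
by apply/funext => x; apply/funext => y; ring.
Qed.

Lemma loewner_addr k1 k2 : psd_kernel k2 ->
  loewner_le k1 (fun x y => k1 x y + k2 x y).
Proof.
congr psd_kernel.
by apply/funext => x; apply/funext => y; ring.
Qed.

Lemma loewner_mul k1 k2 k3 k4 : psd_kernel k1 -> psd_kernel k3 ->
  loewner_le k1 k2 -> loewner_le k3 k4 ->
  loewner_le (fun x y => k1 x y * k3 x y) (fun x y => k2 x y * k4 x y).
Proof.
move=> p1 p3 h12 h34; have p2 := loewner_psd p1 h12.
have := psd_add (psd_mul h12 p3) (psd_mul p2 h34); congr psd_kernel.
by apply/funext => x; apply/funext => y; ring.
Qed.

Lemma loewner_prod (I : Type) (r : seq I) (P : pred I) (K K' : I -> X -> X -> R) :
  (forall i, P i -> psd_kernel (K i)) ->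
  (forall i, P i -> loewner_le (K i) (K' i)) ->
  loewner_le (fun x y => \prod_(i <- r | P i) K i x y)
             (fun x y => \prod_(i <- r | P i) K' i x y).
Proof.
move=> pK KK; elim: r => [|i r IH].
  have /loewner_refl : forall x y : X, \prod_(i <- [::] | P i) K i x y =
     \prod_(i <- [::] | P i) K i y x by move=> x y; rewrite !big_nil.
  congr loewner_le.
  by apply/funext => x; apply/funext => y; rewrite !big_nil.
have [Pi|Pi] := boolP (P i).
  have := loewner_mul (pK i Pi) (psd_prod r pK) (KK i Pi) IH.
  by congr loewner_le;
    apply/funext => x; apply/funext => y; rewrite big_cons Pi.
by move: IH; congr loewner_le;
  apply/funext => x; apply/funext => y; rewrite big_cons (negbTE Pi).
Qed.

Lemma loewner_sum (I : Type) (r : seq I) (P : pred I) (K K' : I -> X -> X -> R) :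
  (forall i, P i -> loewner_le (K i) (K' i)) ->
  loewner_le (fun x y => \sum_(i <- r | P i) K i x y)
             (fun x y => \sum_(i <- r | P i) K' i x y).
Proof.
move=> KK; have := psd_sum r KK; congr psd_kernel.
by apply/funext => x; apply/funext => y; rewrite sumrB.
Qed.

Lemma loewner_comp (Y : Type) (f : Y -> X) k k' : loewner_le k k' ->
  loewner_le (fun x y => k (f x) (f y)) (fun x y => k' (f x) (f y)).
Proof. exact: (@psd_comp Y f (fun x y => k' x y - k x y)). Qed.

(** Cauchy-Schwarz between a point mass at [z] and an arbitrary combination of
    points. *)
Lemma loewner_section k z : psd_kernel k ->
  loewner_le (fun x y => k z x * k z y) (fun x y => k z z * k x y).
Proof.
move=> pk; apply/loewner_leP; split=> [x y|W]; first by rewrite pk.1 (mulrC (k z x)).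
rewrite kernel_formZ kernel_form_rank1.
have := kernel_cauchy_schwarz [:: (1, z)] W pk.
rewrite kernel_pairing_evall mul1r.
by rewrite kernel_form1 expr1n mul1r.
Qed.

End PsdCalculus.

(** * The kernel 1 + min and convex functions of the distance *)

Section MinKernel.
Variable R : realType.

Lemma seq_argmin (V : seq (R * R)) : V != [::] ->
  exists2 w, w \in V & forall w', w' \in V -> w.2 <= w'.2.
Proof.
elim: V => // v [|v' V] IH _.
  by exists v; rewrite ?mem_seq1// => w'; rewrite mem_seq1 => /eqP ->.
have [//|w wV wmin] := IH.
have [vw|wv] := leP v.2 w.2.
  exists v; first by rewrite mem_head.
  by move=> w'; rewrite inE => /predU1P[->//|/wmin]; exact: le_trans.
exists w; first by rewrite inE wV orbT.
by move=> w'; rewrite inE => /predU1P[->|/wmin//]; exact: ltW.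
Qed.

(** Splitting off the smallest value [m], the constant kernel [m] contributes a
    square and [min - m] no longer sees the points where the minimum is reached. *)
Lemma min_form_ge0 (V : seq (R * R)) : (forall w, w \in V -> 0 <= w.2) ->
  0 <= kernel_form (fun x y : R => Num.min x y) V.
Proof.
have [n] := ubnP (size V); elim: n V => // n IH V sV V0.
have [->|Vn] := eqVneq V [::]; first by rewrite /kernel_form /kernel_pairing big_nil.
have [w0 w0V wmin] := seq_argmin Vn; set m := w0.2 in wmin.
have -> : kernel_form (fun x y : R => Num.min x y) V =
    m * eval_points (fun=> 1) V ^+ 2 +
    kernel_form (fun x y => Num.min (x - m) (y - m)) V.
  rewrite -kernel_form_rank1 -kernel_formZ -kernel_formD; congr kernel_form.
  by apply/funext => x; apply/funext => y; rewrite !mulr1 addr_minr !subrKC.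
apply: addr_ge0; first by apply: mulr_ge0; [exact: V0|exact: sqr_ge0].
pose V' := [seq (w.1, w.2 - m) | w <- V & m < w.2].
have -> : kernel_form (fun x y => Num.min (x - m) (y - m)) V =
          kernel_form (fun x y : R => Num.min x y) V'.
  rewrite /V' /kernel_form (kernel_pairing_map (fun t => t - m) (fun t => t - m)) /kernel_pairing big_filter.
  rewrite [RHS]big_mkcond/=; apply: eq_big_seq => w wV.
  case: ifPn => mw.
    rewrite big_filter [RHS]big_mkcond; apply: eq_big_seq => w' w'V.
    case: ifPn => //; rewrite -leNgt => w'm.
    have -> : w'.2 = m by apply/eqP; rewrite eq_le w'm wmin.
    by rewrite subrr min_r ?mulr0// subr_ge0 wmin.
  rewrite big_seq big1// => w' w'V.
  have -> : w.2 = m by apply/eqP; rewrite eq_le wmin// leNgt mw.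
  by rewrite subrr min_l ?mulr0// subr_ge0 wmin.
apply: IH => [|w /mapP[w' + ->]]/=; last first.
  by rewrite mem_filter => /andP[/ltW]; rewrite subr_ge0.
rewrite size_map size_filter; apply: leq_trans (sV : (size V <= n)%N).
rewrite -(count_predC (fun w => m < w.2) V).
rewrite -[X in (X < _)%N]addn0 ltn_add2l -has_count; apply/hasP; exists w0 => //=.
by rewrite ltxx.
Qed.

Lemma psd_min (X : Type) (g : X -> R) : (forall x, 0 <= g x) ->
  psd_kernel (fun x y => Num.min (g x) (g y)).
Proof.
move=> g0; apply/psd_kernel_form; split=> [x y|W]; first exact: minC.
have := @min_form_ge0 [seq (w.1, g w.2) | w <- W].
rewrite /kernel_form kernel_pairing_map => H; apply: H => w.
by elim: W => // v W IH; rewrite inE => /predU1P[->|/IH]//=.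
Qed.

Section UnitValued.
Variables (X : Type) (g : X -> R).
Hypothesis g01 : forall x, 0 <= g x <= 1.

Let g0 x : 0 <= g x. Proof. by case/andP: (g01 x). Qed.
Let g1 x : g x <= 1. Proof. by case/andP: (g01 x). Qed.

Lemma psd_1Dmin : psd_kernel (fun x y => 1 + Num.min (g x) (g y)).
Proof. by apply: psd_add; [exact: psd_cst|exact: psd_min]. Qed.

Lemma loewner_min_1Dmin :
  loewner_le (fun x y => Num.min (g x) (g y)) (fun x y => 1 + Num.min (g x) (g y)).
Proof.
have := loewner_addr (fun x y => Num.min (g x) (g y)) (psd_cst X (@ler01 R)).
by congr loewner_le; apply/funext => x; apply/funext => y; rewrite addrC.
Qed.

(** The product [g x * g y] comes from the section of [min] at 1. *)
Lemma loewner_mul_min :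
  loewner_le (fun x y => g x * g y) (fun x y => Num.min (g x) (g y)).
Proof.
have pm := @psd_min R (fun x => Num.max 0 x) (fun x => ltac:(by rewrite le_max lexx)).
have := loewner_comp g (loewner_section 1 pm); congr loewner_le.
  apply/funext => x; apply/funext => y.
  by rewrite !(max_r ler01) !max_r// !min_r.
apply/funext => x; apply/funext => y.
by rewrite !(max_r ler01) !max_r// minxx mul1r.
Qed.

End UnitValued.

Section Polya.
Variables (X : Type) (g : X -> R).
Hypothesis g01 : forall x, 0 <= g x <= 1.

Let g0 x : 0 <= g x. Proof. by case/andP: (g01 x). Qed.
Let g1 x : g x <= 1. Proof. by case/andP: (g01 x). Qed.

(** The triangle function as a second difference of [min]. *)
Lemma triangle_min (s t a : R) : 0 <= s -> 0 <= t -> 0 <= a ->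
  Num.min (s + a) (t + a) - (Num.min (s + a) t + Num.min s (t + a)) + Num.min s t =
  Num.max 0 (a - `|s - t|).
Proof.
move=> s0 t0 a0; rewrite !minEle !maxEle.
have [st|st] := leP s t.
  by rewrite ler0_norm ?subr_le0// lerD2r st; do !case: ifPn; rewrite -?ltNge; lra.
by rewrite gtr0_norm ?subr_gt0// lerD2r leNgt st/=; do !case: ifPn; rewrite -?ltNge; lra.
Qed.

Definition triangle_kernel (a : R) (x y : X) : R := Num.max 0 (a - `|g x - g y|).

Lemma psd_triangle a : 0 <= a -> psd_kernel (triangle_kernel a).
Proof.
move=> a0.
have pm := @psd_min R (fun x => Num.max 0 x) (fun x => ltac:(by rewrite le_max lexx)).
have := psd_pullback (fun x => g x + a) g (-1) pm; congr psd_kernel.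
apply/funext => x; apply/funext => y.
rewrite !(max_r (addr_ge0 _ a0))// !max_r// sqrrN expr1n mul1r mulN1r.
exact: triangle_min.
Qed.

(** Adding the mixed terms of the second difference, instead of subtracting
    them, gives again a psd kernel. *)
Lemma triangle_le a : 0 <= a <= 1 ->
  loewner_le (triangle_kernel a) (fun x y => 2 + 4 * Num.min (g x) (g y)).
Proof.
move=> /andP[a0 a1].
have pm := @psd_min R (fun x => Num.max 0 x) (fun x => ltac:(by rewrite le_max lexx)).
have p2 := psd_pullback (fun x => g x + a) g 1 pm.
have pc : psd_kernel (fun _ _ : X => 2 - 2 * a) by apply: psd_cst; lra.
have := psd_add pc p2; congr psd_kernel.
apply/funext => x; apply/funext => y.
rewrite !(max_r (addr_ge0 _ a0))// !max_r// expr1n !mul1r.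
by rewrite /triangle_kernel -triangle_min// -addr_minl; ring.
Qed.

Variables (phi d : R -> R) (L : R).
Hypothesis dL : forall x, 0 <= x <= 1 -> 0 <= d x <= L.
Hypothesis phid : forall x y, 0 <= x <= 1 -> 0 <= y <= 1 ->
  phi x - d x * (y - x) <= phi y.

Local Notation hinges C r := (\sum_(c <- C) c.1 * Num.max 0 (c.2 - r)).
Local Notation slope C := (\sum_(c <- C) c.1).

Definition hinge_list (C : seq (R * R)) :=
  forall c, c \in C -> 0 <= c.1 /\ 0 <= c.2 <= 1.

(** Interpolating [phi] at finitely many points from the right to the left,
    one hinge per knot. The hinges that have been placed are all at or beyond
    the last knot [b], so that the interpolant is linear of slope [- slope C]
    below [b], and convexity makes the next change of slope nonnegative. *)
Lemma hinge_interpolation_from (K : seq R) : forall (b : R) (C : seq (R * R)),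
  0 <= b <= 1 -> path (fun x y => y < x) b K -> (forall r, r \in K -> 0 <= r) ->
  hinge_list C -> (forall c, c \in C -> b <= c.2) -> slope C <= L ->
  phi b = phi 1 + hinges C b ->
  (forall c, 0 <= c <= b -> slope C * (b - c) <= phi c - phi b) ->
  exists C', [/\ hinge_list C', slope C' <= L,
    forall r, b <= r -> hinges C' r = hinges C r
    & forall r, r \in K -> phi r = phi 1 + hinges C' r].
Proof.
elim: K => [|c K IH] b C b01 /= pK K0 hC Cb CL phib Cslope.
  by exists C; split.
move: pK => /andP[cb pK].
have c0 : 0 <= c by apply: K0; rewrite mem_head.
have /andP[b0 b1] := b01.
have c01 : 0 <= c <= 1 by rewrite c0 (le_trans (ltW cb)).
have bc : 0 < b - c by rewrite subr_gt0.
pose de := (phi c - phi b) / (b - c) - slope C.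
have de0 : 0 <= de.
  by rewrite subr_ge0 ler_pdivlMr// Cslope// c0 ltW.
have sC : slope ((de, b) :: C) = (phi c - phi b) / (b - c).
  by rewrite big_cons subrK.
have Cc r : r <= b -> hinges C r = hinges C b + slope C * (b - r).
  move=> rb; rewrite mulr_suml -big_split/=; apply: eq_big_seq => a aC.
  by rewrite !max_r ?subr_ge0 ?Cb// ?(le_trans rb) ?Cb//; ring.
have [||||||C' [hC' C'L C'r C'K]] := IH c ((de, b) :: C) c01 pK.
- by move=> r rK; apply: K0; rewrite inE rK orbT.
- by move=> a; rewrite inE => /predU1P[->//|/hC].
- move=> a; rewrite inE => /predU1P[->/=|/Cb]; first exact: ltW.
  exact: le_trans (ltW cb).
- rewrite sC ler_pdivrMr//; have := phid c01 b01.
  have /andP[_ dcL] := dL c01; nra.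
- rewrite big_cons/= (Cc c (ltW cb)) max_r; last exact: ltW.
  by rewrite /de phib; field; rewrite gt_eqF.
- move=> c' /andP[c'0 c'c]; rewrite sC mulrAC ler_pdivrMr//.
  have c'01 : 0 <= c' <= 1 by rewrite c'0 (le_trans c'c)//; case/andP: c01.
  have := phid c01 b01; have := phid c01 c'01.
  have : 0 <= c - c' by rewrite subr_ge0.
  nra.
have C'r2 r : b <= r -> hinges C' r = hinges C r.
  move=> br; rewrite C'r ?(le_trans (ltW cb))//.
  by rewrite big_cons/= max_l ?mulr0 ?add0r// subr_le0.
exists C'; split=> // r; rewrite inE => /predU1P[->|rK]; last exact: C'K.
rewrite C'r// big_cons/= (Cc c (ltW cb)) max_r; last exact: ltW.
by rewrite /de phib; field; rewrite gt_eqF.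
Qed.

Lemma hinge_interpolation (K : seq R) : (forall r, r \in K -> 0 <= r <= 1) ->
  exists C, [/\ hinge_list C, slope C <= L
    & forall r, r \in K -> phi r = phi 1 + hinges C r].
Proof.
move=> K01; pose K' := rev (sort <=%R (undup [seq r <- K | r < 1])).
have o01 : 0 <= (1 : R) <= 1 by rewrite ler01 lexx.
have memK' r : r \in K' = (r < 1) && (r \in K).
  by rewrite mem_rev mem_sort mem_undup mem_filter.
have [|||||||C [hC CL C1 CK]] := @hinge_interpolation_from K' 1 [::] o01.
- rewrite path_sortedE; last by move=> y x z xy yz; apply: lt_trans; [exact: yz|exact: xy].
  apply/andP; split; first by apply/allP => r; rewrite memK' => /andP[].
  by rewrite /K' rev_sorted sort_lt_sorted undup_uniq.
- by move=> r; rewrite memK' => /andP[_ /K01/andP[]].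
- by [].
- by [].
- by rewrite big_nil; have /andP[] := dL o01; exact: le_trans.
- by rewrite big_nil addr0.
- move=> c c01; rewrite big_nil mul0r subr_ge0.
  have := phid o01 c01; have /andP[d0 _] := dL o01; case/andP: c01 => c0 c1; nra.
exists C; split=> // r rK; have /andP[r0 r1] := K01 _ rK.
have [r1'|r1'] := ltP r 1; first by rewrite CK// memK' r1'.
have -> : r = 1 by apply/eqP; rewrite eq_le r1.
by rewrite C1// big_nil addr0.
Qed.

(** On finitely many points [phi] is [phi 1] plus a nonnegative combination of
    triangle functions [(a - r)_+], whose total weight is bounded by the slope
    of [phi]. *)
Lemma convex_form (W : seq (R * X)) : 0 <= phi 1 ->
  0 <= kernel_form (fun x y => phi `|g x - g y|) W <=
  kernel_form (fun x y => phi 1 + L * (2 + 4 * Num.min (g x) (g y))) W.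
Proof.
move=> phi10; pose V := [seq (w.1, g w.2) | w <- W].
have V01 w : w \in V -> 0 <= w.2 <= 1.
  rewrite /V; elim: W {V} => // v W IH.
  by rewrite inE => /predU1P[->|/IH]//=.
have [|C [hC CL CK]] := @hinge_interpolation
    [seq `|w.2 - w'.2| | w <- V, w' <- V].
  move=> r /allpairsP[[w w']/= [/V01/andP[w0 w1] /V01/andP[w'0 w'1] ->]].
  by rewrite normr_ge0/= ler_norml; apply/andP; split; lra.
have -> : kernel_form (fun x y => phi `|g x - g y|) W = kernel_form (fun x y =>
    phi 1 + \sum_(c <- C) c.1 * triangle_kernel c.2 x y) W.
  have := @kernel_pairing_map R R X g g (fun s t => phi `|s - t|) W W.
  have := @kernel_pairing_map R R X g g (fun s t => phi 1 +
    \sum_(c <- C) c.1 * Num.max 0 (c.2 - `|s - t|)) W W.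
  rewrite /kernel_form /triangle_kernel => <- <-.
  apply: eq_big_seq => w wV; apply: eq_big_seq => w' w'V.
  by congr (_ * _); apply: CK; apply/allpairsP; exists (w, w').
have p1 := psd_cst X phi10.
rewrite !kernel_formD kernel_formZ kernel_form_sum; set S := \sum_(c <- C) _.
pose B := kernel_form (fun x y => 2 + 4 * Num.min (g x) (g y)) W.
have SE : S = \sum_(c <- C) c.1 * kernel_form (triangle_kernel c.2) W.
  by apply: eq_bigr => c _; rewrite kernel_formZ.
have S0 : 0 <= S.
  rewrite SE big_seq sumr_ge0// => c /hC[c0 /andP[c2 _]].
  by rewrite mulr_ge0// psd_form_ge0//; exact: psd_triangle.
rewrite addr_ge0 ?psd_form_ge0//= lerD2l -/B.
have B0 : 0 <= B.
  apply: psd_form_ge0; apply: psd_add; first exact: psd_cst.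
  by apply: psd_scale => //; exact: psd_min.
apply: (@le_trans _ _ ((\sum_(c <- C) c.1) * B)); last exact: ler_wpM2r.
rewrite SE mulr_suml big_seq [X in _ <= X]big_seq ler_sum// => c /hC[c0 c2].
by rewrite ler_wpM2l// loewner_form//; exact: triangle_le.
Qed.

Lemma psd_convex : 0 <= phi 1 -> psd_kernel (fun x y => phi `|g x - g y|).
Proof.
move=> phi1; apply/psd_kernel_form; split=> [x y|W]; first by rewrite distrC.
by have /andP[] := convex_form W phi1.
Qed.

Lemma convex_le : 0 <= phi 1 -> loewner_le (fun x y => phi `|g x - g y|)
  (fun x y => phi 1 + L * (2 + 4 * Num.min (g x) (g y))).
Proof.
move=> phi1; apply/loewner_leP; split=> [x y|W]; first by rewrite distrC minC.
by have /andP[] := convex_form W phi1.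
Qed.

End Polya.

Section IntervalKernels.
Variables (X : Type) (g : X -> R).
Hypothesis g01 : forall x, 0 <= g x <= 1.

Let g0 x : 0 <= g x. Proof. by case/andP: (g01 x). Qed.
Let g1 x : g x <= 1. Proof. by case/andP: (g01 x). Qed.

Lemma power_tangent (m : nat) (u v : R) : 0 <= u -> 0 <= v ->
  v ^+ m + m%:R * v ^+ m.-1 * (u - v) <= u ^+ m.
Proof.
move=> u0 v0; elim: m => [|m IH]; first by rewrite !expr0 !mul0r addr0.
case: m IH => [|m] IH; first by rewrite !expr1 expr0; lra.
rewrite [u ^+ _]exprS; apply: le_trans (ler_wpM2l u0 IH); rewrite -subr_ge0 /=.
have -> : u * (v ^+ m.+1 + m.+1%:R * v ^+ m * (u - v)) -
  (v ^+ m.+2 + m.+2%:R * v ^+ m.+1 * (u - v)) =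
  m.+1%:R * v ^+ m * (u - v) ^+ 2 by rewrite -[m.+2%:R]natr1 !exprS; ring.
by apply: mulr_ge0 (sqr_ge0 _); apply: mulr_ge0; rewrite ?exprn_ge0.
Qed.

(** The function [(1 - r) ^ m] is convex with slopes between [- m] and 0,
    which is why the bound is linear in [m]: the moment of order [p] of the
    depth is what [p] such factors require. *)
Lemma triangle_power_le (m : nat) :
  loewner_le (fun x y => (1 - `|g x - g y|) ^+ m)
             (fun x y => (4 * m.+1%:R) * (1 + Num.min (g x) (g y))).
Proof.
have dL (x : R) : 0 <= x <= 1 -> 0 <= m%:R * (1 - x) ^+ m.-1 <= m%:R.
  move=> /andP[x0 x1]; rewrite mulr_ge0 ?exprn_ge0 ?subr_ge0//=.
  by rewrite ler_piMr// exprn_ile1 ?subr_ge0// gerBl.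
have ph (x y : R) : 0 <= x <= 1 -> 0 <= y <= 1 ->
    (1 - x) ^+ m - m%:R * (1 - x) ^+ m.-1 * (y - x) <= (1 - y) ^+ m.
  move=> /andP[x0 x1] /andP[y0 y1].
  have -> : (1 - x) ^+ m - m%:R * (1 - x) ^+ m.-1 * (y - x) =
    (1 - x) ^+ m + m%:R * (1 - x) ^+ m.-1 * ((1 - y) - (1 - x)) by ring.
  by apply: power_tangent; rewrite subr_ge0.
have p1 : 0 <= ((1 : R) - 1) ^+ m by rewrite subrr exprn_ge0.
apply: loewner_trans (convex_le g01 dL ph p1) _.
rewrite subrr.
have e0 : 0 <= (0 : R) ^+ m <= 1 by case: m {dL ph p1} => [|m]; rewrite ?expr0 ?expr0n//= lexx ler01.
have pc : psd_kernel (fun _ _ : X => 4 - 0 ^+ m + 2 * m%:R : R).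
  by apply: psd_cst; have := ler0n R m; case/andP: e0; lra.
have p2 := psd_scale (ler0n R 4) (@psd_min X g g0).
have := psd_add pc p2; congr psd_kernel; apply/funext => x; apply/funext => y.
by rewrite -natr1; ring.
Qed.

Lemma triangle_ge :
  loewner_le (fun x y => 4^-1 * (1 + Num.min (g x) (g y)))
             (fun x y => 1 - `|g x - g y|).
Proof.
have h01 x : 0 <= 1 - g x <= 1 by rewrite subr_ge0 g1 gerBl g0.
have E x y : 1 - `|g x - g y| = Num.min (g x) (g y) + Num.min (1 - g x) (1 - g y).
  rewrite !minEle; have [st|st] := leP (g x) (g y).
    by rewrite ler0_norm ?subr_le0//; case: ifPn; rewrite -?ltNge; lra.
  by rewrite gtr0_norm ?subr_gt0//; case: ifPn; rewrite -?ltNge; lra.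
have q1 := loewner_mul_min g01.
have q2 := loewner_mul_min h01.
(* with s := g x and t := g y, 1 = (s + (1 - s)) (t + (1 - t)) is at most
   2 s t + 2 (1 - s) (1 - t) *)
have q3 : psd_kernel (fun x y => 4^-1 * ((2 * g x - 1) * (2 * g y - 1))).
  by apply: psd_scale; [rewrite invr_ge0|exact: (psd_rank1 (fun x => 2 * g x - 1))].
have h0 x : 0 <= 1 - g x by case/andP: (h01 x).
have p4 : psd_kernel (fun x y => 2^-1 * Num.min (1 - g x) (1 - g y)).
  by apply: psd_scale; [rewrite invr_ge0|exact: psd_min].
have i0 : 0 <= (2^-1 : R) by rewrite invr_ge0.
have i4 : 0 <= (4^-1 : R) by rewrite invr_ge0.
have p5 := psd_scale i4 (@psd_min X g g0).
have := psd_add (psd_add (psd_scale i0 q1) (psd_scale i0 q2)) (psd_add q3 (psd_add p4 p5)).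
congr psd_kernel; apply/funext => x; apply/funext => y; by rewrite E; field.
Qed.

Lemma expRN_tangent (x y : R) : expR (- x) - expR (- x) * (y - x) <= expR (- y).
Proof.
have -> : - y = - x + (x - y) by ring.
by rewrite expRD; have := expR_ge1Dx (x - y); have := expR_gt0 (- x); nra.
Qed.

Lemma psd_exp : psd_kernel (fun x y => expR (- `|g x - g y|)).
Proof.
apply: (@psd_convex X g g01 (fun r => expR (- r)) (fun r => expR (- r)) 1).
- by move=> x /andP[x0 x1]; rewrite expR_ge0 -expR0 ler_expR oppr_le0.
- by move=> x y _ _; exact: expRN_tangent.
- exact: expR_ge0.
Qed.

Lemma exp_le : loewner_le (fun x y => expR (- `|g x - g y|))
  (fun x y => 4 * (1 + Num.min (g x) (g y))).
Proof.
have dL (x : R) : 0 <= x <= 1 -> 0 <= expR (- x) <= 1.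
  by move=> /andP[x0 x1]; rewrite expR_ge0 -expR0 ler_expR oppr_le0.
apply: (loewner_trans (convex_le g01 dL (fun x y _ _ => expRN_tangent x y) (expR_ge0 _))).
have p1 : psd_kernel (fun _ _ : X => 2 - expR (-1) : R).
  apply: psd_cst; have : expR (-1) <= expR (0 : R) by rewrite ler_expR oppr_le0.
  by rewrite expR0; lra.
by move: p1; congr psd_kernel; apply/funext => x; apply/funext => y; ring.
Qed.

(** The difference [exp (- r) - exp (- 1) (1 - r)] is still convex and
    nonincreasing on the unit interval. *)
Lemma exp_ge : loewner_le (fun x y => expR (- 1) * (1 - `|g x - g y|))
  (fun x y => expR (- `|g x - g y|)).
Proof.
apply: (@psd_convex X g g01 (fun r => expR (- r) - expR (- 1) * (1 - r))
    (fun r => expR (- r) - expR (- 1)) 1).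
- move=> x /andP[x0 x1]; rewrite subr_ge0 ler_expR lerN2 x1/=.
  rewrite lerBlDr ler_wpDr ?expR_ge0// -[leRHS]expR0 ler_expR oppr_le0//.
- by move=> x y _ _; have := expRN_tangent x y; lra.
- by rewrite subrr mulr0 subr0 expR_ge0.
Qed.

End IntervalKernels.
End MinKernel.

(** * Membership in a reproducing kernel Hilbert space *)

Section DominatedFunctions.
Variables (R : realType) (X : Type) (k : X -> X -> R).
Hypothesis pk : psd_kernel k.

(** The function [h] has squared norm at most [M] in the reproducing kernel
    space of [k]: this is the form of membership that Loewner inequalities
    transport. *)
Definition kernel_dominated (h : X -> R) (M : R) : Prop :=
  forall W, eval_points h W ^+ 2 <= M * kernel_form k W.

Definition difference_points (W W' : seq (R * X)) := W ++ scale_points (- 1) W'.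

Lemma kernel_form_difference W W' : kernel_form k (difference_points W W') =
  kernel_form k W - 2 * kernel_pairing k W W' + kernel_form k W'.
Proof.
rewrite kernel_form_cat; last by case: pk.
by rewrite kernel_pairing_scaler kernel_form_scale; ring.
Qed.

(** A Riesz representation without a space: maximizing the concave functional
    [J = 2 * eval_points h - kernel_form k]. A maximizing sequence is Cauchy
    by the parallelogram law, and its values at [x] tend to [h x] because
    moving it in the direction of the section at [x] cannot increase [J]
    beyond its supremum. *)
Lemma dominated_approximation (h : X -> R) (M : R) : 0 <= M -> kernel_dominated h M ->
  exists W : nat -> seq (R * X), [/\
    forall n x, (h x - eval_points (k x) (W n)) ^+ 2 <= n.+1%:R^-1 * k x x,
    forall n m, kernel_form k (difference_points (W n) (W m)) <=
      2 * (n.+1%:R^-1 + m.+1%:R^-1)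
    & forall n, kernel_form k (W n) <= 4 * M].
Proof.
move=> M0 hM; pose J W := 2 * eval_points h W - kernel_form k W.
have Q0 W : 0 <= kernel_form k W by exact: psd_form_ge0.
have J0 : J [::] = 0.
  by rewrite /J /eval_points /kernel_form /kernel_pairing !big_nil mulr0 subr0.
have JM W : J W <= M.
  rewrite /J leNgt; apply/negP => MJ; have := hM W; have := Q0 W.
  set l := eval_points h W in MJ *; set q := kernel_form k W in MJ * => q0 lq.
  by have := sqr_ge0 (M - q); nra.
have supJ : has_sup (range J).
  by split; [exists 0, [::]|exists M => _ [W _ <-]].
pose S := sup (range J).
have JS W : J W <= S by apply: ub_le_sup; [case: supJ|exists W].
have S0 : 0 <= S by rewrite -J0.
have HW n : exists W, S - n.+1%:R^-1 <= J W /\ 0 <= J W.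
  have n0 : 0 < (n.+1%:R^-1 : R) by rewrite invr_gt0.
  have [Sn|Sn] := leP S n.+1%:R^-1.
    by exists [::]; rewrite J0 lexx subr_le0.
  have [_ [W _ <-] SW] := sup_adherent n0 supJ.
  by exists W; split; rewrite ltW//; apply: lt_trans SW; rewrite subr_gt0.
pose W n := projT1 (cid (HW n)).
have WS n : S <= J (W n) + n.+1%:R^-1.
  by rewrite -lerBlDr; case: (projT2 (cid (HW n))).
have W0 n : 0 <= J (W n) by case: (projT2 (cid (HW n))).
exists W; split=> [n x|n m|n].
- have sk := pk.1.
  (* no perturbation of [W n] by a point mass at [x] gains more than 1 / (n + 1) *)
  rewrite -sqrrN; apply: discriminant_le => t.
  have := le_trans (JS (W n ++ [:: (t, x)])) (WS n).
  rewrite /J eval_points_cat eval_points1 kernel_form_cat//.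
  rewrite (kernel_pairingC _ _ sk) kernel_pairing_evall.
  by rewrite kernel_form1; move: (n.+1%:R^-1) => v; lra.
- (* the parallelogram law at the midpoint of [W n] and [W m] *)
  have := JS (scale_points 2^-1 (W n ++ W m)); have := WS n; have := WS m.
  rewrite /J eval_points_scale kernel_form_scale eval_points_cat.
  rewrite kernel_form_cat; last by case: pk.
  rewrite kernel_form_difference.
  have -> : (2^-1 : R) ^+ 2 = 4^-1 by field.
  by move: (n.+1%:R^-1) (m.+1%:R^-1) => v v'; lra.
- have := W0 n; rewrite /J subr_ge0; set l := eval_points h _.
  set q := kernel_form k _ => ql.
  have lq : l ^+ 2 <= M * q by exact: hM.
  have q0 : 0 <= q by exact: Q0.
  have [->|qn] := eqVneq q 0; first by rewrite mulr_ge0.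
  have qp : 0 < q by rewrite lt_neqAle eq_sym qn q0.
  have l0 : 0 <= l by lra.
  rewrite -(ler_pM2r qp).
  have : q * q <= (2 * l) * (2 * l) by apply: ler_pM.
  by move: lq; rewrite expr2; lra.
Qed.

End DominatedFunctions.

Section ReproducingKernelSpace.
Variables (R : realType) (X : Type) (k : X -> X -> R).
Variables (H : set (X -> R)) (ip : (X -> R) -> (X -> R) -> R).
Hypothesis rk : rkhs_of k H ip.

Let hil := rkhs_hilbert rk.

Definition section_sum (W : seq (R * X)) : X -> R :=
  fun y => \sum_(w <- W) w.1 * k w.2 y.

Lemma section_sum_cons w W :
  section_sum (w :: W) = (fun y => w.1 * k w.2 y + section_sum W y).
Proof. by apply/funext => y; rewrite /section_sum big_cons. Qed.

Lemma section_sum_nil : section_sum [::] = (fun=> 0).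
Proof. by apply/funext => y; rewrite /section_sum big_nil. Qed.

Lemma rkhs_section_sum W : H (section_sum W).
Proof.
elim: W => [|w W IH]; first by rewrite section_sum_nil; exact: hfs_zero hil.
by rewrite section_sum_cons; apply: (hfs_lin hil) => //; exact: rkhs_section rk _.
Qed.

Lemma ip_zerol f : H f -> ip (fun=> 0) f = 0.
Proof.
move=> Hf; have H0 := hfs_zero hil.
have := hfs_ip_lin hil 1 H0 H0 Hf.
rewrite (_ : (fun x : X => 1 * 0 + 0) = (fun=> 0 : R)); last first.
  by apply/funext => x; rewrite mulr0 addr0.
by lra.
Qed.

(** The reproducing property, extended by linearity. *)
Lemma ip_section_sum W f : H f -> ip (section_sum W) f = eval_points f W.
Proof.
move=> Hf; elim: W => [|w W IH].
  by rewrite section_sum_nil ip_zerol// /eval_points big_nil.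
have Hk := rkhs_section rk w.2.
rewrite section_sum_cons (hfs_ip_lin hil)//; last exact: rkhs_section_sum.
rewrite IH /eval_points big_cons; congr (_ * _ + _).
by rewrite (hfs_ip_sym hil)// (rkhs_reproducing rk).
Qed.

Lemma ip_cauchy_schwarz f g : H f -> H g -> ip f g ^+ 2 <= ip f f * ip g g.
Proof.
move=> Hf Hg; apply: discriminant_le => t.
have Hfg : H (fun x => t * g x + f x) by exact: (hfs_lin hil).
have := hfs_ip_ge0 hil Hfg; rewrite (hfs_ip_lin hil)//.
rewrite (hfs_ip_sym hil Hg Hfg) (hfs_ip_sym hil Hf Hfg) !(hfs_ip_lin hil)//.
by rewrite (hfs_ip_sym hil Hg Hf); lra.
Qed.

Lemma kernel_symmetric x y : k x y = k y x.
Proof.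
have Hx := rkhs_section rk x; have Hy := rkhs_section rk y.
by rewrite -(rkhs_reproducing rk y Hx) (hfs_ip_sym hil)// (rkhs_reproducing rk).
Qed.

Lemma ip_section_sum2 W W' :
  ip (section_sum W) (section_sum W') = kernel_pairing k W W'.
Proof.
rewrite ip_section_sum ?kernel_pairing_eval; last exact: rkhs_section_sum.
apply: eq_bigr => w _; congr (_ * _).
by apply: eq_bigr => w' _; rewrite kernel_symmetric.
Qed.

Lemma rkhs_psd : psd_kernel k.
Proof.
apply/psd_kernel_form; split=> [|W]; first exact: kernel_symmetric.
rewrite /kernel_form -ip_section_sum2.
by apply: (hfs_ip_ge0 hil); exact: rkhs_section_sum.
Qed.

Lemma rkhs_dominated h : H h -> kernel_dominated k h (ip h h).
Proof.
move=> Hh W; rewrite -ip_section_sum// mulrC /kernel_form -ip_section_sum2.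
by apply: ip_cauchy_schwarz => //; exact: rkhs_section_sum.
Qed.

Lemma section_sum_difference W W' : section_sum (difference_points W W') =
  (fun x => section_sum W x - section_sum W' x).
Proof.
apply/funext => x; rewrite /section_sum big_cat; congr (_ + _).
by rewrite big_map -sumrN; apply: eq_bigr => w _ /=; rewrite mulN1r mulNr.
Qed.

Lemma hfs_sub f g : H f -> H g -> H (fun x => f x - g x).
Proof.
move=> Hf Hg; have := hfs_lin hil (-1) Hg Hf; congr H.
by apply/funext => x; rewrite mulN1r addrC.
Qed.

Lemma ip_subl f g h : H f -> H g -> H h ->
  ip (fun x => f x - g x) h = ip f h - ip g h.
Proof.
move=> Hf Hg Hh; have := hfs_ip_lin hil (-1) Hg Hf Hh.
rewrite mulN1r addrC => <-; congr ip.
by apply/funext => x; rewrite mulN1r addrC.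
Qed.

(** The approximating combinations of sections converge in the space because
    it is complete, and the limit is [h] because evaluations are continuous.
    The constant 4 is not sharp: only the order of the norm matters. *)
Lemma dominated_rkhs (h : X -> R) (M : R) : 0 <= M -> kernel_dominated k h M ->
  H h /\ ip h h <= 4 * M.
Proof.
move=> M0 hM; have pk := rkhs_psd.
have [W [Wh WC WM]] := dominated_approximation pk M0 hM.
pose u n := section_sum (W n).
have Hu n : H (u n) by exact: rkhs_section_sum.
have [|f Hf uf] := hfs_complete hil Hu.
  move=> e e0; have e2 : 0 < e ^+ 2 / 4 by rewrite divr_gt0// exprn_gt0.
  have [n _ ne] := near_infty_natSinv_lt (PosNum e2).
  exists n => m m' nm nm'.
  rewrite /u -section_sum_difference /ip_norm ip_section_sum2.
  rewrite -(ger0_norm (ltW e0)) -sqrtr_sqr ltr_sqrt ?exprn_gt0//.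
  have := ne m nm; have := ne m' nm' => /=.
  have := WC m m'; rewrite /kernel_form.
  by move: (m.+1%:R^-1) (m'.+1%:R^-1) => v v'; lra.
have hx : f = h.
  apply/funext => x; apply/eqP; rewrite -subr_eq0 -sqrf_eq0 eq_le sqr_ge0 andbT.
  have kx := psd_diag_ge0 x pk.
  apply/ler_addgt0Pr => e e0; rewrite add0r.
  have d0 : 0 < e / (4 * (k x x + 1)) by rewrite divr_gt0// mulr_gt0// ltr_wpDl.
  have [n1 _ ne] := near_infty_natSinv_lt (PosNum d0).
  have s0 : 0 < Num.sqrt (e / (4 * (k x x + 1))) by rewrite sqrtr_gt0.
  move/cvgrPdist_lt : uf => /(_ _ s0)[n2 _ uf].
  pose n := maxn n1 n2.
  have := ne n (leq_maxl _ _); have := uf n (leq_maxr _ _) => /=.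
  rewrite sub0r normrN ger0_norm ?sqrtr_ge0// ltr_sqrt// => uf1 ne1.
  have Huf := hfs_sub (Hu n) Hf.
  have := ip_cauchy_schwarz Huf (rkhs_section rk x).
  rewrite (rkhs_reproducing rk _ Huf) (rkhs_reproducing rk _ (rkhs_section rk x)).
  have : eval_points (k x) (W n) = u n x.
    by apply: eq_bigr => w _; rewrite kernel_symmetric.
  have := Wh n x => + unx; rewrite unx => h1 h2.
  have e4 : e / (4 * (k x x + 1)) * (k x x + 1) = e / 4 by field; rewrite gt_eqF// ltr_wpDl.
  have h3 : (h x - u n x) ^+ 2 <= e / 4.
    rewrite (le_trans h1)// -e4.
    by apply: ler_pM => //; [exact: ltW|rewrite lerDl].
  have h4 : (u n x - f x) ^+ 2 <= e / 4.
    rewrite (le_trans h2)// -e4.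
    by apply: ler_pM => //; [exact: (hfs_ip_ge0 hil)|exact: ltW|rewrite lerDl].
  have := sqr_ge0 ((h x - u n x) - (u n x - f x)); nra.
rewrite -hx; split=> //; rewrite leNgt; apply/negP => Mf.
have f0 : 0 < ip f f by apply: le_lt_trans Mf; rewrite mulr_ge0.
have s0 : 0 < Num.sqrt (ip f f / 4) by rewrite sqrtr_gt0 divr_gt0.
move/cvgrPdist_lt : uf => /(_ _ s0)[n _ /(_ n (leqnn n))] /=.
rewrite sub0r normrN ger0_norm ?sqrtr_ge0// ltr_sqrt ?divr_gt0// => uf1.
have Huf := hfs_sub (Hu n) Hf.
have := ip_cauchy_schwarz Huf Hf; rewrite ip_subl// ip_section_sum//.
have := hM (W n); have := WM n; rewrite -hx; set l := eval_points f _.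
set q := kernel_form k _ => q4 lq lf.
have l2 : l <= 2 * M.
  have ll : l ^+ 2 <= (2 * M) ^+ 2.
    by rewrite (le_trans lq)// exprMn; have := ler_wpM2l M0 q4; lra.
  rewrite (le_trans (ler_norm l))// -(ler_pXn2r (n := 2))// ?nnegrE ?mulr_ge0//.
  by rewrite real_normK ?num_real.
nra.
Qed.
End ReproducingKernelSpace.

(** * The distribution of one split *)

Section SplitDistribution.
Variables (R : realType) (fS : R -> R).
Hypothesis hS : split_density fS.
Local Notation mu := (@lebesgue_measure R).
Local Notation F := (split_cdf fS).

Lemma density_integrable : mu.-integrable `[0, 1] (EFin \o fS).
Proof.
apply: continuous_compact_integrable; first exact: segment_compact.
by case: hS.
Qed.

Lemma density_integrable_sub (A : set (measurableTypeR R)) : measurable A -> A `<=` `[0, 1] ->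
  mu.-integrable A (EFin \o fS).
Proof. by move=> mA A01; exact: (integrableS _ _ A01 density_integrable). Qed.

Lemma cdf1 : F 1 = 1.
Proof. by case: hS => _ _ H; rewrite /split_cdf /Rintegral H. Qed.

Lemma cdf_sub x y : 0 <= x -> x <= y -> y <= 1 ->
  F y - F x = \int[mu]_(s in `]x, y]) fS s.
Proof.
move=> x0 xy y1; rewrite /split_cdf Rintegral_itvB//=.
by apply: density_integrable_sub => // s /=; rewrite !in_itv/= => /andP[-> /le_trans ->].
Qed.

Lemma cdf0 : F 0 = 0.
Proof. by rewrite /split_cdf set_itv1 Rintegral_set1. Qed.

(** A positive continuous density on a compact interval has a positive
    minimum. *)
Lemma cdf_increment_ge : exists2 m : R, 0 < m & forall x y,
  0 <= x -> x <= y -> y <= 1 -> m * (y - x) <= F y - F x.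
Proof.
have [cS pS _] := hS.
have [c c01 cmin] := EVT_min (@ler01 R) cS.
exists (fS c); first exact: pS.
move=> x y x0 xy y1; rewrite cdf_sub//.
have <- : \int[mu]_(s in `]x, y]) fS c = fS c * (y - x).
  rewrite Rintegral_cst//= lebesgue_measure_itv/= lte_fin.
  have [xy'|yx] := ltP x y; first by rewrite -EFinB.
  by have -> : y = x by [apply/eqP; rewrite eq_le yx]; rewrite subrr.
apply: le_Rintegral => //=.
- have xyS : `]x, y] `<=` `[x, y]%classic.
    by move=> s /=; rewrite !in_itv/= => /andP[/ltW -> ->].
  have H : mu.-integrable `[x, y] (EFin \o cst (fS c)).
    apply: continuous_compact_integrable; first exact: segment_compact.
    by move=> ?; exact: cvg_cst.
  by apply: integrableS H.
- apply: density_integrable_sub => // s /=; rewrite !in_itv/= => /andP[xs sy].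
  by rewrite (le_trans x0 (ltW xs)) (le_trans sy).
- move=> s /=; rewrite in_itv/= => /andP[xs sy]; apply: cmin.
  by rewrite in_itv/= (le_trans x0 (ltW xs)) (le_trans sy).
Qed.

Lemma cdf_nondecreasing x y : 0 <= x -> x <= y -> y <= 1 -> F x <= F y.
Proof.
have [m m0 mF] := cdf_increment_ge; move=> x0 xy y1.
rewrite -subr_ge0; apply: le_trans (mF _ _ x0 xy y1).
by rewrite mulr_ge0 ?subr_ge0 ?(ltW m0).
Qed.

Lemma cdf01 x : 0 <= x <= 1 -> 0 <= F x <= 1.
Proof.
move=> /andP[x0 x1]; rewrite -cdf0 -[X in _ && (_ <= X)]cdf1.
by rewrite !cdf_nondecreasing.
Qed.

Lemma cdf_lipschitzE : [lipschitz F t | t in `[0%R : R, 1%R]] ->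
  exists2 M : R, 0 < M & forall x y,
  0 <= x -> x <= y -> y <= 1 -> F y - F x <= M * (y - x).
Proof.
move=> [M [_ MF]]; pose K := `|M| + 1.
have MK : M < K by rewrite /K (le_lt_trans (ler_norm _))// ltrDl.
exists K => [|x y x0 xy y1]; first by rewrite /K ltr_wpDl.
have /= := MF K MK (y, x); rewrite !in_itv/= => H.
apply: le_trans (ler_norm _) _.
rewrite -[X in _ <= _ * X]ger0_norm ?subr_ge0//; apply: H.
by rewrite x0 y1 (le_trans x0) ?(le_trans xy).
Qed.

Definition same_side (x y : R) : set (measurableTypeR R) :=
  [set s | (x < s /\ y < s) \/ (s <= x /\ s <= y)].

Lemma same_sideC x y : same_side x y = same_side y x.
Proof. by apply/seteqP; split=> s /= [] [? ?]; by [left|right]. Qed.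

Lemma same_sideE x y : x <= y -> same_side x y = ~` `]x, y]%classic.
Proof.
move=> xy; apply/seteqP; split=> s /=; rewrite in_itv/=.
  by move=> [[xs ys]|[sx sy]] /andP[]; lra.
have [xs|sx] := ltP x s; last by right; split=> //; lra.
have [sy|ys] := leP s y; last by left.
by move=> H; exfalso; apply: H.
Qed.

Lemma measurable_same_side x y : measurable (same_side x y).
Proof.
wlog xy : x y / x <= y => [H|]; last by rewrite same_sideE//; exact: measurableC.
by have [|/ltW] := leP x y; [|rewrite same_sideC]; exact: H.
Qed.

Lemma same_side_probability x y : 0 <= x <= 1 -> 0 <= y <= 1 ->
  \int[mu]_(s in same_side x y `&` `[0, 1]) fS s = 1 - `|F x - F y|.
Proof.
wlog xy : x y / x <= y => [H|].
  move=> x01 y01; have [xy|/ltW yx] := leP x y; first exact: H.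
  by rewrite same_sideC distrC; exact: H.
move=> /andP[x0 x1] /andP[y0 y1].
have mA := measurable_same_side x y.
have B01 : `]x, y] `<=` `[0, 1]%classic.
  move=> s /=; rewrite !in_itv/= => /andP[xs sy].
  by rewrite (le_trans x0 (ltW xs)) (le_trans sy).
have E : (same_side x y `&` `[0, 1]) `|` `]x, y] = `[0, 1]%classic.
  rewrite same_sideE//; apply/seteqP; split=> s.
    by move=> [[]//|/B01].
  by move=> s01; have [|] := pselect (`]x, y]%classic s); [right|left].
suff : \int[mu]_(s in `[0, 1]) fS s =
    \int[mu]_(s in same_side x y `&` `[0, 1]) fS s + \int[mu]_(s in `]x, y]) fS s.
  rewrite -cdf_sub// -[LHS]/(F 1) cdf1 distrC ger0_norm.
    by set A := \int[_]_(_ in _ `&` _) _; lra.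
  by rewrite subr_ge0 cdf_nondecreasing.
rewrite -{1}E Rintegral_setU//.
- by apply: measurableI => //; exact: measurable_same_side.
- by rewrite E; exact: density_integrable.
- by apply/disj_setPS => s [[]]; rewrite same_sideE.
Qed.

End SplitDistribution.

(** * The BART kernel as a power series *)

Section BartSeries.
Variables (R : realType) (p : nat) (sigma2 : R).
Variables (fD : nat -> R) (fV : 'I_p -> R) (fS : R -> R).
Hypothesis hS : split_density fS.

(** The probability that a single random split does not separate two points. *)
Definition split_kernel (x x' : unit_cube R p) : R :=
  \sum_(v < p) fV v * (1 - `|split_cdf fS (\val x 0 v) - split_cdf fS (\val x' 0 v)|).

Section Law.
Context d (T : measurableType d) (P : probability T R).
Variables (D : T -> nat) (V : nat -> T -> 'I_p) (S : nat -> T -> R).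
Hypothesis hdraw : symmetric_tree_draw fD fV fS P D V S.
Variables x x' : unit_cube R p.

Let cube01 (y : unit_cube R p) v : 0 <= \val y 0 v <= 1.
Proof. by have := set_valP y; exact. Qed.

Let B v := same_side (\val x 0 v) (\val x' 0 v).

Let E n (v : 'I_n -> 'I_p) : set T :=
  [set w | D w = n /\ forall k : 'I_n, V k w = v k /\ B (v k) (S k w)].

Let measurable_E n (v : 'I_n -> 'I_p) : measurable (E v).
Proof.
have -> : E v = D @^-1` [set n] `&` \bigcap_(k in [set: 'I_n])
    (V k @^-1` [set v k] `&` (S k @^-1` B (v k))).
  apply/seteqP; split=> w /=.
    by move=> [Dn H]; split=> // k _; exact: H.
  by move=> [Dn H]; split=> // k; have [] := H k I.
apply: measurableI.
  by have := draw_depth_measurable hdraw; rewrite -[X in measurable X]setTI; apply.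
apply: fin_bigcap_measurable => // k _; apply: measurableI.
  exact: draw_variable_measurable hdraw _ _.
have := draw_split_measurable hdraw k; rewrite -[X in measurable X]setTI; apply => //.
exact: measurable_same_side.
Qed.

Let A n : set T :=
  [set w | D w = n /\ same_leaf n (V ^~ w) (S ^~ w) (\val x) (\val x')].

Let AE n : A n = \bigcup_(v in [set: {ffun 'I_n -> 'I_p}]) E v.
Proof.
apply/seteqP; split=> w /=.
  move=> [Dn H]; exists [ffun k : 'I_n => V k w] => //; split=> // k.
  by rewrite ffunE; split=> //; exact: H.
move=> [v _ [Dn H]]; split=> // k kn.
by have [Vk] := H (Ordinal kn); rewrite -Vk.
Qed.

Let measurable_A n : measurable (A n).
Proof. by rewrite AE; apply: fin_bigcup_measurable. Qed.

Let PE n (v : {ffun 'I_n -> 'I_p}) : P (E v) = (fD n * \prod_(k < n) (fV (v k) *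
  (1 - `|split_cdf fS (\val x 0 (v k)) - split_cdf fS (\val x' 0 (v k))|)))%:E.
Proof.
rewrite (draw_law hdraw v (fun k => measurable_same_side _ _)).
congr (_ * _)%:E; apply: eq_bigr => k _.
by rewrite same_side_probability ?cube01.
Qed.

Let PA n : P (A n) = (fD n * split_kernel x x' ^+ n)%:E.
Proof.
rewrite AE measure_fin_bigcup; [|exact: finite_finset| |]; last 2 first.
- move=> v v' _ _ [w [[_ H] [_ H']]]; apply/ffunP => k.
  by have [<- _] := H k; have [<- _] := H' k.
- by move=> v _; exact: measurable_E.
rewrite -[X in \sum_(_ \in X) _](_ : [set` index_enum {ffun 'I_n -> 'I_p}] = setT); last first.
  by apply/seteqP; split=> // v _ /=; rewrite mem_index_enum.
rewrite -fsbig_seq ?index_enum_uniq//.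
rewrite (eq_bigr _ (fun v _ => PE v)).
rewrite sumEFin -mulr_sumr; congr (_ * _)%:E.
have -> : split_kernel x x' ^+ n = \prod_(k < n) split_kernel x x'.
  by rewrite prodr_const card_ord.
by rewrite /split_kernel bigA_distr_bigA.
Qed.

(** The event splits according to the depth [n] and the sequence of the [n]
    split variables; conditionally on these the splits are independent, and
    the probabilities of all the sequences add up to a power of
    [split_kernel]. *)
Lemma bart_series : (fun N => sigma2 * \sum_(n < N) fD n * split_kernel x x' ^+ n)
  @ \oo --> bart_kernel sigma2 P D V S x x'.
Proof.
apply: cvgM; first exact: cvg_cst.
suff : (fun N => (\sum_(n < N) fD n * split_kernel x x' ^+ n)%:E) @ \oo -->
    (fine (P [set w | same_leaf (D w) (V ^~ w) (S ^~ w) (\val x) (\val x')]))%:E.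
  by move/fine_cvg.
have -> : [set w | same_leaf (D w) (V ^~ w) (S ^~ w) (\val x) (\val x')] =
    \bigcup_n A n.
  apply/seteqP; split=> w /=; first by move=> H; exists (D w).
  by move=> [n _ [<-]].
have tA : trivIset setT A by move=> n n' _ _ [w [[<- _] [<- _]]].
have mA : measurable (\bigcup_n A n).
  by apply: bigcup_measurable => n _; exact: measurable_A.
have AN : (fun N => (\sum_(0 <= n < N) P (A n))%E) =
    (fun N => (\sum_(n < N) fD n * split_kernel x x' ^+ n)%:E).
  apply/funext => N; rewrite big_mkord -sumEFin.
  by apply: eq_bigr => n _; exact: PA.
rewrite -AN fineK ?fin_num_measure//.
exact: measure_semi_sigma_additive.
Qed.
End Law.
End BartSeries.

(** * Comparison of the BART and Laplace kernels with a product of 1 + min *)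

Section KernelLimits.
Variables (R : realType) (X : Type).
Variables (kN : nat -> X -> X -> R) (k : X -> X -> R).
Hypothesis kNk : forall x y, (fun N => kN N x y) @ \oo --> k x y.

Lemma psd_limit : (\forall N \near \oo, psd_kernel (kN N)) -> psd_kernel k.
Proof.
move=> pN; split=> [x y|n x a].
  apply/eqP; rewrite eq_le; apply/andP; split.
    by apply: (ler_cvg_to (@kNk x y) (@kNk y x)); apply: filterS pN => N [->].
  by apply: (ler_cvg_to (@kNk y x) (@kNk x y)); apply: filterS pN => N [->].
have : (fun N => \sum_(i < n) \sum_(j < n) a i * a j * kN N (x i) (x j)) @ \oo -->
    \sum_(i < n) \sum_(j < n) a i * a j * k (x i) (x j).
  apply: cvg_big => [|i _]; first exact: add_continuous.
  apply: cvg_big => [|j _]; first exact: add_continuous.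
  by apply: cvgM; [exact: cvg_cst|exact: kNk].
move/cvgr_to_ge; apply.
by apply: filterS pN => N [_]; exact.
Qed.

End KernelLimits.

Lemma loewner_limit_ge (R : realType) (X : Type) (kN : nat -> X -> X -> R)
    (k k1 : X -> X -> R) : (forall x y, (fun N => kN N x y) @ \oo --> k x y) ->
  (\forall N \near \oo, loewner_le k1 (kN N)) -> loewner_le k1 k.
Proof.
move=> kNk h; apply: (@psd_limit _ _ (fun N x y => kN N x y - k1 x y)) => // x y.
by apply: cvgB; [exact: kNk|exact: cvg_cst].
Qed.

Lemma loewner_limit_le (R : realType) (X : Type) (kN : nat -> X -> X -> R)
    (k k1 : X -> X -> R) : (forall x y, (fun N => kN N x y) @ \oo --> k x y) ->
  (\forall N \near \oo, loewner_le (kN N) k1) -> loewner_le k k1.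
Proof.
move=> kNk h; apply: (@psd_limit _ _ (fun N x y => k1 x y - kN N x y)) => // x y.
by apply: cvgB; [exact: cvg_cst|exact: kNk].
Qed.

(** The kernel of the functions [x |-> int_(u < x) w u] whose density [w] is
    square integrable on [[-1, 1]^p]: all kernels are compared with it. *)
Definition min_kernel (R : realType) (p : nat) (u u' : unit_cube R p) : R :=
  \prod_(v < p) (1 + Num.min (\val u 0 v) (\val u' 0 v)).

Section CubeKernels.
Variables (R : realType) (p : nat).
Implicit Types u : unit_cube R p.

Lemma unit_cube01 u v : 0 <= \val u 0 v <= 1.
Proof. by have := set_valP u; exact. Qed.

Lemma psd_min_kernel : psd_kernel (@min_kernel R p).
Proof. by apply: psd_prod => v _; apply: psd_1Dmin => u; exact: unit_cube01. Qed.

Lemma loewner_prodZ (a : R) (K K' : 'I_p -> unit_cube R p -> unit_cube R p -> R) :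
  0 <= a -> (forall v, psd_kernel (K v)) ->
  (forall v, loewner_le (K v) (fun x y => a * K' v x y)) ->
  loewner_le (fun x y => \prod_v K v x y) (fun x y => a ^+ p * \prod_v K' v x y).
Proof.
move=> a0 pK KK; have := @loewner_prod _ _ _ (index_enum 'I_p) xpredT _ _ (fun v _ => pK v) (fun v _ => KK v).
congr loewner_le; apply/funext => x; apply/funext => y.
by rewrite big_split/= prodr_const card_ord.
Qed.

Lemma laplace_le_min :
  loewner_le (@laplace_kernel R p) (fun x y => 4 ^+ p * min_kernel x y).
Proof.
apply: loewner_prodZ => // v.
  by apply: (psd_exp (g := fun u => \val u 0 v)) => u; exact: unit_cube01.
by apply: (exp_le (g := fun u => \val u 0 v)) => u; exact: unit_cube01.
Qed.

Lemma min_le_laplace : exists2 C : R, 0 < C &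
  loewner_le (@min_kernel R p) (fun x y => C * laplace_kernel x y).
Proof.
have e0 : 0 < expR (-1) :> R by exact: expR_gt0.
exists ((4 / expR (-1)) ^+ p); first by rewrite exprn_gt0// divr_gt0.
apply: loewner_prodZ => [|v|v]; first by rewrite ltW// divr_gt0.
  by apply: psd_1Dmin => u; exact: unit_cube01.
have g01 : forall u, 0 <= (fun u : unit_cube R p => \val u 0 v) u <= 1.
  by move=> u; exact: unit_cube01.
have h1 := loewner_scale (ltW e0) (triangle_ge g01).
have := loewner_scale (divr_ge0 (ler0n R 4) (ltW e0)) (loewner_trans h1 (exp_ge g01)).
congr loewner_le; apply/funext => x; apply/funext => y.
by field; rewrite gt_eqF.
Qed.

Lemma psd_laplace : psd_kernel (@laplace_kernel R p).
Proof.
apply: psd_prod => v _.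
by apply: (psd_exp (g := fun u => \val u 0 v)) => u; exact: unit_cube01.
Qed.

End CubeKernels.

Section BartBounds.
Variables (R : realType) (p : nat) (sigma2 : R).
Variables (fD : nat -> R) (fV : 'I_p -> R) (fS : R -> R).
Hypotheses (p_ge1 : (1 <= p)%N) (sigma2_gt0 : 0 < sigma2).
Hypotheses (fD_pmf : depth_pmf fD) (fV_pmf : variable_pmf fV).
Hypothesis hS : split_density fS.
Hypotheses (depth_ge_p : (0 < depth_tail fD p)%E)
  (depth_moment_p : (depth_moment fD p < +oo)%E)
  (cdf_lipschitz : [lipschitz (split_cdf fS t) | t in `[0%R : R, 1%R]]).

Local Notation F := (split_cdf fS).
Local Notation X := (unit_cube R p).

Let Fv v (x : X) := F (\val x 0 v).
Let Fv01 v x : 0 <= Fv v x <= 1.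
Proof. by apply: cdf01 => //; exact: unit_cube01. Qed.
Let lv v (x y : X) := 1 - `|Fv v x - Fv v y|.
Let kv v (x y : X) := 1 + Num.min (\val x 0 v) (\val y 0 v).

(** When [h - g] increases with [g], the difference of the two kernels is [min
    (h x - g x) (h y - g y)]. *)
Lemma loewner_min_monotone (Y : Type) (g h : Y -> R) :
  (forall x, 0 <= g x) -> (forall x, g x <= h x) ->
  (forall x y, g x <= g y -> h x - g x <= h y - g y) ->
  loewner_le (fun x y => 1 + Num.min (g x) (g y)) (fun x y => 1 + Num.min (h x) (h y)).
Proof.
move=> g0 gh mono.
have := @psd_min R Y (fun x => h x - g x) (fun x => ltac:(by rewrite subr_ge0)).
congr psd_kernel; apply/funext => x; apply/funext => y.
wlog xy : x y / g x <= g y => [H|].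
  have /orP[|] := le_total (g x) (g y); first exact: H.
  by rewrite (minC (h x - g x)) (minC (h x)) (minC (g x)); exact: H.
have := mono _ _ xy => m; rewrite (min_l m) (min_l xy) min_l; first by ring.
by lra.
Qed.

(** The increments of [F] are at least those of [c x]. *)
Lemma min_le_cdf_min : exists2 c : R, 0 < c & forall v,
  loewner_le (fun x y => c * kv v x y) (fun x y => 1 + Num.min (Fv v x) (Fv v y)).
Proof.
have [m m0 mF] := cdf_increment_ge hS.
pose c := Num.min 1 m; have c0 : 0 < c by rewrite lt_min ltr01.
have c1 : c <= 1 by rewrite ge_min lexx.
have cm : c <= m by rewrite ge_min lexx orbT.
exists c => // v.
have Fx (x : X) : c * \val x 0 v <= Fv v x.
  have /andP[x0 x1] := unit_cube01 x v.
  have := mF 0 _ (lexx 0) x0 x1; rewrite cdf0 !subr0; apply: le_trans.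
  exact: ler_wpM2r.
have := @loewner_min_monotone X (fun x : X => c * \val x 0 v) (Fv v) _ Fx.
have x0 (x : X) : 0 <= c * \val x 0 v.
  by rewrite mulr_ge0// ?(ltW c0)//; case/andP: (unit_cube01 x v).
move=> /(_ x0) H; apply: loewner_trans (H _).
  have := psd_cst X (_ : 0 <= 1 - c); rewrite subr_ge0 => /(_ c1).
  congr psd_kernel; apply/funext => x; apply/funext => y.
  by rewrite -minr_pMr ?(ltW c0)// /kv; ring.
move=> x y; rewrite ler_pM2l// => xy.
have /andP[? ?] := unit_cube01 x v; have /andP[? ?] := unit_cube01 y v.
have := mF (\val x 0 v) (\val y 0 v); rewrite /Fv => /(_ _ _ _) h.
have : m * (\val y 0 v - \val x 0 v) <= F (\val y 0 v) - F (\val x 0 v) by exact: h.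
have : c * (\val y 0 v - \val x 0 v) <= m * (\val y 0 v - \val x 0 v).
  by rewrite ler_wpM2r// subr_ge0.
lra.
Qed.

(** The increments of [F] are at most those of [M x]. *)
Lemma cdf_min_le_min : exists2 C : R, 0 < C & forall v,
  loewner_le (fun x y => 1 + Num.min (Fv v x) (Fv v y)) (fun x y => C * kv v x y).
Proof.
have [M M0 FM] := cdf_lipschitzE cdf_lipschitz.
exists (1 + M) => [|v]; first by rewrite addr_gt0.
have K0 : 0 < 1 + M by rewrite addr_gt0.
have x0 (x : X) : 0 <= \val x 0 v by case/andP: (unit_cube01 x v).
have Fx (x : X) : Fv v x <= (1 + M) * \val x 0 v.
  have /andP[_ x1] := unit_cube01 x v.
  have := FM 0 _ (lexx 0) (x0 x) x1; rewrite (cdf0 fS) !subr0 => /le_trans; apply.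
  by rewrite ler_wpM2r// lerDr.
have F0 x : 0 <= Fv v x by case/andP: (Fv01 v x).
have := @loewner_min_monotone X (Fv v) (fun x : X => (1 + M) * \val x 0 v) F0 Fx.
move=> H; apply: loewner_trans (H _) _.
  move=> x y Fxy; have [xy|yx] := leP (\val x 0 v) (\val y 0 v).
    have /andP[_ y1] := unit_cube01 y v.
    have := FM _ _ (x0 x) xy y1; rewrite /Fv; lra.
  have /andP[_ x1] := unit_cube01 x v.
  have := cdf_increment_ge hS => -[m m0 mF].
  have := mF _ _ (x0 y) (ltW yx) x1; rewrite -/(Fv v x) -/(Fv v y).
  by have : 0 < m * (\val x 0 v - \val y 0 v) by [rewrite mulr_gt0// subr_gt0]; lra.
have := psd_cst X (ltW M0).
congr psd_kernel; apply/funext => x; apply/funext => y.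
by rewrite -minr_pMr ?(ltW K0)// /kv; ring.
Qed.

Let q : X -> X -> R := split_kernel fV fS.

Let psd_lv v : psd_kernel (lv v).
Proof.
have h := triangle_ge (Fv01 v); apply: loewner_psd h.
by apply: psd_scale; [rewrite invr_ge0|exact: psd_1Dmin].
Qed.

Let psd_kv v : psd_kernel (kv v).
Proof. by apply: psd_1Dmin => u; exact: unit_cube01. Qed.

Let fV_ge0 v : 0 <= fV v. Proof. by case: fV_pmf => /(_ v)/ltW. Qed.

Let psd_q : psd_kernel q.
Proof.
apply: (@psd_sum _ _ _ (index_enum 'I_p) xpredT (fun v x y => fV v * lv v x y)) => v _.
exact: psd_scale.
Qed.

Let qE x y : q x y = \sum_v fV v * lv v x y. Proof. by []. Qed.

Let lv_le_q v : loewner_le (fun x y => fV v * lv v x y) q.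
Proof.
have := @psd_sum _ _ _ (index_enum 'I_p) (predC1 v) (fun v x y => fV v * lv v x y).
move=> /(_ (fun i _ => psd_scale (fV_ge0 i) (psd_lv i))); congr psd_kernel.
apply/funext => x; apply/funext => y; by rewrite qE [in RHS](bigD1 v)//= addrAC subrr add0r.
Qed.

Let psd_pow (k : X -> X -> R) n : psd_kernel k -> psd_kernel (fun x y => k x y ^+ n).
Proof.
move=> pk; have := @psd_prod _ _ _ (index_enum 'I_n) xpredT (fun=> k) (fun _ _ => pk).
by congr psd_kernel; apply/funext => x; apply/funext => y; rewrite prodr_const card_ord.
Qed.

Let loewner_pow (k k' : X -> X -> R) n : psd_kernel k -> loewner_le k k' ->
  loewner_le (fun x y => k x y ^+ n) (fun x y => k' x y ^+ n).
Proof.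
move=> pk kk; have := @loewner_prod _ _ _ (index_enum 'I_n) xpredT
  (fun=> k) (fun=> k') (fun _ _ => pk) (fun _ _ => kk).
by congr loewner_le; apply/funext => x; apply/funext => y; rewrite prodr_const card_ord.
Qed.

Let lv_ge : exists2 c : R, 0 < c & forall v,
  loewner_le (fun x y => c * kv v x y) (lv v).
Proof.
have [c c0 H] := min_le_cdf_min; exists (4^-1 * c) => [|v].
  by rewrite mulr_gt0// invr_gt0.
have i4 : 0 <= (4^-1 : R) by rewrite invr_ge0.
have := loewner_trans (loewner_scale i4 (H v)) (triangle_ge (Fv01 v)).
by congr loewner_le; apply/funext => x; apply/funext => y; rewrite mulrA.
Qed.

(** Each of [p] of the splits may be taken along a different variable, and each
    further split dominates a constant. *)
Lemma split_power_ge n : (p <= n)%N -> exists2 c : R, 0 < c &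
  loewner_le (fun x y => c * min_kernel x y) (fun x y => q x y ^+ n).
Proof.
move=> pn; have [c c0 lc] := lv_ge.
pose v0 : 'I_p := Ordinal p_ge1; pose b := fV v0 * c.
have fV0 v : 0 < fV v by case: fV_pmf.
have b0 : 0 < b by rewrite mulr_gt0.
exists (b ^+ (n - p) * (c ^+ p * \prod_v fV v)).
  by rewrite mulr_gt0 ?exprn_gt0// mulr_gt0 ?exprn_gt0// prodr_gt0.
have fl v : loewner_le (fun x y => fV v * (c * kv v x y)) q.
  exact: loewner_trans (loewner_scale (fV_ge0 v) (lc v)) (lv_le_q v).
have pfl v : psd_kernel (fun x y => fV v * (c * kv v x y)).
  by apply: psd_scale => //; apply: psd_scale => //; exact: ltW.
have h1 := @loewner_prod _ _ _ (index_enum 'I_p) xpredT _ (fun=> q)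
  (fun v _ => pfl v) (fun v _ => fl v).
have bq : loewner_le (fun _ _ => b) q.
  apply: loewner_trans (fl v0).
  have := psd_scale (ltW b0) (@psd_min R X (fun x => \val x 0 v0) (fun x => ltac:(by case/andP: (unit_cube01 x v0)))).
  congr psd_kernel; apply/funext => x; apply/funext => y; rewrite /kv /b; ring.
have h2 := loewner_pow (n - p) (psd_cst X (ltW b0)) bq.
have := loewner_mul (psd_cst X (exprn_ge0 (n - p) (ltW b0)))
  (@psd_prod _ _ _ (index_enum 'I_p) xpredT _ (fun v _ => pfl v)) h2 h1.
congr loewner_le; apply/funext => x; apply/funext => y; last first.
  by rewrite prodr_const card_ord -exprD subnK.
rewrite !big_split/= prodr_const card_ord /min_kernel -/(kv _); ring.
Qed.

(** Along each sequence of split variables, variable [v] is used at most [n]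
    times and contributes a factor linear in [n]. *)
Lemma split_power_le : exists2 C : R, 0 < C & forall n,
  loewner_le (fun x y => q x y ^+ n)
             (fun x y => (C * n.+1%:R) ^+ p * min_kernel x y).
Proof.
have [C1 C10 H] := cdf_min_le_min; exists (4 * C1) => [|n]; first by rewrite mulr_gt0.
pose cnt (w : {ffun 'I_n -> 'I_p}) v := #|[pred k | w k == v]|.
have qn x y : q x y ^+ n = \sum_(w : {ffun 'I_n -> 'I_p})
    (\prod_k fV (w k)) * \prod_v lv v x y ^+ cnt w v.
  have -> : q x y ^+ n = \prod_(k < n) q x y by rewrite prodr_const card_ord.
  rewrite /q /split_kernel bigA_distr_bigA; apply: eq_bigr => w _.
  rewrite big_split/=; congr (_ * _).
  rewrite (partition_big w xpredT)//=; apply: eq_bigr => v _.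
  rewrite (eq_bigr (fun=> lv v x y)) ?prodr_const//.
  by move=> k /eqP ->.
have lw v m : (m <= n)%N -> loewner_le (fun x y => lv v x y ^+ m)
    (fun x y => (4 * C1 * n.+1%:R) * kv v x y).
  move=> mn; apply: loewner_trans (triangle_power_le (Fv01 v) m) _.
  have m0 : 0 <= 4 * m.+1%:R :> R by rewrite mulr_ge0.
  apply: loewner_trans (loewner_scale m0 (H v)) _.
  have := @loewner_scalel _ _ (4 * m.+1%:R * C1) (4 * C1 * n.+1%:R) (kv v) _ (psd_kv v).
  rewrite mulrAC ler_wpM2l ?mulr_ge0 ?(ltW C10)// ?ler_nat ?ltnS// => /(_ erefl).
  by congr loewner_le; apply/funext => x; apply/funext => y; ring.
have ww (w : {ffun 'I_n -> 'I_p}) : loewner_le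
    (fun x y => (\prod_k fV (w k)) * \prod_v lv v x y ^+ cnt w v)
    (fun x y => (\prod_k fV (w k)) * ((4 * C1 * n.+1%:R) ^+ p * min_kernel x y)).
  apply: loewner_scale; first by apply: prodr_ge0 => k _.
  apply: (loewner_prodZ (K' := kv)) => [|v|v].
  - by rewrite !mulr_ge0 ?(ltW C10).
  - exact: psd_pow.
  - by apply: lw; rewrite -[X in (_ <= X)%N]card_ord max_card.
have := @loewner_sum _ _ _ (index_enum {ffun 'I_n -> 'I_p}) xpredT _ _ (fun w _ => ww w).
congr loewner_le; apply/funext => x; apply/funext => y; first by rewrite qn.
rewrite -mulr_suml -[X in X * _](_ : \prod_(k < n) \sum_v fV v = _).
  by case: fV_pmf => _ ->; rewrite prodr_const expr1n mul1r.
by rewrite bigA_distr_bigA.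
Qed.

Lemma depth_witness : exists2 n, (p <= n)%N & 0 < fD n.
Proof.
apply: contrapT => h; move: depth_ge_p; rewrite /depth_tail.
rewrite eseries0 ?ltxx// => n pn _; have [fD0 _ _] := fD_pmf.
congr EFin; apply/eqP; rewrite eq_le fD0 andbT leNgt; apply/negP => n0.
by apply: h; exists n.
Qed.

(** [n + 1 <= 2 n] for positive [n], and depth 0 has no mass. *)
Lemma depth_moment_partial : exists2 M : R, 0 <= M & forall N,
  \sum_(n < N) fD n * n.+1%:R ^+ p <= M.
Proof.
have [fD0 fD00 _] := fD_pmf.
have M0 : (0 <= depth_moment fD p)%E.
  by apply: nneseries_ge0 => n _ _; rewrite lee_fin mulr_ge0 ?exprn_ge0.
pose m := fine (depth_moment fD p).
exists (2 ^+ p * m) => [|N]; first by rewrite mulr_ge0 ?exprn_ge0// fine_ge0.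
apply: (@le_trans _ _ (2 ^+ p * \sum_(n < N) (n%:R ^+ p * fD n))).
  rewrite mulr_sumr; apply: ler_sum => -[[|n] nN] _ /=.
    by rewrite fD00 !(mul0r, mulr0).
  rewrite mulrA -exprMn mulrC ler_wpM2r// lerXn2r ?nnegrE ?mulr_ge0//.
  by rewrite -natrM ler_nat mul2n -addnn addSnnS addnS ltnS leq_addl.
rewrite ler_wpM2l ?exprn_ge0// -lee_fin /m fineK; last by rewrite ge0_fin_numE.
rewrite -sumEFin -(big_mkord xpredT (fun n => (n%:R ^+ p * fD n)%:E)).
by apply: nneseries_lim_ge => n _ _; rewrite lee_fin mulr_ge0 ?exprn_ge0.
Qed.

(** The lower bound keeps a single depth of the series, the upper bound sums
    the bounds of all depths against the moment. The constants are chosen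
    before the draw: they depend on it only through [fD], [fV] and [fS]. *)
Lemma bart_min_bounds : exists c C : R, [/\ 0 < c, 0 < C &
  forall (d : measure_display) (T : measurableType d) (P : probability T R)
    (D : T -> nat) (V : nat -> T -> 'I_p) (S : nat -> T -> R),
  symmetric_tree_draw fD fV fS P D V S ->
  loewner_le (fun x y => c * min_kernel x y) (bart_kernel sigma2 P D V S) /\
  loewner_le (bart_kernel sigma2 P D V S) (fun x y => C * min_kernel x y)].
Proof.
have [fD0 _ _] := fD_pmf.
have [n0 pn0 fn0] := depth_witness.
have [c1 c10 Hc] := split_power_ge pn0.
have [C1 C10 HC] := split_power_le.
have [M M0 HM] := depth_moment_partial.
(* adding 1 keeps the upper constant positive when [M] is zero *)
exists (sigma2 * fD n0 * c1), (sigma2 * (C1 ^+ p * M) + 1); split.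
- by rewrite !mulr_gt0.
- by rewrite ltr_wpDl// mulr_ge0 ?(ltW sigma2_gt0)// mulr_ge0 ?exprn_ge0 ?(ltW C10).
move=> d T P D V S hdraw; have lim := bart_series (sigma2 := sigma2) hS hdraw.
have s0 := ltW sigma2_gt0.
have psdn n : psd_kernel (fun x y => fD n * q x y ^+ n).
  by apply: psd_scale => //; exact: psd_pow psd_q.
split.
  apply: (loewner_limit_ge lim); exists n0.+1 => // N /= n0N.
  have -> : (fun x y => sigma2 * fD n0 * c1 * min_kernel x y) =
      (fun x y : X => sigma2 * (fD n0 * (c1 * min_kernel x y))).
    by apply/funext => x; apply/funext => y; ring.
  apply: loewner_scale => //.
  apply: loewner_trans (loewner_scale (fD0 n0) Hc) _.
  have := @psd_sum _ _ _ (index_enum 'I_N) (predC1 (Ordinal n0N)) _ (fun n _ => psdn n).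
  congr psd_kernel; apply/funext => x; apply/funext => y.
  by rewrite [in RHS](bigD1 (Ordinal n0N))//= addrAC subrr add0r.
apply: (loewner_limit_le lim); apply: nearW => N.
apply: (@loewner_trans _ _ (fun x y => sigma2 * (\sum_(n < N) fD n *
    ((C1 * n.+1%:R) ^+ p * min_kernel x y)))).
  apply: (loewner_scale s0).
  apply: (@loewner_sum _ _ _ (index_enum 'I_N) xpredT
    (fun n x y => fD n * q x y ^+ n)) => n _.
  by apply: loewner_scale => //; exact: HC.
have := @loewner_scalel _ _ (sigma2 * (C1 ^+ p * \sum_(n < N) fD n * n.+1%:R ^+ p))
  (sigma2 * (C1 ^+ p * M) + 1) (@min_kernel R p) _ (@psd_min_kernel R p).
have -> : sigma2 * (C1 ^+ p * \sum_(n < N) fD n * n.+1%:R ^+ p) <=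
    sigma2 * (C1 ^+ p * M) + 1.
  rewrite ler_wpDr// ler_wpM2l// ler_wpM2l// ?exprn_ge0 ?(ltW C10)//; exact: HM.
move=> /(_ isT); congr loewner_le; apply/funext => x; apply/funext => y.
rewrite -mulrA; congr (_ * _); rewrite -mulrA mulr_suml mulr_sumr.
by apply: eq_bigr => n _; rewrite exprMn; ring.
Qed.

End BartBounds.

(** * Square integrable functions on a probability space *)

Section SquareIntegrable.
Context d (T : measurableType d) (R : realType) (mu : probability T R).
Implicit Types f g : T -> R.

Definition sq_integrable f : Prop :=
  measurable_fun setT f /\ mu.-integrable setT (EFin \o (fun x => f x ^+ 2)).

Definition integrableR f : Prop := mu.-integrable setT (EFin \o f).

Lemma integrableRD f g : integrableR f -> integrableR g ->
  integrableR (fun x => f x + g x).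
Proof. by move=> hf hg; have := integrableD measurableT hf hg. Qed.

Lemma integrableRB f g : integrableR f -> integrableR g ->
  integrableR (fun x => f x - g x).
Proof. by move=> hf hg; have := integrableB measurableT hf hg. Qed.

Lemma integrableRZ c f : integrableR f -> integrableR (fun x => c * f x).
Proof. by move=> hf; have := integrableZl measurableT c hf. Qed.

Lemma integrableR_cst c : integrableR (fun=> c).
Proof. by apply: finite_measure_integrable_cst. Qed.

Lemma integrableR_dominated f g : measurable_fun setT f -> integrableR g ->
  (forall x, `|f x| <= g x) -> integrableR f.
Proof.
move=> mf ig fg; apply: (le_integrable measurableT _ _ ig).
  exact/measurable_EFinP.
by move=> x _ /=; rewrite lee_fin (le_trans (fg x))// ler_norm.
Qed.

Lemma integrableR_bounded f (M : R) : measurable_fun setT f ->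
  (forall x, `|f x| <= M) -> integrableR f.
Proof. by move=> mf fM; exact: (integrableR_dominated mf (integrableR_cst M)). Qed.

Lemma integrableR_sum (I : Type) (r : seq I) (P : pred I) (h : I -> T -> R) :
  (forall i, P i -> integrableR (h i)) ->
  integrableR (fun x => \sum_(i <- r | P i) h i x).
Proof.
move=> hi; elim: r => [|i r IH].
  have := integrableR_cst 0; congr integrableR.
  by apply/funext => x; rewrite big_nil.
have [Pi|Pi] := boolP (P i).
  have := integrableRD (hi i Pi) IH; congr integrableR.
  by apply/funext => x; rewrite big_cons Pi.
by move: IH; congr integrableR; apply/funext => x; rewrite big_cons (negbTE Pi).
Qed.

Lemma Rintegral_sum (I : Type) (r : seq I) (P : pred I) (h : I -> T -> R) :
  (forall i, P i -> integrableR (h i)) ->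
  \int[mu]_x (\sum_(i <- r | P i) h i x) = \sum_(i <- r | P i) \int[mu]_x h i x.
Proof.
move=> hi; elim: r => [|i r IH].
  rewrite big_nil; under eq_Rintegral do rewrite big_nil.
  by rewrite Rintegral_cst// mul0r.
rewrite big_cons; under eq_Rintegral do rewrite big_cons.
by case: ifPn => // Pi; rewrite RintegralD// ?IH//; [exact: hi|exact: integrableR_sum].
Qed.

Lemma integrableR_measurable f : integrableR f -> measurable_fun setT f.
Proof. by move=> /measurable_int/measurable_EFinP. Qed.

Lemma sq_integrable_mul f g : sq_integrable f -> sq_integrable g ->
  integrableR (fun x => f x * g x).
Proof.
move=> [mf f2] [mg g2].
apply: (@integrableR_dominated _ (fun x => f x ^+ 2 + g x ^+ 2)).
- exact: measurable_funM.
- exact: integrableRD.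
move=> x; rewrite normrM -(real_normK (num_real (f x))) -(real_normK (num_real (g x))).
by have := sqr_ge0 (`|f x| - `|g x|); have := normr_ge0 (f x); have := normr_ge0 (g x); nra.
Qed.

Lemma sq_integrable_add f g : sq_integrable f -> sq_integrable g ->
  sq_integrable (fun x => f x + g x).
Proof.
move=> hf hg; split; first by apply: measurable_funD; [case: hf|case: hg].
have := integrableRD (integrableRD hf.2 hg.2)
  (integrableRZ 2 (sq_integrable_mul hf hg)).
rewrite /integrableR; congr (mu.-integrable _ _).
by apply/funext => x /=; congr EFin; ring.
Qed.

Lemma sq_integrable_scale c f : sq_integrable f -> sq_integrable (fun x => c * f x).
Proof.
move=> hf; split; first by apply: measurable_funM; [exact: measurable_cst|case: hf].
have := integrableRZ (c ^+ 2) hf.2.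
rewrite /integrableR; congr (mu.-integrable _ _).
by apply/funext => x /=; rewrite exprMn.
Qed.

Lemma sq_integrable_sub f g : sq_integrable f -> sq_integrable g ->
  sq_integrable (fun x => f x - g x).
Proof.
move=> hf hg; have := sq_integrable_add hf (sq_integrable_scale (-1) hg).
by congr sq_integrable; apply/funext => x; rewrite mulN1r.
Qed.

Lemma sq_integrable_bounded f (M : R) : measurable_fun setT f ->
  (forall x, `|f x| <= M) -> sq_integrable f.
Proof.
move=> mf fM; split => //; apply: (@integrableR_bounded _ (M ^+ 2)).
  exact: measurable_funX.
by move=> x; rewrite normrX lerXn2r ?nnegrE ?normr_ge0// (le_trans (normr_ge0 _) (fM x)).
Qed.

Lemma sq_integrable_sum (I : Type) (r : seq I) (h : I -> T -> R) :
  (forall i, sq_integrable (h i)) ->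
  sq_integrable (fun x => \sum_(i <- r) h i x).
Proof.
move=> hi; elim: r => [|i r IH].
  have : sq_integrable (cst 0) by apply: (@sq_integrable_bounded _ 0) => // x; rewrite normr0.
  by congr sq_integrable; apply/funext => x; rewrite big_nil.
have := sq_integrable_add (hi i) IH; congr sq_integrable.
by apply/funext => x; rewrite big_cons.
Qed.

Lemma sq_integrable_integrable f : sq_integrable f -> integrableR f.
Proof.
move=> hf; have h1 : sq_integrable (fun=> 1).
  by apply: (@sq_integrable_bounded _ 1) => // x; rewrite normr1.
have := sq_integrable_mul hf h1; congr integrableR.
by apply/funext => x; rewrite mulr1.
Qed.

Lemma sq_norm_ge0 f : 0 <= \int[mu]_x (f x ^+ 2).
Proof. by apply: Rintegral_ge0 => x _; exact: sqr_ge0. Qed.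

Lemma sq_normD t f g : sq_integrable f -> sq_integrable g ->
  \int[mu]_x ((f x + t * g x) ^+ 2) = \int[mu]_x (f x ^+ 2) +
    2 * t * \int[mu]_x (f x * g x) + t ^+ 2 * \int[mu]_x (g x ^+ 2).
Proof.
move=> hf hg; have hfg := sq_integrable_mul hf hg.
rewrite -(RintegralZl (t ^+ 2) measurableT hg.2).
rewrite -(RintegralZl (2 * t) measurableT hfg) -RintegralD//; last 2 first.
- exact: hf.2.
- exact: integrableRZ.
rewrite -RintegralD//; last 2 first.
- by apply: integrableRD; [exact: hf.2|exact: integrableRZ].
- by apply: integrableRZ; exact: hg.2.
by apply: eq_Rintegral => x _; ring.
Qed.

Lemma sq_integrable_cauchy_schwarz f g : sq_integrable f -> sq_integrable g ->
  (\int[mu]_x (f x * g x)) ^+ 2 <= \int[mu]_x (f x ^+ 2) * \int[mu]_x (g x ^+ 2).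
Proof.
by move=> hf hg; apply: discriminant_le => t; rewrite -sq_normD// sq_norm_ge0.
Qed.

Lemma sq_norm_triangle f g : sq_integrable f -> sq_integrable g ->
  \int[mu]_x ((f x + g x) ^+ 2) <=
  2 * \int[mu]_x (f x ^+ 2) + 2 * \int[mu]_x (g x ^+ 2).
Proof.
move=> hf hg; have := sq_norm_ge0 (fun x => f x + (-1) * g x).
rewrite sq_normD//; have := sq_normD 1 hf hg.
have -> : \int[mu]_x ((f x + g x) ^+ 2) = \int[mu]_x ((f x + 1 * g x) ^+ 2).
  by apply: eq_Rintegral => x _; rewrite mul1r.
by move=> ->; lra.
Qed.

Lemma sq_norm_EFin f : sq_integrable f ->
  ((\int[mu]_x (f x ^+ 2))%:E = \int[mu]_x (f x ^+ 2)%:E)%E.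
Proof.
by move=> hf; rewrite /Rintegral fineK//; apply: integrable_fin_num => //; exact: hf.2.
Qed.

Lemma Lfun_sq_integrable f : f \in Lfun mu 2%:E <-> sq_integrable f.
Proof.
split=> [hf|[mf f2]].
  split; last exact: Lfun2_integrable_sqr.
  by move: hf; rewrite inE => /andP[/[!inE]].
rewrite inE; apply/andP; split; rewrite inE//= /finite_norm.
rewrite unlock; apply: poweR_lty.
rewrite (_ : (\int[mu]_x `|(EFin \o f) x| `^ 2)%E = (\int[mu]_x (f x ^+ 2)%:E)%E).
  by rewrite -ge0_fin_numE ?(integrable_fin_num measurableT f2)// integral_ge0// => x _; rewrite lee_fin sqr_ge0.
by apply: eq_integral => x _ /=; rewrite powR_mulrn// real_normK ?num_real.
Qed.

Lemma Lnorm_sqr f : sq_integrable f ->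
  fine ('N[mu]_2%:E[EFin \o f])%E ^+ 2 = \int[mu]_x (f x ^+ 2).
Proof.
move=> hf; have /Lfun_sq_integrable lf := hf.
have nf : ('N[mu]_2%:E[EFin \o f] \is a fin_num)%E.
  rewrite ge0_fin_numE ?Lnorm_ge0//.
  by move: lf; rewrite inE => /andP[_]; rewrite inE.
apply: EFin_inj; rewrite sq_norm_EFin//.
transitivity ('N[mu]_2%:E[EFin \o f] `^ 2)%E.
  by rewrite -[in RHS](fineK nf) poweR_EFin powR_mulrn// fine_ge0// Lnorm_ge0.
rewrite poweR_Lnorm//; apply: eq_integral => x _ /=.
by rewrite powR_mulrn// real_normK ?num_real.
Qed.

(** By Cauchy-Schwarz the absolute increments have summable integrals, so that
    their sum is finite almost everywhere. The limit is taken to be the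
    [limsup], which is measurable everywhere. *)
Lemma sq_integrable_increments (v : nat -> T -> R) : (forall n, sq_integrable (v n)) ->
  (forall k, \int[mu]_x ((v k.+1 x - v k x) ^+ 2) <= (2^-1 ^+ k) ^+ 2) ->
  exists2 g : T -> R, measurable_fun setT g &
    {ae mu, forall x, (fun k => v k x) @ \oo --> g x}.
Proof.
move=> hv vk; pose D k x := `|v k.+1 x - v k x|.
have hD k : sq_integrable (fun x => v k.+1 x - v k x) by exact: sq_integrable_sub.
have mD k : measurable_fun setT (D k).
  by apply: measurableT_comp => //; case: (hD k).
have mDe k : measurable_fun setT (fun x => (D k x)%:E) by exact/measurable_EFinP.
have D0 k x : (0 <= (D k x)%:E)%E by rewrite lee_fin normr_ge0.
have i2 k : 0 <= (2^-1 : R) ^+ k by rewrite exprn_ge0// invr_ge0.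
have iD k : integrableR (D k).
  apply: (@integrableR_dominated _ (fun x => 1 + (v k.+1 x - v k x) ^+ 2)) => //.
    by apply: integrableRD; [exact: integrableR_cst|exact: (hD k).2].
  move=> x; rewrite normr_id -(real_normK (num_real (v k.+1 x - v k x))).
  rewrite -/(D k x).
  by have := sqr_ge0 (D k x - 1); have := normr_ge0 (v k.+1 x - v k x); rewrite -/(D k x); nra.
have Dk k : \int[mu]_x D k x <= 2^-1 ^+ k.
  have h1 : sq_integrable (cst 1) by apply: (@sq_integrable_bounded _ 1) => // x; rewrite normr1.
  have hDk : sq_integrable (D k).
    split => //; move: (hD k).2; congr (mu.-integrable _ _).
    by apply/funext => x /=; rewrite real_normK ?num_real.
  have := sq_integrable_cauchy_schwarz hDk h1.
  rewrite (_ : \int[mu]_x (D k x * cst 1 x) = \int[mu]_x D k x); last first.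
    by apply: eq_Rintegral => x _; rewrite mulr1.
  rewrite (_ : \int[mu]_x (D k x ^+ 2) = \int[mu]_x ((v k.+1 x - v k x) ^+ 2)); last first.
    by apply: eq_Rintegral => x _; rewrite real_normK ?num_real.
  rewrite (_ : \int[mu]_x (cst 1 x ^+ 2) = 1); last first.
    transitivity (\int[mu]_(_ in setT) (1 : R)).
      by apply: eq_Rintegral => x _; rewrite expr1n.
    by rewrite Rintegral_cst// mul1r; exact: (congr1 fine (probability_setT mu)).
  rewrite mulr1 => /le_trans/(_ (vk k)).
  by rewrite ler_pXn2r// nnegrE// Rintegral_ge0// => x _; exact: normr_ge0.
have sumD : (\int[mu]_x (\sum_(k <oo) (D k x)%:E) <= 2%:E)%E.
  rewrite (integral_nneseries mu measurableT mDe (fun n x _ => D0 n x)).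
  apply: lime_le; first by apply: is_cvg_nneseries => n _ _; exact: integral_ge0.
  apply: nearW => n; rewrite big_mkord.
  rewrite (eq_bigr (fun k : 'I_n => (\int[mu]_x D k x)%:E)); last first.
    by move=> k _; rewrite /Rintegral fineK//; exact: integrable_fin_num (iD k).
  rewrite sumEFin lee_fin.
  apply: (@le_trans _ _ (2 - 2 * 2^-1 ^+ n)); last by rewrite gerBl mulr_ge0.
  elim: n => [|n IH]; first by rewrite big_ord0 expr0 mulr1 subrr.
  rewrite big_ord_recr/=; apply: le_trans (lerD IH (Dk n)) _.
  by rewrite exprS mulrA mulfV// mul1r; lra.
have intD : mu.-integrable setT (fun x => \sum_(k <oo) (D k x)%:E)%E.
  apply/integrableP; split.
    by apply: ge0_emeasurable_sum => // n _; exact: mDe.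
  rewrite (eq_integral (fun x => \sum_(k <oo) (D k x)%:E)%E).
    by apply: le_lt_trans sumD _; rewrite ltry.
  by move=> x _; rewrite gee0_abs//; apply: nneseries_ge0 => n _ _.
exists (fun x => fine (limn_esup (fun k => (v k x)%:E))).
  apply/measurable_EFinP/measurable_EFinP.
  apply: (@measurableT_comp _ _ _ _ _ _ fine) => //.
  apply: measurable_fun_limn_esup => n; apply/measurable_EFinP.
  by case: (hv n).
have := integrable_ae measurableT intD; apply: filterS => x /(_ I) Dfin.
have cD : cvgn (series (fun k => D k x)).
  apply: nnseries_is_cvg => [k|]; first exact: normr_ge0.
  by rewrite -ge0_fin_numE// nneseries_ge0.
have /cvg_ex[l cl] : cvgn (series (fun k => v k.+1 x - v k x)) by exact: normed_cvg.
have vl : (fun k => v k x) @ \oo --> v 0%N x + l.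
  rewrite (_ : (fun k => v k x) = (fun k => v 0%N x + series (fun k => v k.+1 x - v k x) k)).
    by apply: cvgD => //; exact: cvg_cst.
  apply/funext => k; rewrite /series/= telescope_sumr// addrC subrK//.
have vE : (fun k => (v k x)%:E) @ \oo --> (v 0%N x + l)%:E.
  by apply: cvg_EFin => //; exact: nearW.
by have [_ ->] := cvg_limn_einf_sup vE.
Qed.

(** Fatou's lemma for the squared distances to [f]. *)
Lemma sq_norm_fatou (v : nat -> T -> R) (g f : T -> R) (c : R) :
  (forall n, sq_integrable (v n)) -> sq_integrable f -> measurable_fun setT g ->
  {ae mu, forall x, (fun k => v k x) @ \oo --> g x} ->
  (\forall k \near \oo, \int[mu]_x ((v k x - f x) ^+ 2) <= c) ->
  sq_integrable (fun x => g x - f x) /\ \int[mu]_x ((g x - f x) ^+ 2) <= c.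
Proof.
move=> hv hf mg vg [N _ vc]; have [mf _] := hf.
have mgf : measurable_fun setT (fun x => g x - f x) by exact: measurable_funB.
have hvf k : sq_integrable (fun x => v k x - f x) by exact: sq_integrable_sub.
have m2 k : measurable_fun setT (fun x => ((v k x - f x) ^+ 2)%:E).
  by apply/measurable_EFinP; apply: measurable_funX; case: (hvf k).
have mgf2 : measurable_fun setT (fun x => ((g x - f x) ^+ 2)%:E).
  by apply/measurable_EFinP; exact: measurable_funX.
have ge0 k x : (0 <= ((v k x - f x) ^+ 2)%:E)%E by rewrite lee_fin sqr_ge0.
have le_c : (\int[mu]_x ((g x - f x) ^+ 2)%:E <= c%:E)%E.
  have -> : (\int[mu]_x ((g x - f x) ^+ 2)%:E =
      \int[mu]_x limn_einf (fun k => ((v k x - f x) ^+ 2)%:E))%E.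
    apply: ge0_ae_eq_integral => //.
    - rewrite /limn_einf; apply: measurableT_comp => //.
      apply: measurable_fun_limn_esup => k; apply: measurableT_comp => //.
    - by move=> x _; rewrite lee_fin sqr_ge0.
    - move=> x _; rewrite limn_einf_lim; apply: lime_ge; first exact: is_cvg_einfs.
      by apply: nearW => k; apply: le_ereal_inf_tmp => _ [m _ <-].
    apply: filterS vg => x vx _.
    have vE : (fun k => ((v k x - f x) ^+ 2)%:E) @ \oo --> ((g x - f x) ^+ 2)%:E.
      apply: cvg_EFin; first exact: nearW.
      have vf : (fun k => v k x - f x) @ \oo --> g x - f x.
        by apply: cvgB => //; exact: cvg_cst.
      exact: (cvgM vf vf).
    by have [-> _] := cvg_limn_einf_sup vE.
  apply: (le_trans (fatou mu measurableT m2 (fun n x _ => ge0 n x))).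
  rewrite limn_einf_lim; apply: lime_le; first exact: is_cvg_einfs.
  apply: nearW => k; pose j := maxn N k.
  apply: (@le_trans _ _ (\int[mu]_x ((v j x - f x) ^+ 2)%:E)%E).
    by apply: ereal_inf_lbound; exists j => //=; exact: leq_maxr.
  by rewrite -sq_norm_EFin// lee_fin; apply: vc; exact: leq_maxl.
have hgf : sq_integrable (fun x => g x - f x).
  split=> //; apply/integrableP; split=> //.
  rewrite (eq_integral (fun x => ((g x - f x) ^+ 2)%:E)) => [|x _].
    by apply: le_lt_trans le_c _; rewrite ltry.
  by rewrite gee0_abs// lee_fin sqr_ge0.
by split=> //; rewrite -lee_fin sq_norm_EFin.
Qed.

(** The Riesz-Fischer theorem for [L^2]: a subsequence with geometrically
    small increments converges almost everywhere, and Fatou's lemma turns its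
    limit into a limit in [L^2] of the whole sequence. *)
Theorem sq_integrable_complete (u : nat -> T -> R) : (forall n, sq_integrable (u n)) ->
  (forall e, 0 < e -> exists N, forall m n, (N <= m)%N -> (N <= n)%N ->
     \int[mu]_x ((u m x - u n x) ^+ 2) < e) ->
  exists2 g, sq_integrable g &
    (fun n => \int[mu]_x ((u n x - g x) ^+ 2)) @ \oo --> 0.
Proof.
move=> hu uC.
have e0 k : 0 < ((2^-1 : R) ^+ k) ^+ 2 by rewrite !exprn_gt0// invr_gt0.
pose N k := projT1 (cid (uC _ (e0 k))).
have NP k m n : (N k <= m)%N -> (N k <= n)%N ->
    \int[mu]_x ((u m x - u n x) ^+ 2) < (2^-1 ^+ k) ^+ 2.
  exact: (projT2 (cid (uC _ (e0 k)))).
(* partial sums make the ranks monotone in [k] *)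
pose s k := (\sum_(i < k.+1) N i)%N.
have Ns k : (N k <= s k)%N by rewrite /s big_ord_recr leq_addl.
have ss k : (s k <= s k.+1)%N by rewrite /s [X in (_ <= X)%N]big_ord_recr leq_addr.
have smono k j : (k <= j)%N -> (s k <= s j)%N.
  by apply: (homo_leq (leqnn) leq_trans).
have [|k|g mg vg] := @sq_integrable_increments (fun k => u (s k)).
- by move=> k; exact: hu.
- by apply: ltW; apply: NP => //; exact: leq_trans (Ns k) (ss k).
have H k n : (N k <= n)%N -> sq_integrable (fun x => g x - u n x) /\
    \int[mu]_x ((g x - u n x) ^+ 2) <= (2^-1 ^+ k) ^+ 2.
  move=> kn; apply: (@sq_norm_fatou (fun j => u (s j))) => //.
  exists k => // j /= kj; apply: ltW; apply: NP => //.
  exact: leq_trans (Ns k) (smono _ _ kj).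
exists g.
  have [h _] := H 0%N _ (leqnn _); have := sq_integrable_add h (hu (N 0%N)).
  by congr sq_integrable; apply/funext => x; rewrite subrK.
apply/cvgrPdist_lt => e ep.
have [k ke] : exists k, ((2^-1 : R) ^+ k) ^+ 2 < e.
  have : (fun k => (2^-1 : R) ^+ k) @ \oo --> (0 : R).
    by apply: cvg_expr; rewrite ger0_norm ?invr_ge0// invf_lt1// ltr1n.
  have m0 : 0 < Num.min e 1 by rewrite lt_min ep ltr01.
  move=> /cvgrPdist_lt/(_ _ m0)[k _ /(_ k (leqnn k))] /=.
  rewrite sub0r normrN ger0_norm ?exprn_ge0 ?invr_ge0// lt_min => /andP[ke k1].
  exists k; apply: le_lt_trans ke; rewrite expr2 ler_piMl ?exprn_ge0 ?invr_ge0//.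
  exact: ltW.
exists (N k) => // n /= kn; rewrite sub0r normrN ger0_norm ?sq_norm_ge0//.
apply: le_lt_trans ke; have [_] := H k n kn; congr (_ <= _).
by apply: eq_Rintegral => x _; rewrite -sqrrN opprB.
Qed.

End SquareIntegrable.

(** * Fubini on the cube and lower orthants *)

Lemma ae_eq_integrable_trans d (T : measurableType d) (R : realType)
    (mu : {measure set T -> \bar R}) (f g : T -> \bar R) :
  measurable_fun setT g -> ae_eq mu setT f g -> mu.-integrable setT f ->
  mu.-integrable setT g.
Proof.
move=> mg fg /integrableP[mf f_fin]; apply/integrableP; split=> //.
rewrite -(@ge0_ae_eq_integral _ _ _ mu setT (fun x => `|f x|%E))//.
- exact: measurableT_comp.
- exact: measurableT_comp.
- by apply: filterS fg => x /= fgx /fgx ->.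
Qed.

Section RealFubini.
Context d1 d2 (T1 : measurableType d1) (T2 : measurableType d2) (R : realType).
Variables (m1 : probability T1 R) (m2 : probability T2 R) (f : T1 * T2 -> R).
Hypothesis f_int : (m1 \x m2)%E.-integrable setT (EFin \o f).

(** Fubini's theorem for real integrals; the inner real integral differs from
    the extended one only on the null set where the latter is infinite. *)
Lemma Rintegral_prod1 :
  m1.-integrable setT (EFin \o (fun x => \int[m2]_y f (x, y))) /\
  \int[(m1 \x m2)%E]_z f z = \int[m1]_x \int[m2]_y f (x, y).
Proof.
pose F x := (\int[m2]_y (f (x, y))%:E)%E.
have iF : m1.-integrable setT F by exact: integrable_fubini_F f_int.
have aeF : {ae m1, forall x, [set: T1] x -> F x = (\int[m2]_y f (x, y))%:E}.
  have := ae_integrable1 f_int; apply: filterS => x /= ix _.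
  by rewrite /Rintegral fineK//; apply: integrable_fin_num.
have mF : measurable_fun setT (EFin \o (fun x => \int[m2]_y f (x, y))).
  apply/measurable_EFinP; apply: (@measurableT_comp _ _ _ _ _ _ fine) => //.
  exact: measurable_int iF.
split.
  exact: ae_eq_integrable_trans aeF iF.
rewrite {1}/Rintegral -integral12_prod_meas1//; congr fine.
by apply: ae_eq_integral => //; exact: measurable_int iF.
Qed.

Lemma Rintegral_prod2 :
  \int[(m1 \x m2)%E]_z f z = \int[m2]_y \int[m1]_x f (x, y).
Proof.
pose G y := (\int[m1]_x (f (x, y))%:E)%E.
have mG : measurable_fun setT G by exact: measurable_fubini_G f_int.
have aeG : {ae m2, forall y, [set: T2] y -> G y = (\int[m1]_x f (x, y))%:E}.
  have := ae_integrable2 f_int; apply: filterS => y /= iy _.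
  by rewrite /Rintegral fineK//; apply: integrable_fin_num.
rewrite {1}/Rintegral -integral21_prod_meas1//; congr fine.
apply: ae_eq_integral => //; apply/measurable_EFinP.
exact: (@measurableT_comp _ _ _ _ _ _ fine).
Qed.

End RealFubini.

Section UnitInterval.
Variable R : realType.
Local Notation X := (measurableTypeR R).
Local Notation U := (unit_interval_measure R).
Local Notation leb := (@lebesgue_measure R).

Lemma unit_interval_outside : U (~` `[0, 1]%classic) = 0%E.
Proof. by rewrite /unit_interval_measure /mrestr setICl measure0. Qed.

Lemma Rintegral_unit_interval (f : X -> R) : integrableR U f ->
  \int[U]_x f x = \int[leb]_(x in `[0, 1]) f x.
Proof.
move=> if_; rewrite /Rintegral; congr fine.
rewrite (@negligible_integral _ _ _ U setT (~` (`[0, 1]%classic : set X)))//; last first.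
- exact: unit_interval_outside.
- exact: measurableC.
rewrite setTD setCK; apply: eq_measure_integral => A mA A01.
by rewrite /unit_interval_measure /mrestr; congr (lebesgue_measure _); exact/setIidl.
Qed.

End UnitInterval.

Section CubeMeasure.
Variable R : realType.
Local Notation X := (measurableTypeR R).
Local Notation U := (unit_interval_measure R).
Local Notation C := (cube_measure R).

Lemma measurable_coord n (v : 'I_n) : measurable_fun setT (fun t : n.-tuple X => tnth t v).
Proof. exact: measurable_tnth. Qed.

Lemma Rintegral_cubeS n (f : n.+1.-tuple X -> R) : integrableR (C n.+1) f ->
  \int[C n.+1]_t f t = \int[U]_x \int[C n]_t f [tuple of x :: t].
Proof.
move=> if_.
have mf : measurable_fun setT f by exact: integrableR_measurable if_.
have mfc : measurable_fun setT (f \o @tuple_cons R n).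
  by apply: measurableT_comp => //; exact: measurable_tuple_cons.
have ifc : (U \x C n)%E.-integrable setT (EFin \o (f \o @tuple_cons R n)).
  apply/integrableP; split; first exact/measurable_EFinP.
  move/integrableP : if_ => [_]; rewrite /=.
  by rewrite ge0_integral_distribution//; apply/measurable_EFinP; exact: measurableT_comp.
rewrite {1}/Rintegral integral_distribution//; last exact/measurable_EFinP.
by have [_] := Rintegral_prod1 ifc.
Qed.

Lemma Rintegral_cube0 (f : 0.-tuple X -> R) : \int[C 0]_t f t = f [tuple].
Proof.
have -> : \int[C 0]_t f t = \int[C 0]_t (cst (f [tuple]) t).
  by apply: eq_Rintegral => t _; rewrite tuple0.
by rewrite Rintegral_cst// (congr1 fine (probability_setT (C 0))) mulr1.
Qed.

Lemma measurable_prod_coord n (G : 'I_n -> X -> R) :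
  (forall v, measurable_fun setT (G v)) ->
  measurable_fun setT (fun t : n.-tuple X => \prod_v G v (tnth t v)).
Proof.
move=> mG; apply: measurable_prod => v _.
by apply: measurableT_comp => //; exact: measurable_coord.
Qed.

Lemma prod_bounded (I : finType) (a b : I -> R) : (forall v, `|a v| <= b v) ->
  `|\prod_v a v| <= \prod_v b v.
Proof.
move=> ab; rewrite normr_prod; apply: ler_prod => v _.
by rewrite normr_ge0 ab.
Qed.

Lemma Rintegral_cube_prod n (G : 'I_n -> X -> R) (M : 'I_n -> R) :
  (forall v, measurable_fun setT (G v)) -> (forall v x, `|G v x| <= M v) ->
  \int[C n]_t (\prod_v G v (tnth t v)) = \prod_v \int[U]_x G v x.
Proof.
elim: n G M => [|n IH] G M mG GM; first by rewrite Rintegral_cube0 !big_ord0.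
rewrite Rintegral_cubeS; last first.
  apply: (@integrableR_bounded _ _ _ _ _ (\prod_v M v)); first exact: measurable_prod_coord.
  by move=> t; exact: prod_bounded.
have iG : integrableR U (G ord0) by exact: (integrableR_bounded _ (mG ord0) (GM ord0)).
have iG' : integrableR (C n) (fun t => \prod_(v < n) G (lift ord0 v) (tnth t v)).
  apply: (@integrableR_bounded _ _ _ _ _ (\prod_(v < n) M (lift ord0 v))).
    exact: (@measurable_prod_coord n (fun v => G (lift ord0 v))).
  by move=> t; exact: prod_bounded.
rewrite big_ord_recl -(IH (fun v => G (lift ord0 v)) (fun v => M (lift ord0 v)))//.
rewrite -RintegralZr//; apply: eq_Rintegral => x _.
rewrite -RintegralZl//; apply: eq_Rintegral => t _.
rewrite big_ord_recl tnth0; congr (_ * _).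
by apply: eq_bigr => v _; rewrite tnthS.
Qed.

(** Lower orthants: they form a pi-system that generates the Borel sets of the
    cube, and their indicators are products. *)
Definition box n (b : 'I_n -> R) : set (n.-tuple X) :=
  [set t | forall v, tnth t v < b v].

Definition boxes n : set (set (n.-tuple X)) := range (@box n).

Lemma box_indicator n (b : 'I_n -> R) t :
  \1_(box b) t = \prod_v \1_(`]-oo, b v[%classic) (tnth t v) :> R.
Proof.
rewrite indicE; have [bt|bt] := boolP (t \in box b).
  rewrite big1// => v _; rewrite indicE mem_set//= in_itv/=.
  by move: bt; rewrite inE; exact.
move: bt; rewrite notin_setE => /existsNP[v tv].
rewrite (bigD1 v)//= indicE memNset ?mul0r//= in_itv/=; exact/negP.
Qed.

Lemma boxes_setI_closed n : setI_closed (@boxes n).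
Proof.
move=> _ _ [b _ <-] [b' _ <-]; exists (fun v => Num.min (b v) (b' v)) => //.
apply/seteqP; split=> t /=.
  by move=> H; split=> v; have := H v; rewrite lt_min => /andP[].
by move=> [H H'] v; rewrite lt_min H H'.
Qed.

Lemma boxes_cover n : \bigcup_k box (fun _ : 'I_n => k%:R) = setT.
Proof.
apply/seteqP; split=> // t _.
pose M : R := \sum_v `|tnth t v|.
have M0 : 0 <= M by exact: sumr_ge0.
exists (Num.bound M) => // v; apply: le_lt_trans (archi_boundP M0).
rewrite (le_trans (ler_norm _))// /M (bigD1 v)//= lerDl.
exact: sumr_ge0.
Qed.

Lemma measurable_box n (b : 'I_n -> R) : measurable (box b).
Proof.
have -> : box b = \bigcap_(v in [set: 'I_n]) ((fun t => tnth t v) @^-1` `]-oo, b v[%classic).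
  apply/seteqP; split=> [t H v _|t H v] /=; first by rewrite in_itv/=; exact: H.
  by have := H v I; rewrite /= in_itv.
apply: fin_bigcap_measurable => // v _.
have := @measurable_coord n v; rewrite -[X in measurable X]setTI; apply => //.
Qed.

Lemma measurable_boxesE n : @measurable _ (n.-tuple X) = <<s @boxes n >>.
Proof.
apply/seteqP; split; last first.
  apply: smallest_sub; first exact: sigma_algebra_measurable.
  by move=> _ [b _ <-]; exact: measurable_box.
apply: smallest_sub; first exact: smallest_sigma_algebra.
rewrite -bigcup_seq; apply: bigcup_sub => v _ _ [B mB <-].
have : measurable_fun [set: g_sigma_algebraType (@boxes n)] (fun t : n.-tuple X => tnth t v).
  apply: (measurability _ (RGenInftyO.measurableE R)) => _ [_ [x ->] <-].
  rewrite setTI.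
  have -> : (fun t : n.-tuple X => tnth t v) @^-1` `]-oo, x[%classic =
      \bigcup_k box (fun w => if w == v then x else k%:R).
    apply/seteqP; split=> t /=; rewrite in_itv/=.
      move=> tx; have : (\bigcup_k box (fun _ : 'I_n => k%:R)) t by rewrite boxes_cover.
      by move=> [k _ tk]; exists k => // w; case: eqP => [->|_] //; exact: tk.
    by move=> [k _ /(_ v)]; rewrite eqxx.
  apply: bigcup_measurable => k _; apply: sub_sigma_algebra; by eexists.
by move=> /(_ measurableT B mB).
Qed.

Lemma cube_measure_unique n (m : {measure set (n.-tuple X) -> \bar R}) :
  (forall b : 'I_n -> R, C n (box b) = m (box b)) ->
  forall A, measurable A -> C n A = m A.
Proof.
move=> Cm A mA; apply: (measure_unique (@boxes n) (fun k => box (fun=> k%:R))) => //.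
- exact: measurable_boxesE.
- exact: boxes_setI_closed.
- by move=> k; eexists.
- exact: boxes_cover.
- by move=> _ [b _ <-]; exact: Cm.
- by move=> k; rewrite -ge0_fin_numE// fin_num_measure//; exact: measurable_box.
Qed.

End CubeMeasure.

(** * Redrawing a coordinate, and functions with null integrals over orthants *)

Section DensityMeasure.
Context d (T : measurableType d) (R : realType) (mu : {measure set T -> \bar R}).
Variables (f : T -> \bar R) (mf : measurable_fun setT f) (f0 : forall x, (0 <= f x)%E).

(** The two side conditions are arguments so that the measure structure can be
    attached to this set function. *)
Definition density_measure of measurable_fun setT f & (forall x, (0 <= f x)%E) :
  set T -> \bar R := fun A => (\int[mu]_(t in A) f t)%E.

Let nu0 : density_measure mf f0 set0 = 0%E.
Proof. by rewrite /density_measure integral_set0. Qed.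

Let nu_ge0 A : (0 <= density_measure mf f0 A)%E.
Proof. by apply: integral_ge0 => x _; exact: f0. Qed.

Let nu_sigma : semi_sigma_additive (density_measure mf f0).
Proof. exact: semi_sigma_additive_nng_induced. Qed.

HB.instance Definition _ := isMeasure.Build _ _ _ (density_measure mf f0)
  nu0 nu_ge0 nu_sigma.

End DensityMeasure.

Section RealDominatedConvergence.
Context d (T : measurableType d) (R : realType) (mu : probability T R).

Lemma Rdominated_cvg (f_ : nat -> T -> R) (f g : T -> R) :
  (forall n, measurable_fun setT (f_ n)) -> measurable_fun setT f ->
  integrableR mu g -> (forall n x, `|f_ n x| <= g x) ->
  (forall x, (fun n => f_ n x) @ \oo --> f x) ->
  (fun n => \int[mu]_x f_ n x) @ \oo --> \int[mu]_x f x.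
Proof.
move=> mf_ mf ig fg ff.
have [|||||if_ _ H] := @dominated_convergence _ _ _ mu setT measurableT
   (fun n => EFin \o f_ n) (EFin \o f) (EFin \o g).
- by move=> n; exact/measurable_EFinP.
- exact/measurable_EFinP.
- apply: nearW => x _; apply: cvg_EFin; first exact: nearW.
  exact: ff.
- exact: ig.
- by apply: nearW => x n _ /=; rewrite lee_fin.
suff : (fun n => (\int[mu]_x (f_ n x)%:E)%E) @ \oo --> (\int[mu]_x f x)%:E.
  by move/fine_cvg.
by rewrite /Rintegral fineK//; exact: (integrable_fin_num measurableT if_).
Qed.

End RealDominatedConvergence.

Section CubeResampling.
Variable R : realType.
Local Notation X := (measurableTypeR R).
Local Notation U := (unit_interval_measure R).
Local Notation C := (cube_measure R).

Definition resample n (v : 'I_n) (z : n.-tuple X * X) : n.-tuple X :=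
  [tuple (if i == v then z.2 else tnth z.1 i) | i < n].

Lemma tnth_resample n (v w : 'I_n) z :
  tnth (resample v z) w = if w == v then z.2 else tnth z.1 w.
Proof. by rewrite tnth_mktuple. Qed.

Lemma measurable_resample n (v : 'I_n) : measurable_fun setT (resample v).
Proof.
apply/measurable_fun_tnthP => w.
have [->|wv] := eqVneq w v.
  rewrite (_ : _ \o _ = snd); first by [].
  by apply/funext => z /=; rewrite tnth_resample eqxx.
rewrite (_ : _ \o _ = (fun t : n.-tuple X => tnth t w) \o fst).
  by apply: measurableT_comp => //; exact: measurable_coord.
by apply/funext => z /=; rewrite tnth_resample (negbTE wv).
Qed.

HB.instance Definition _ n (v : 'I_n) :=
  isMeasurableFun.Build _ _ _ _ (@resample n v) (@measurable_resample n v).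

Lemma measurable_ray (b : R) : measurable_fun setT (\1_(`]-oo, b[%classic : set X) : X -> R).
Proof. exact: measurable_indic. Qed.

Lemma indic_le1 (T : Type) (A : set T) x : `|(\1_A x : R)| <= 1.
Proof. by rewrite indicE; case: (_ \in _); rewrite ?normr1 ?normr0. Qed.

Lemma resample_box n (v : 'I_n) b :
  C n (box b) = distribution (C n \x U)%E (@resample n v) (box b).
Proof.
set P := distribution _ _.
have mb := @measurable_box R n b.
suff : \int[C n]_t (\1_(box b) t) = \int[(C n \x U)%E]_z (\1_(box b) (resample v z)).
  rewrite {1}/Rintegral integral_indic// setIT.
  have -> : \int[(C n \x U)%E]_z (\1_(box b) (resample v z)) =
      fine (\int[(C n \x U)%E]_z (\1_(resample v @^-1` box b) z)%:E) by [].
  have mb' : measurable (resample v @^-1` box b).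
    by have := measurable_resample v; rewrite -[X in measurable X]setTI; apply.
  rewrite integral_indic// setIT => H.
  have := congr1 EFin H; rewrite !fineK ?fin_num_measure//.
  exact: (fin_num_measure ((C n \x U)%E : probability _ R)).
have iz : integrableR (C n \x U)%E (fun z => \1_(box b) (resample v z) : R).
  apply: (@integrableR_bounded _ _ _ _ _ 1) => [|z]; last exact: indic_le1.
  apply: (@measurableT_comp _ _ _ _ _ _ (\1_(box b) : n.-tuple X -> R)); first exact: measurable_indic.
  exact: measurable_resample.
have [_ ->] := Rintegral_prod1 iz.
pose G w : X -> R := \1_(`]-oo, b w[%classic).
pose G' w : X -> R := if w == v then cst 1 else G w.
have mG w : measurable_fun setT (G w) by exact: measurable_ray.
have mG' w : measurable_fun setT (G' w) by rewrite /G'; case: ifP.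
have G1 w x : `|G w x| <= 1 by exact: indic_le1.
have G'1 w x : `|G' w x| <= 1 by rewrite /G'; case: ifP => //=; rewrite normr1.
have iG w : integrableR U (G w) by exact: (@integrableR_bounded _ _ _ _ _ 1).
transitivity (\int[C n]_t (\prod_w G w (tnth t w))).
  by apply: eq_Rintegral => t _; exact: box_indicator.
rewrite (@Rintegral_cube_prod _ _ G (fun=> 1))//.
transitivity (\int[C n]_t (\prod_w G' w (tnth t w) * \int[U]_x G v x)); last first.
  apply: eq_Rintegral => t _; rewrite -RintegralZl//; last exact: iG.
  apply: eq_Rintegral => x _; rewrite box_indicator.
  rewrite (bigD1 v)//= (bigD1 v (P := predT))//= {1}/G' eqxx mul1r mulrC.
  rewrite tnth_resample eqxx /=; congr (_ * _).
  by apply: eq_bigr => w wv; rewrite tnth_resample /G' (negbTE wv).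
rewrite RintegralZr//; last first.
  apply: (@integrableR_bounded _ _ _ _ _ (\prod_(w < n) 1)).
    exact: measurable_prod_coord.
  by move=> t; apply: prod_bounded.
rewrite (@Rintegral_cube_prod _ _ G' (fun=> 1))//.
rewrite (bigD1 v)//= [in RHS](bigD1 v)//= {1}/G' eqxx.
rewrite Rintegral_cst// (congr1 fine (probability_setT U)) !mul1r mulrC.
by congr (_ * _); apply: eq_bigr => w wv; rewrite /G' (negbTE wv).
Qed.

(** Redrawing one coordinate of a uniform point leaves its law unchanged: this
    is the one-variable Fubini theorem on the cube, in any direction. *)
Lemma Rintegral_resample n (v : 'I_n) (f : n.-tuple X -> R) (M : R) :
  measurable_fun setT f -> (forall t, `|f t| <= M) ->
  \int[C n]_t f t = \int[C n]_t \int[U]_x f (resample v (t, x)).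
Proof.
move=> mf fM.
have mfr : measurable_fun setT (f \o resample v).
  by apply: measurableT_comp => //; exact: measurable_resample.
have ifr : (C n \x U)%E.-integrable setT (EFin \o (f \o resample v)).
  by apply: (@integrableR_bounded _ _ _ _ _ M) => // z; exact: fM.
have [_ <-] := Rintegral_prod1 ifr.
rewrite /Rintegral; congr fine.
rewrite (@eq_measure_integral _ _ _ _ (distribution (C n \x U)%E (@resample n v))).
  by rewrite integral_distribution//; exact/measurable_EFinP.
move=> A mA _; apply: cube_measure_unique => // b; exact: resample_box.
Qed.

(** An integrable function whose integral over every box vanishes is null: the
    measures of densities [g^+] and [g^-] agree on a pi-system. *)
Lemma ae_zero_boxes n (g : n.-tuple X -> R) : integrableR (C n) g ->
  (forall b, \int[C n]_t (g t * \1_(box b) t) = 0) ->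
  {ae C n, forall t, g t = 0}.
Proof.
move=> ig gb.
have mg : measurable_fun setT (EFin \o g) by exact: measurable_int ig.
have mgp := measurable_funepos mg; have mgn := measurable_funeneg mg.
pose m1 := density_measure (C n) mgp (fun x => funepos_ge0 _ x).
pose m2 := density_measure (C n) mgn (fun x => funeneg_ge0 _ x).
have igS A : measurable A -> (C n).-integrable A (EFin \o g).
  by move=> mA; apply: integrableS ig.
have fin1 A : measurable A -> (m1 A \is a fin_num)%E.
  by move=> mA; apply: integrable_fin_num => //; apply: integrable_funepos => //; exact: igS.
have fin2 A : measurable A -> (m2 A \is a fin_num)%E.
  by move=> mA; apply: integrable_fin_num => //; apply: integrable_funeneg => //; exact: igS.
have m12 A : measurable A -> m1 A = m2 A.
  move=> mA; apply: (measure_unique (@boxes R n) (fun k => box (fun=> k%:R))) => //.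
  - exact: measurable_boxesE.
  - exact: boxes_setI_closed.
  - by move=> k; eexists.
  - exact: boxes_cover.
  - move=> _ [b _ <-]; have mb := @measurable_box R n b.
    have : (\int[C n]_(t in box b) (g t)%:E = 0)%E.
      have E : \int[C n]_(t in box b) g t = 0.
        rewrite -(gb b) Rintegral_mkcond; apply: eq_Rintegral => t _.
        by rewrite patchE indicE; case: ifP => _; rewrite ?mulr1 ?mulr0.
      have fin : (\int[C n]_(t in box b) (g t)%:E)%E \is a fin_num.
        by apply: integrable_fin_num => //; exact: igS.
      by rewrite -(fineK fin) -[fine _]/(\int[C n]_(t in box b) g t) E.
    rewrite integralE => /eqP E; apply/eqP; move: E.
    by rewrite sube_eq ?add0e//; exact: (fin1 _ mb).
  - by move=> k; have := fin1 _ (@measurable_box R n (fun=> k%:R)); rewrite ge0_fin_numE.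
have : ae_eq (C n) setT (EFin \o g) (cst 0%E).
  apply: integral_ae_eq => // A _ mA.
  rewrite integral0 integralE.
  by have := m12 A mA; rewrite /m1 /m2 /density_measure => ->; rewrite subee//; exact: fin2.
by apply: filterS => t /= /(_ I) [].
Qed.

End CubeResampling.

(** * Test functions of one variable *)

Lemma Rintegral_eq0 d (T : measurableType d) (R : realType)
    (mu : {measure set T -> \bar R}) (A : set T) (f : T -> R) :
  (forall x, A x -> f x = 0) -> \int[mu]_(x in A) f x = 0.
Proof.
move=> f0; rewrite /Rintegral (eq_integral (cst 0%E)) ?integral0// => x.
by rewrite inE => /f0 ->.
Qed.

Section SmoothFunctions.
Variable R : realType.
Implicit Types f g : R -> R.

Fixpoint differentiable_upto (n : nat) f : Prop :=
  if n is m.+1 then (forall x, derivable f x 1) /\ differentiable_upto m (f^`())%classic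
  else True.

Definition smooth1 f : Prop := forall n, differentiable_upto n f.

Lemma differentiable_uptoS n f : differentiable_upto n.+1 f -> differentiable_upto n f.
Proof. by elim: n f => // n IH f [df /IH H]; split. Qed.

Lemma smooth1_derivable f x : smooth1 f -> derivable f x 1.
Proof. by move=> /(_ 1%N)[]. Qed.

Lemma smooth1_derive f : smooth1 f -> smooth1 (f^`())%classic.
Proof. by move=> sf n; have [] := sf n.+1. Qed.

Lemma smooth1_is_derive f (x : R) : smooth1 f -> is_derive x 1 f ((f^`())%classic x).
Proof. by move=> sf; rewrite derive1E; apply: derivableP; exact: smooth1_derivable. Qed.

Lemma smooth1_continuous f : smooth1 f -> continuous f.
Proof.
move=> sf x; apply/differentiable_continuous/derivable1_diffP.
exact: smooth1_derivable.
Qed.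

Lemma is_derive_derive1 f f' : (forall x : R, is_derive x 1 f (f' x)) -> (f^`())%classic = f'.
Proof. by move=> H; apply/funext => x; rewrite derive1E; have [_] := H x. Qed.

Lemma differentiable_upto_add n f g : differentiable_upto n f ->
  differentiable_upto n g -> differentiable_upto n (fun x => f x + g x).
Proof.
elim: n f g => // n IH f g [df nf] [dg ng]; split=> [x|].
  by apply: derivableD; [exact: df|exact: dg].
have -> : ((fun x => f x + g x)^`())%classic =
    (fun x => (f^`())%classic x + (g^`())%classic x).
  apply: is_derive_derive1 => x; rewrite !derive1E.
  by apply: is_deriveD; apply: derivableP.
exact: IH.
Qed.

Lemma differentiable_upto_mul n f g : differentiable_upto n f ->
  differentiable_upto n g -> differentiable_upto n (fun x => f x * g x).
Proof.
elim: n f g => // n IH f g nf ng; have [df nf'] := nf; have [dg ng'] := ng.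
split=> [x|]; first by apply: derivableM; [exact: df|exact: dg].
have -> : ((fun x => f x * g x)^`())%classic =
    (fun x => f x * (g^`())%classic x + g x * (f^`())%classic x).
  apply: is_derive_derive1 => x; rewrite !derive1E.
  by apply: is_deriveM; apply: derivableP.
by apply: differentiable_upto_add; apply: IH => //; exact: differentiable_uptoS.
Qed.

Lemma differentiable_upto_cst n c : differentiable_upto n (fun=> c).
Proof.
elim: n c => // n IH c; split=> [x|]; first exact: derivable_cst.
have -> : ((fun=> c : R)^`())%classic = (fun=> 0).
  by apply: is_derive_derive1 => x; exact: is_derive_cst.
exact: IH.
Qed.

Lemma differentiable_upto_affine n f (a b : R) : differentiable_upto n f ->
  differentiable_upto n (fun x => f (a * x + b)).
Proof.
elim: n f => // n IH f [df nf].
have ia (x : R) : is_derive x 1 (fun y : R => a * y + b) a.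
  have h := @is_deriveD R R R _ _ x 1 _ _
    (@is_deriveZ R R R id a x 1 _ (is_derive_id x 1)) (is_derive_cst b x 1).
  by apply: (is_derive_eq h); rewrite addr0 /GRing.scale/= mulr1.
have ic (x : R) : is_derive x 1 (fun y => f (a * y + b)) (a * (f^`())%classic (a * x + b)).
  have h : is_derive (a * x + b) 1 f ((f^`())%classic (a * x + b)).
    by rewrite derive1E; apply: derivableP; exact: df.
  exact: (is_derive_eq (@is_derive1_comp R f (fun y => a * y + b) x _ _ h (ia x)) (mulrC _ _)).
split=> [x|]; first by have [] := ic x.
rewrite (is_derive_derive1 ic); apply: differentiable_upto_mul.
  exact: differentiable_upto_cst.
exact: IH.
Qed.

(** The functions [P (1/x) exp (-1/x)] on the positive half-line form a class
    closed under differentiation, whence the smoothness of [exp (-1/x)]. *)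
Definition flat (P : {poly R}) (x : R) : R :=
  if 0 < x then P.[x^-1] * expR (- x^-1) else 0.

Lemma expR_ge_power (n : nat) (y : R) : 0 <= y -> (y / n.+1%:R) ^+ n.+1 <= expR y.
Proof.
move=> y0; have {2}-> : y = n.+1%:R * (y / n.+1%:R) by rewrite mulrC divfK.
rewrite expRM_natl lerXn2r ?nnegrE ?expR_ge0 ?divr_ge0//.
by apply: le_trans (expR_ge1Dx _); rewrite lerDr.
Qed.

(** The bound by a multiple of [|x|], applied to ['X * P], is the derivative
    of [flat P] at 0. *)
Lemma flat_le (P : {poly R}) : exists2 K : R, 0 <= K &
  forall x, `|x| <= 1 -> `|flat P x| <= K * `|x|.
Proof.
pose n := size P; pose M := \sum_(i < n) `|P`_i|.
pose N : R := n.+1%:R ^+ n.+1.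
have M0 : 0 <= M by exact: sumr_ge0.
have N0 : 0 <= N by rewrite exprn_ge0.
exists (M * N) => [|x x1]; first exact: mulr_ge0.
rewrite /flat; case: ifPn => x0; last by rewrite normr0 !mulr_ge0.
move: x1; rewrite (gtr0_norm x0) => x1.
have y1 : 1 <= x^-1 by rewrite invr_ge1 ?unitfE ?gt_eqF//.
set y := x^-1 in y1 *; have y0 : 0 < y by rewrite invr_gt0.
have Py : `|P.[y]| <= M * y ^+ n.
  rewrite horner_coef (le_trans (ler_norm_sum _ _ _))// mulr_suml ler_sum// => i _.
  rewrite normrM normrX (gtr0_norm y0) ler_wpM2l//.
  by rewrite ler_weXn2l// ltnW.
have ey : y ^+ n.+1 <= N * expR y.
  have := expR_ge_power n (ltW y0); rewrite expr_div_n ler_pdivrMr ?exprn_gt0//.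
  by rewrite mulrC.
have yx : x = y^-1 by rewrite /y invrK.
have H : `|P.[y]| * y <= M * N * expR y.
  apply: (le_trans (ler_wpM2r (ltW y0) Py)).
  by rewrite -!mulrA -exprSr ler_wpM2l.
rewrite normrM (gtr0_norm (expR_gt0 _)) expRN yx.
by rewrite ler_pdivrMr ?expR_gt0// mulrAC ler_pdivlMr.
Qed.

Lemma is_derive_flat (P : {poly R}) (x : R) :
  is_derive x 1 (flat P) (flat ('X^2 * (P - P^`())) x).
Proof.
have [x0|x0|->] := ltrgtP x 0.
- have -> : flat ('X^2 * (P - P^`())) x = 0 by rewrite /flat ltNge ltW.
  apply: (near_eq_is_derive _ (is_derive_cst 0 x 1)).
  near=> y; rewrite /flat ltNge ltW//.
  by near: y; exact: lt_nbhsl.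
- have iv : is_derive x 1 (fun y : R => y^-1) (- x ^- 2).
    have h := @is_deriveV R id x 1 1 (lt0r_neq0 x0) (is_derive_id x 1).
    by apply: (is_derive_eq h); rewrite /GRing.scale/= mulr1.
  have ip : is_derive x 1 (fun y => P.[y^-1]) (P^`().[x^-1] * (- x ^- 2)).
    have h : is_derive x^-1 1 (horner P) (P^`().[x^-1]).
      by rewrite derivE derive1E; apply: derivableP; exact: derivable_horner.
    exact: (@is_derive1_comp R (horner P) _ x _ _ h iv).
  have ie : is_derive x 1 (fun y => expR (- y^-1)) (expR (- x^-1) * x ^- 2).
    have h := @is_deriveN R R R _ x 1 _ iv.
    have := @is_derive1_comp R expR _ x _ _ (is_derive_expR (- x^-1)) h.
    by rewrite opprK.
  have E : \near x, ((fun y => P.[y^-1]) * (fun y => expR (- y^-1))) x = flat P x.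
    near=> y; rewrite /flat ifT//.
    by near: y; exact: lt_nbhsr.
  apply: (is_derive_eq (near_eq_is_derive E (@is_deriveM R R _ _ x 1 _ _ ip ie))).
  by rewrite /flat x0 !hornerE /GRing.scale/= -exprVn; ring.
- rewrite [X in is_derive _ _ _ X](_ : _ = 0); last by rewrite /flat ltxx.
  have [K K0 HK] := flat_le ('X * P).
  have H : (fun h : R => h^-1 *: (flat P (h *: 1 + 0) - flat P 0)) @ 0^' --> (0 : R).
    apply/cvgr0Pnorm_lt => e e0.
    near=> h; have h0 : h != 0 by near: h; exact: nbhs_dnbhs_neq.
    have -> : h^-1 *: (flat P (h *: 1 + 0) - flat P 0) = flat ('X * P) h.
      rewrite /flat ltxx subr0 addr0 /GRing.scale/= mulr1.
      by case: ifP => _; rewrite ?mulr0// hornerM hornerX mulrA.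
    have h1 : `|h| <= 1.
      near: h; apply: dnbhs0_le => //.
    apply: le_lt_trans (HK h h1) _.
    have : `|h| < e / (K + 1).
      by near: h; apply: dnbhs0_lt; rewrite divr_gt0// ltr_wpDl.
    rewrite ltr_pdivlMr ?ltr_wpDl// => /(le_lt_trans _); apply.
    by rewrite mulrC ler_wpM2l// lerDl.
  apply: DeriveDef; first by apply/cvg_ex; exists 0.
  exact/cvg_lim.
Unshelve. all: by end_near.
Qed.

Lemma smooth1_flat P : smooth1 (flat P).
Proof.
move=> n; elim: n P => // n IH P; split=> [x|].
  by have [] := is_derive_flat P x.
by rewrite (is_derive_derive1 (is_derive_flat P)).
Qed.

Definition flat1 : R -> R := flat 1.

Lemma flat1E x : flat1 x = if 0 < x then expR (- x^-1) else 0.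
Proof. by rewrite /flat1 /flat hornerC mul1r. Qed.

Lemma flat1_ge0 x : 0 <= flat1 x.
Proof. by rewrite flat1E; case: ifP => // _; exact: expR_ge0. Qed.

Lemma flat1_le1 x : flat1 x <= 1.
Proof.
rewrite flat1E; case: ifP => // x0.
by rewrite -expR0 ler_expR oppr_le0 invr_ge0 ltW.
Qed.

Lemma flat1_eq0 x : x <= 0 -> flat1 x = 0.
Proof. by move=> x0; rewrite flat1E ltNge x0. Qed.

Lemma smooth1_mul f g : smooth1 f -> smooth1 g -> smooth1 (fun x => f x * g x).
Proof. by move=> sf sg n; exact: differentiable_upto_mul. Qed.

Lemma smooth1_add f g : smooth1 f -> smooth1 g -> smooth1 (fun x => f x + g x).
Proof. by move=> sf sg n; exact: differentiable_upto_add. Qed.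

Lemma smooth1_scale c f : smooth1 f -> smooth1 (fun x => c * f x).
Proof. by move=> sf; apply: smooth1_mul => // n; exact: differentiable_upto_cst. Qed.

Lemma smooth1_affine a b f : smooth1 f -> smooth1 (fun x => f (a * x + b)).
Proof. by move=> sf n; exact: differentiable_upto_affine. Qed.

(** The one variable factors of the product test functions. *)
Definition test1 f : Prop := smooth1 f /\
  exists2 ab : R * R, 0 < ab.1 /\ ab.2 < 1 & forall x, ~~ (ab.1 <= x <= ab.2) -> f x = 0.

Lemma test1_continuous f : test1 f -> continuous f.
Proof. by move=> [sf _]; exact: smooth1_continuous. Qed.

Lemma test1_eq0 f x : test1 f -> ~~ (0 < x < 1) -> f x = 0.
Proof.
move=> [_ [[a b]/= [a0 b1] fab]] x01; apply: fab; apply: contra x01 => /andP[ax xb].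
by rewrite (lt_le_trans a0 ax) (le_lt_trans xb b1).
Qed.

Lemma test1_lincomb c f g : test1 f -> test1 g -> test1 (fun x => f x + c * g x).
Proof.
move=> [sf [[a b]/= [a0 b1] fab]] [sg [[a' b']/= [a'0 b'1] gab]]; split.
  by apply: smooth1_add => //; exact: smooth1_scale.
exists (Num.min a a', Num.max b b') => /=; first by rewrite lt_min gt_max a0 a'0 b1.
move=> x H; rewrite fab ?gab ?mulr0 ?addr0//; apply: contra H => /andP[h1 h2].
  by rewrite ge_min le_max h1 h2 !orbT.
by rewrite ge_min le_max h1 h2.
Qed.

Lemma test1_bounded f : test1 f -> exists M : R, forall x, `|f x| <= M.
Proof.
move=> tf; have cf : {within `[0, 1], continuous (fun x => `|f x|)}.
  apply: continuous_subspaceT => x; apply: cvg_norm; exact: test1_continuous.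
have [c _ H] := EVT_max (@ler01 R) cf.
exists `|f c| => x; have [x01|x01] := boolP (0 < x < 1).
  by apply: H; rewrite in_itv/=; case/andP: x01 => /ltW -> /ltW ->.
by rewrite (test1_eq0 tf x01) normr0.
Qed.

Lemma test1_measurable f : test1 f -> measurable_fun setT (f : measurableTypeR R -> R).
Proof. by move=> tf; apply: continuous_measurable_fun; exact: test1_continuous. Qed.

(** Smooth approximations of the indicator of [(0, b)] from inside, vanishing
    up to distance [1 / (n + 1)] of the boundary. *)
Definition mollified_indicator (b : R) (n : nat) (x : R) : R :=
  flat1 (n.+1%:R * x - 1) * flat1 (n.+1%:R * (b - x) - 1).

Lemma test1_mollified b n : b <= 1 -> test1 (mollified_indicator b n).
Proof.
move=> b1; split.
  apply: smooth1_mul; first exact: (smooth1_affine _ (- 1) (smooth1_flat 1)).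
  have := smooth1_affine (- n.+1%:R) (n.+1%:R * b - 1) (smooth1_flat 1).
  by congr smooth1; apply/funext => x; congr flat; ring.
have n0 : 0 < (n.+1%:R : R) by [].
exists (n.+1%:R^-1, b - n.+1%:R^-1) => /=.
  by split; [rewrite invr_gt0|rewrite (lt_le_trans _ b1)// gtrBl invr_gt0].
move=> x; rewrite negb_and -!ltNge => /orP[xn|xn]; rewrite /mollified_indicator.
  rewrite flat1_eq0 ?mul0r// subr_le0 -ler_pdivlMl// mulr1 ltW//.
rewrite (@flat1_eq0 (_ * (b - x) - 1)) ?mulr0// subr_le0 -ler_pdivlMl// mulr1.
by rewrite lerBlDr -lerBlDl ltW.
Qed.

Lemma mollified_norm b n x : `|mollified_indicator b n x| <= 1.
Proof.
rewrite ger0_norm ?mulr_ge0 ?flat1_ge0//.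
by rewrite mulr_ile1 ?flat1_ge0 ?flat1_le1.
Qed.

Lemma cvg_flat1_affine (c : R) : 0 < c ->
  (fun n => flat1 (n.+1%:R * c - 1)) @ \oo --> (1 : R).
Proof.
move=> c0; apply/cvgrPdist_le => e e0.
have ec0 : 0 < Num.min (c / 2) (e * c / 2) by rewrite lt_min !divr_gt0// mulr_gt0.
have [N _ HN] := near_infty_natSinv_lt (PosNum ec0).
exists N => // n /= /HN /=; rewrite lt_min => /andP[n1 n2].
have n0 : 0 < (n.+1%:R : R) by [].
have nc : 2 < n.+1%:R * c.
  by rewrite -ltr_pdivrMl//; move: n1; set v := n.+1%:R^-1; lra.
have nec : 2 < n.+1%:R * (e * c).
  by rewrite -ltr_pdivrMl//; move: n2; set v := n.+1%:R^-1; lra.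
have y0 : 0 < n.+1%:R * c - 1 by lra.
rewrite ger0_norm ?subr_ge0 ?flat1_le1// flat1E y0.
set y := _ - 1 in y0 *; have := expR_ge1Dx (- y^-1).
have : y^-1 <= e; last by lra.
rewrite -div1r ler_pdivrMr// /y; nra.
Qed.

Lemma cvg_mollified b x :
  (mollified_indicator b ^~ x) @ \oo --> (((0 < x < b)%R : bool)%:R : R).
Proof.
have [/andP[x0 xb]|] := boolP (0 < x < b).
  rewrite -[X in _ --> X]mulr1; apply: cvgM; apply: cvg_flat1_affine => //.
  by rewrite subr_gt0.
move=> xb; apply: cvg_near_cst; apply: nearW => n; rewrite /mollified_indicator.
move: xb; rewrite negb_and -!leNgt => /orP[x0|bx].
  rewrite flat1_eq0 ?mul0r//; have : n.+1%:R * x <= 0 by rewrite mulr_ge0_le0.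
  lra.
rewrite (@flat1_eq0 (_ * (b - x) - 1)) ?mulr0//.
have : n.+1%:R * (b - x) <= 0 by rewrite mulr_ge0_le0// subr_le0.
lra.
Qed.

Local Notation U := (unit_interval_measure R).
Local Notation leb := (@lebesgue_measure R).

Lemma unit_interval_interior : U `]0, 1[%classic = 1%E.
Proof.
rewrite /unit_interval_measure /mrestr setIidl; last first.
  by move=> x /=; rewrite !in_itv/= => /andP[/ltW -> /ltW ->].
by rewrite lebesgue_measure_itv/= lte_fin ltr01 -EFinB subr0.
Qed.

Lemma test1_integrable f : test1 f -> integrableR U f.
Proof.
move=> tf; have [M fM] := test1_bounded tf.
exact: (integrableR_bounded _ (test1_measurable tf) fM).
Qed.

(** The mollified indicators of [(0, 1)] have integrals tending to 1; one of
    them is normalized. *)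
Lemma test1_weight : exists rho : R -> R, [/\ test1 rho, forall x, 0 <= rho x &
  \int[U]_x rho x = 1].
Proof.
have H : (fun n => \int[U]_x mollified_indicator 1 n x) @ \oo -->
    \int[U]_x \1_(`]0, 1[%classic) x.
  apply: (@Rdominated_cvg _ _ _ U _ _ (cst 1)).
  - by move=> n; apply: test1_measurable; exact: test1_mollified.
  - exact: measurable_indic.
  - exact: integrableR_cst.
  - by move=> n x; exact: mollified_norm.
  - by move=> x; rewrite indicE mem_setE in_itv/=; exact: cvg_mollified.
have E : \int[U]_x (\1_(`]0, 1[%classic) x : R) = 1.
  by rewrite /Rintegral integral_indic// setIT; exact: (congr1 fine unit_interval_interior).
rewrite E in H; move/cvgrPdist_lt : H => /(_ _ ltr01)[n _ /(_ n (leqnn n))] /=.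
set I := \int[U]_x _ => I1.
have I0 : 0 < I by move: I1; rewrite ltr_norml => /andP[_]; lra.
have tm := test1_mollified n (lexx (1 : R)).
exists (fun x => I^-1 * mollified_indicator 1 n x); split.
- have := test1_lincomb (I^-1 - 1) tm tm; congr test1.
  by apply/funext => x; ring.
- by move=> x; rewrite mulr_ge0 ?invr_ge0 ?(ltW I0)// mulr_ge0 ?flat1_ge0.
- by rewrite RintegralZl//; [rewrite mulVf// gt_eqF|exact: test1_integrable].
Qed.

Section Primitive.
Variable g : R -> R.
Hypotheses (tg : test1 g) (g0 : \int[U]_x g x = 0).

Let G u : R := \int[leb]_(x in `[0, u]) g x.

Let int_g (a b : R) : leb.-integrable `[a, b] (EFin \o g).
Proof.
apply: continuous_compact_integrable; first exact: segment_compact.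
by apply: continuous_subspaceT; exact: test1_continuous.
Qed.

(** The total integral of [g] is zero, so that integrating from the right or
    from the left gives opposite values. *)
Lemma primitive_tail u : \int[U]_x ((u < x)%R%:R * g x) = - G u.
Proof.
have [M gM] := test1_bounded tg.
have m1 : measurable_fun setT (fun x : measurableTypeR R => (u < x)%R%:R * g x).
  apply: measurable_funM; last exact: test1_measurable.
  have -> : (fun x : R => (u < x)%R%:R) = \1_(`]u, +oo[%classic) :> (R -> R).
    by apply/funext => x; rewrite indicE mem_setE in_itv/= andbT.
  exact: measurable_indic.
rewrite Rintegral_unit_interval; last first.
  apply: (integrableR_bounded (M := M) _ m1) => x.
  by case: (u < x); rewrite ?mul1r ?mul0r// normr0 (le_trans (normr_ge0 (g 0)) (gM 0)).
have G1 : G 1 = 0 by rewrite -g0 Rintegral_unit_interval//; exact: test1_integrable.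
have [u0|u0] := ltP u 0.
  have -> : G u = 0.
    apply: Rintegral_eq0 => x /=; rewrite in_itv/= => /andP[x0 xu]; lra.
  rewrite oppr0; apply: etrans _ G1; apply: eq_Rintegral => x; rewrite inE/= in_itv/= => /andP[x0 _].
  by rewrite (lt_le_trans u0 x0) mul1r.
have [u1|u1] := leP u 1.
  have -> : \int[leb]_(x in `[0, 1]) ((u < x)%R%:R * g x) =
      \int[leb]_(x in `]u, 1]) g x.
    rewrite [RHS]Rintegral_mkcond [LHS]Rintegral_mkcond.
    apply: eq_Rintegral => x _; rewrite !patchE !mem_setE !in_itv/=.
    have [ux|xu] := ltP u x; last by rewrite mul0r if_same.
    by rewrite mul1r (le_trans u0 (ltW ux)).
  have := @Rintegral_itvB R g (BLeft 0) (BRight 1) u (int_g 0 1).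
  by rewrite -/(G 1) -/(G u) G1 sub0r !bnd_simp => ->.
have -> : G u = 0.
  apply: etrans _ G1; rewrite /G; apply/eqP; rewrite -subr_eq0; apply/eqP.
  rewrite Rintegral_itvB//= ?bnd_simp ?ltW//.
  apply: Rintegral_eq0 => x /=; rewrite in_itv/= => /andP[x1 _].
  apply: (test1_eq0 tg).
  by rewrite negb_and -!leNgt (ltW x1) orbT.
rewrite oppr0; apply: Rintegral_eq0 => x /=; rewrite in_itv/= => /andP[_ x1].
by rewrite ltNge (le_trans x1 (ltW u1)) mul0r.
Qed.

(** The primitive from the left vanishes beyond the support of [g] because the
    total integral of [g] is zero. *)
Lemma test1_primitive : test1 G /\ (G^`())%classic = g.
Proof.
have [sg [[a b]/= [a0 b1] gab]] := tg.
have Ga u : u < a -> G u = 0.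
  move=> ua; apply: Rintegral_eq0 => x /=; rewrite in_itv/= => /andP[_ xu].
  apply: gab.
  by rewrite negb_and -!ltNge (le_lt_trans xu ua).
have Gb u : b < u -> G u = 0.
  move=> bu; apply/eqP; rewrite -oppr_eq0 -primitive_tail; apply/eqP.
  apply: Rintegral_eq0 => x _; have [ux|_] := ltP u x; last by rewrite mul0r.
  by rewrite gab ?mulr0// negb_and -!ltNge (lt_trans bu ux) orbT.
have dG (u : R) : is_derive u 1 G (g u).
  have [ua|au] := ltP u a.
    rewrite gab; last by rewrite negb_and -!ltNge ua.
    apply: (near_eq_is_derive _ (is_derive_cst 0 u 1)).
    near=> y; rewrite Ga//.
    by near: y; exact: lt_nbhsl.
  have u0 : 0 < u by exact: lt_le_trans a0 au.
  have cu : {for u, continuous g} by exact: test1_continuous.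
  have H := @continuous_FTC1 R g (BLeft 0) u (u + 1) (ltr_pwDr ltr01 (lexx u))
    (int_g 0 (u + 1)).
  have [|dGu Gu] := H _ cu; first by rewrite /= lte_fin.
  by rewrite -Gu derive1E; exact: derivableP.
split; last exact: is_derive_derive1.
split.
  case=> // n; split=> [x|]; first by have [] := dG x.
  by rewrite (is_derive_derive1 dG); exact: sg.
exists (a, b) => //= x; rewrite negb_and -!ltNge => /orP[/Ga|/Gb]//.
Unshelve. all: by end_near. Qed.

End Primitive.

End SmoothFunctions.

(** * Test functions on the cube and integration by parts along a coordinate *)

Section CubeTestFunctions.
Variables (R : realType) (p : nat).
Local Notation X := (measurableTypeR R).
Local Notation V := 'rV[R]_p.
Local Notation C := (cube_measure R p).
Local Notation U := (unit_interval_measure R).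

Lemma row_of_tupleE (t : p.-tuple X) v : row_of_tuple t 0 v = tnth t v.
Proof. by rewrite mxE. Qed.

(** The Borel structure lives on tuples and the topology on row vectors: the
    open set where [phi > a] is the union of the countably many rational cubes
    that it contains. *)
Lemma measurable_continuous_row (phi : V -> R) : continuous phi ->
  measurable_fun setT (phi \o @row_of_tuple R p).
Proof.
move=> cphi; apply: (measurability _ (RGenOInfty.measurableE R)) => _ [_ [a ->] <-].
rewrite setTI.
pose good (qm : {ffun 'I_p -> rat} * nat) := forall t : p.-tuple X,
  (forall v, `|tnth t v - ratr (qm.1 v)| < qm.2.+1%:R^-1) -> a < phi (row_of_tuple t).
pose A (qm : {ffun 'I_p -> rat} * nat) : set (p.-tuple X) :=
  [set t | good qm /\ forall v, `|tnth t v - ratr (qm.1 v)| < qm.2.+1%:R^-1].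
have -> : (phi \o @row_of_tuple R p) @^-1` `]a, +oo[%classic = \bigcup_qm A qm.
  apply/seteqP; split=> t /=; last first.
    by move=> [qm _ [g tq]]; rewrite in_itv/= andbT; exact: g.
  rewrite in_itv/= andbT => at_.
  have [e /= e0 He] : exists2 e : R, 0 < e & forall y : V,
      (forall v, `|tnth t v - y 0 v| < e) -> a < phi y.
    have : nbhs (phi (row_of_tuple t)) `]a, +oo[%classic.
      by apply: open_nbhs_nbhs; split; [exact: interval_open|rewrite /= in_itv/= andbT].
    move=> /(cphi (row_of_tuple t))/nbhs_ballP[e /= e0 He]; exists e => // y ty.
    have /= : ball (row_of_tuple t) e y.
      by split=> // i v; rewrite (ord1 i) row_of_tupleE; exact: ty.
    by move=> /He; rewrite /= in_itv/= andbT.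
  have e20 : 0 < e / 2 by rewrite divr_gt0.
  have [m _ /(_ m (leqnn m)) /= me] := near_infty_natSinv_lt (PosNum e20).
  have m0 : 0 < (m.+1%:R^-1 : R) by rewrite invr_gt0.
  have Hq v : exists q : rat, `|tnth t v - ratr q| < m.+1%:R^-1.
    have [|q] := @rat_in_itvoo R (tnth t v - m.+1%:R^-1) (tnth t v + m.+1%:R^-1).
      by rewrite ltrBlDr -addrA ltrDl addr_gt0.
    by rewrite in_itv/= => Hq; exists q; rewrite distrC ltr_distl.
  pose q := [ffun v => projT1 (cid (Hq v))].
  have qP v : `|tnth t v - ratr (q v)| < m.+1%:R^-1.
    by rewrite ffunE; exact: (projT2 (cid (Hq v))).
  exists (q, m) => //; split=> // t' /= t'q; apply: He => v; rewrite row_of_tupleE.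
  rewrite -(subrKA (ratr (q v))) (le_lt_trans (ler_normD _ _))//.
  rewrite [X in _ < X](splitr e) ltrD// ?(lt_trans (qP v))// distrC (lt_trans (t'q v))//.
apply: countable_bigcupT_measurable => // qm.
have [g|g] := pselect (good qm); last first.
  have -> : A qm = set0 by apply/seteqP; split=> // t [].
  exact: measurable0.
have -> : A qm = \bigcap_(v in [set: 'I_p])
    ((fun t : p.-tuple X => tnth t v) @^-1` ball (ratr (qm.1 v) : R) qm.2.+1%:R^-1).
  apply/seteqP; split=> t /=.
    by move=> [_ H] v _; rewrite /ball/= distrC; exact: H.
  by move=> H; split=> // v; have := H v I; rewrite /ball/= distrC.
apply: fin_bigcap_measurable => // v _.
have := @measurable_coord R p v; rewrite -[X in measurable X]setTI; apply => //.
exact: measurable_ball.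
Qed.

Lemma line_coord (x : V) v w (h : R) :
  (h *: delta_mx 0 v + x) 0 w = if w == v then h + x 0 w else x 0 w.
Proof.
rewrite !mxE eqxx /=; case: eqP => _; first by rewrite mulr1.
by rewrite mulr0 add0r.
Qed.

Section ProductTests.

Definition prod_fun (theta : 'I_p -> R -> R) : V -> R :=
  fun x => \prod_v theta v (x 0 v).

Lemma prod_fun_row theta (t : p.-tuple X) :
  prod_fun theta (row_of_tuple t) = \prod_v theta v (tnth t v).
Proof. by apply: eq_bigr => v _; rewrite row_of_tupleE. Qed.

Lemma is_derive_prod_fun theta v (x : V) : (forall w, smooth1 (theta w)) ->
  is_derive x (delta_mx 0 v) (prod_fun theta)
    (prod_fun (fun w => if w == v then ((theta w)^`())%classic else theta w) x).
Proof.
move=> st; pose r := \prod_(w | w != v) theta w (x 0 w).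
have -> : prod_fun (fun w => if w == v then ((theta w)^`())%classic else theta w) x =
    ((theta v)^`())%classic (x 0 v) * r.
  rewrite /prod_fun (bigD1 v)//= eqxx; congr (_ * _).
  by apply: eq_bigr => w /negbTE ->.
have [dv Dv] := smooth1_is_derive (x 0 v) (st v).
have H : (fun h : R => h^-1 *: ((prod_fun theta \o shift x) (h *: delta_mx 0 v) -
    prod_fun theta x)) @ 0^' --> ((theta v)^`())%classic (x 0 v) * r.
  have -> : (fun h : R => h^-1 *: ((prod_fun theta \o shift x) (h *: delta_mx 0 v) -
      prod_fun theta x)) =
      (fun h : R => h^-1 *: ((theta v \o shift (x 0 v)) (h *: 1) - theta v (x 0 v)) * r).
    apply/funext => h; rewrite /GRing.scale/= -mulrA; congr (_ * _).
    rewrite mulrBl /prod_fun [in LHS](bigD1 v)//= [X in _ - X](bigD1 v)//=.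
    rewrite line_coord eqxx mulr1; congr (_ * _ - _).
    by apply: eq_bigr => w /negbTE wv; rewrite line_coord wv.
  apply: cvgM; last exact: cvg_cst.
  by rewrite -Dv; exact: dv.
apply: DeriveDef; first by apply/cvg_ex; eexists; exact: H.
exact/cvg_lim.
Qed.

(** The factor [v] has been differentiated as many times as [v] occurs in [s]. *)
Definition iter_theta (s : seq 'I_p) (theta : 'I_p -> R -> R) : 'I_p -> R -> R :=
  fun v => iter (count_mem v s) (fun f => (f^`())%classic) (theta v).

Lemma smooth1_iter (f : R -> R) n : smooth1 f ->
  smooth1 (iter n (fun f : R -> R => (f^`())%classic) f).
Proof. by move=> sf; elim: n => // n IH; exact: smooth1_derive. Qed.

Lemma iter_partial_prod_fun s theta : (forall w, smooth1 (theta w)) ->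
  iter_partial s (prod_fun theta) = prod_fun (iter_theta s theta).
Proof.
move=> st; elim: s => [//|v s IH] /=.
rewrite IH; apply/funext => x; rewrite /partial.
have si w : smooth1 (iter_theta s theta w) by exact: smooth1_iter.
have [_ ->] := is_derive_prod_fun v x si.
apply: eq_bigr => w _; rewrite /iter_theta /= [v == w]eq_sym.
by case: eqP.
Qed.

Lemma continuous_prod_fun theta : (forall w, continuous (theta w)) ->
  continuous (prod_fun theta).
Proof.
move=> ct; rewrite /prod_fun; elim: (index_enum 'I_p) => [|w r IH].
  rewrite (_ : (fun x => _) = cst 1); first exact: cst_continuous.
  by apply/funext => x; rewrite big_nil.
rewrite (_ : (fun x => _) =
  (fun x : V => theta w (x 0 w) * \prod_(v <- r) theta v (x 0 v))); last first.
  by apply/funext => x; rewrite big_cons.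
move=> x; apply: continuousM; last exact: IH.
apply: (@continuous_comp _ _ _ (fun y : V => y 0 w) (theta w)).
  exact: coord_continuous.
exact: ct.
Qed.

Lemma smooth_prod_fun theta : (forall w, smooth1 (theta w)) ->
  smooth (prod_fun theta).
Proof.
move=> st s; rewrite iter_partial_prod_fun//.
have si w : smooth1 (iter_theta s theta w) by exact: smooth1_iter.
split=> [|x v].
  by apply: continuous_prod_fun => w; exact: smooth1_continuous.
by have [] := is_derive_prod_fun v x si.
Qed.

Lemma test_function_prod_fun theta : (forall w, test1 (theta w)) ->
  test_function (prod_fun theta).
Proof.
move=> tt; split; first by apply: smooth_prod_fun => w; case: (tt w).
have Hab w : exists ab : R * R, (0 < ab.1 /\ ab.2 < 1) /\
    forall x, ~~ (ab.1 <= x <= ab.2) -> theta w x = 0.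
  by have [_ [ab]] := tt w; exists ab.
pose ab w := projT1 (cid (Hab w)).
have abP w := projT2 (cid (Hab w)).
exists [set x | forall w, `[(ab w).1, (ab w).2]%classic (x 0 w)]; split.
- apply: (@rV_compact _ _ (fun w => `[(ab w).1, (ab w).2]%classic)) => w.
  exact: segment_compact.
- move=> x /= Hx w; have [[a0 b1] _] := abP w.
  have := Hx w; rewrite in_itv/= => /andP[ax xb].
  by rewrite (lt_le_trans a0 ax) (le_lt_trans xb b1).
- move=> x /existsNP[w Hw]; rewrite /prod_fun (bigD1 w)//= (abP w).2 ?mul0r//.
  by apply/negP => H; apply: Hw; rewrite /= in_itv.
Qed.

Lemma iter_partial_enum_prod_fun (a : {set 'I_p}) theta : (forall w, smooth1 (theta w)) ->
  iter_partial (enum a) (prod_fun theta) =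
  prod_fun (fun w => if w \in a then ((theta w)^`())%classic else theta w).
Proof.
move=> st; rewrite iter_partial_prod_fun//; congr prod_fun; apply/funext => w.
rewrite /iter_theta count_uniq_mem ?enum_uniq// mem_enum.
by case: (w \in a).
Qed.

End ProductTests.

Section GeneralTests.
Variable phi : V -> R.
Hypothesis tphi : test_function phi.

Lemma test_iter_continuous s : continuous (iter_partial s phi).
Proof. by have [sp _] := tphi; case: (sp s). Qed.

Lemma test_iter_derivable s x v : derivable (iter_partial s phi) x (delta_mx 0 v).
Proof. by have [sp _] := tphi; case: (sp s). Qed.

(** Derivatives vanish off the support since its complement is open. *)
Lemma test_iter_support : exists K : set V, [/\ compact K, K `<=` @open_cube R p &
  forall s x, ~ K x -> iter_partial s phi x = 0].
Proof.
have [sp [K [cK K01 K0]]] := tphi; exists K; split=> // s.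
elim: s => [x /K0//|v s IH x Kx] /=.
have : \forall y \near x, iter_partial s phi y = cst 0 y.
  have : nbhs x (~` K).
    apply: open_nbhs_nbhs; split=> //; rewrite openC.
    by apply: compact_closed => //; exact: norm_hausdorff.
  by apply: filterS => y; exact: IH.
by rewrite /partial => /near_eq_derive ->; exact: derive_cst.
Qed.

Lemma test_iter_eq0 s x : ~ open_cube x -> iter_partial s phi x = 0.
Proof.
have [K [_ K01 K0]] := test_iter_support => ox; apply: K0 => /K01.
exact: ox.
Qed.

Lemma test_iter_bounded s : exists M : R, forall x, `|iter_partial s phi x| <= M.
Proof.
have [K [cK K01 K0]] := test_iter_support.
have [K_0|/set0P Kn] := eqVneq K set0.
  by exists 0 => x; rewrite K0 ?normr0// K_0.
have cf : {within K, continuous (fun x => `|iter_partial s phi x|)}.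
  apply: continuous_subspaceT => x.
  apply: (@continuous_comp _ _ _ (iter_partial s phi) (fun r : R => `|r|)).
    exact: test_iter_continuous.
  exact: norm_continuous.
have [c _ H] := EVT_max_rV Kn cK cf.
exists `|iter_partial s phi c| => x; have [Kx|Kx] := pselect (K x).
  by apply: H; rewrite inE.
by rewrite K0// normr0.
Qed.

Lemma measurable_test_iter s :
  measurable_fun setT (fun t : p.-tuple X => iter_partial s phi (row_of_tuple t)).
Proof. by apply: measurable_continuous_row; exact: test_iter_continuous. Qed.

End GeneralTests.

(** Integration by parts is required against all C^1 functions vanishing off
    the open interval, because the slices of a multivariate test function
    along one coordinate are such functions. *)
Definition weak_derivative1 (k k' : R -> R) : Prop :=
  forall psi psi' : R -> R, (forall x : R, is_derive x 1 psi (psi' x)) ->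
  continuous psi' -> (forall x, ~~ (0 < x < 1) -> psi x = 0) ->
  \int[U]_x (k x * psi' x) = - \int[U]_x (k' x * psi x).

Definition replace_coord (x : V) (v : 'I_p) (s : R) : V :=
  \row_w (if w == v then s else x 0 w).

Lemma row_of_resample v (t : p.-tuple X) s :
  row_of_tuple (resample v (t, s)) = replace_coord (row_of_tuple t) v s.
Proof.
by apply/rowP => w; rewrite row_of_tupleE tnth_resample mxE row_of_tupleE.
Qed.

Lemma replace_coord_line x v (s h : R) :
  replace_coord x v (h *: 1 + s) = h *: delta_mx 0 v + replace_coord x v s.
Proof.
apply/rowP => w; rewrite line_coord !mxE /GRing.scale/= mulr1.
by case: eqP.
Qed.

Lemma is_derive_replace_coord (psi : V -> R) x v (s : R) :
  derivable psi (replace_coord x v s) (delta_mx 0 v) ->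
  is_derive s 1 (fun s => psi (replace_coord x v s)) (partial v psi (replace_coord x v s)).
Proof.
move=> dpsi.
have E : (fun h : R => h^-1 *: (((fun s => psi (replace_coord x v s)) \o shift s) (h *: 1) -
    psi (replace_coord x v s))) =
  (fun h : R => h^-1 *: ((psi \o shift (replace_coord x v s)) (h *: delta_mx 0 v) -
    psi (replace_coord x v s))).
  by apply/funext => h; rewrite /= replace_coord_line.
have H : (fun h : R => h^-1 *: (((fun s => psi (replace_coord x v s)) \o shift s) (h *: 1) -
    psi (replace_coord x v s))) @ 0^' --> partial v psi (replace_coord x v s).
  by rewrite E; exact: dpsi.
apply: DeriveDef; first by apply/cvg_ex; eexists; exact: H.
exact/cvg_lim.
Qed.

Lemma continuous_replace_coord x v : continuous (replace_coord x v).
Proof.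
move=> s; apply/cvg_ballP => e e0.
have : nbhs s (ball s e) by exact: nbhsx_ballx.
apply: filterS => s' ss'; split=> // i w.
by rewrite !mxE; case: eqP => _ //; exact: ballxx.
Qed.

(** By [Rintegral_resample] the coordinate [v] can be integrated first; the
    factor [c], which is constant along it, comes out, and the one variable
    integration by parts applies. *)
Lemma weak_partial_coord (k k' : R -> R) (v : 'I_p) (c : p.-tuple X -> R) (M N : R)
    (psi : V -> R) :
  weak_derivative1 k k' ->
  measurable_fun setT (k : X -> R) -> measurable_fun setT (k' : X -> R) ->
  (forall x, `|k x| <= M) -> (forall x, `|k' x| <= M) ->
  measurable_fun setT c -> (forall t, `|c t| <= N) ->
  (forall t s, c (resample v (t, s)) = c t) ->
  (forall x, derivable psi x (delta_mx 0 v)) -> continuous psi ->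
  continuous (partial v psi) ->
  (forall x, ~ open_cube x -> psi x = 0) ->
  (exists B : R, forall x, `|psi x| <= B) ->
  (exists B : R, forall x, `|partial v psi x| <= B) ->
  \int[C]_t (k (tnth t v) * c t * partial v psi (row_of_tuple t)) =
  - \int[C]_t (k' (tnth t v) * c t * psi (row_of_tuple t)).
Proof.
move=> kk mk mk' kM k'M mc cN cv dpsi cpsi cdpsi psi0 [B1 HB1] [B2 HB2].
have mkt : measurable_fun setT (fun t : p.-tuple X => k (tnth t v)).
  by apply: (measurableT_comp (f := k : X -> R)) => //; exact: measurable_coord.
have mk't : measurable_fun setT (fun t : p.-tuple X => k' (tnth t v)).
  by apply: (measurableT_comp (f := k' : X -> R)) => //; exact: measurable_coord.
have m1 : measurable_fun setT
    (fun t => k (tnth t v) * c t * partial v psi (row_of_tuple t)).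
  apply: measurable_funM; first exact: measurable_funM.
  exact: measurable_continuous_row.
have m2 : measurable_fun setT (fun t => k' (tnth t v) * c t * psi (row_of_tuple t)).
  apply: measurable_funM; first exact: measurable_funM.
  exact: measurable_continuous_row.
have bnd3 (a b d A B D : R) : `|a| <= A -> `|b| <= B -> `|d| <= D -> `|a * b * d| <= A * B * D.
  by move=> aA bB dD; rewrite !normrM !ler_pM// mulr_ge0.
rewrite (Rintegral_resample v (M := M * N * B2) m1); last by move=> t; exact: bnd3.
rewrite (Rintegral_resample v (M := M * N * B1) m2); last by move=> t; exact: bnd3.
have mrep t (f : V -> R) : continuous f ->
    measurable_fun setT ((fun s : X => f (replace_coord (row_of_tuple t) v s))).
  move=> cf; apply: continuous_measurable_fun => s.
  by apply: continuous_comp; [exact: continuous_replace_coord|exact: cf].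
rewrite -mulN1r -RintegralZl//; last first.
  have m3 : measurable_fun setT
      ((fun t : p.-tuple X => k' (tnth t v) * c t * psi (row_of_tuple t)) \o resample v).
    by apply: measurableT_comp => //; exact: measurable_resample.
  have i3 : (C \x U)%E.-integrable setT (EFin \o
      ((fun t : p.-tuple X => k' (tnth t v) * c t * psi (row_of_tuple t)) \o resample v)).
    by apply: (@integrableR_bounded _ _ _ _ _ (M * N * B1)) => // z; exact: bnd3.
  exact: (Rintegral_prod1 i3).1.
apply: eq_Rintegral => t _; rewrite mulN1r.
pose f s := psi (replace_coord (row_of_tuple t) v s).
pose f' s := partial v psi (replace_coord (row_of_tuple t) v s).
have mf : measurable_fun setT (f : X -> R) by exact: mrep.
have mf' : measurable_fun setT (f' : X -> R) by exact: mrep.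
have E1 : \int[U]_s (k (tnth (resample v (t, s)) v) * c (resample v (t, s)) *
    partial v psi (row_of_tuple (resample v (t, s)))) = \int[U]_s (k s * f' s) * c t.
  rewrite -RintegralZr//; last first.
    apply: (@integrableR_bounded _ _ _ _ _ (M * B2)) => [|s].
      exact: measurable_funM.
    by rewrite normrM ler_pM// HB2.
  by apply: eq_Rintegral => s _; rewrite tnth_resample eqxx cv row_of_resample mulrAC.
have E2 : \int[U]_s (k' (tnth (resample v (t, s)) v) * c (resample v (t, s)) *
    psi (row_of_tuple (resample v (t, s)))) = \int[U]_s (k' s * f s) * c t.
  rewrite -RintegralZr//; last first.
    apply: (@integrableR_bounded _ _ _ _ _ (M * B1)) => [|s].
      exact: measurable_funM.
    by rewrite normrM ler_pM// HB1.
  by apply: eq_Rintegral => s _; rewrite tnth_resample eqxx cv row_of_resample mulrAC.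
have df (s : R) : is_derive s 1 f (f' s) by exact: is_derive_replace_coord.
have cf' : continuous f'.
  by move=> s; apply: continuous_comp; [exact: continuous_replace_coord|exact: cdpsi].
have f0 s : ~~ (0 < s < 1) -> f s = 0.
  by move=> s01; apply: psi0 => /(_ v); rewrite mxE eqxx; exact/negP.
by rewrite E1 E2 (kk f f' df cf' f0) mulNr.
Qed.

End CubeTestFunctions.

(** * The sections of 1 + min and their weak derivatives *)

Section OneVariable.
Variable R : realType.
Local Notation X := (measurableTypeR R).
Local Notation U := (unit_interval_measure R).
Local Notation leb := (@lebesgue_measure R).

(** Clamping makes the sections of [1 + min] continuous and bounded on the
    whole line without changing them on the unit interval. *)
Definition clamp (x : R) : R := Num.max 0 (Num.min 1 x).

Lemma clamp01 x : 0 <= clamp x <= 1.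
Proof. by rewrite /clamp le_max lexx ge_max ler01 ge_min lexx. Qed.

Lemma clamp_id x : 0 <= x <= 1 -> clamp x = x.
Proof. by move=> /andP[x0 x1]; rewrite /clamp min_r// max_r. Qed.

Lemma continuous_clamp : continuous clamp.
Proof.
move=> x; apply: continuous_max; first exact: cst_continuous.
by apply: continuous_min; [exact: cst_continuous|exact: cvg_id].
Qed.

Lemma ray_lt (y : R) : (fun r : R => (r < y)%R%:R : R) = \1_(`]-oo, y[%classic).
Proof. by apply/funext => r; rewrite indicE mem_setE in_itv. Qed.

Lemma measurable_lt_ray (y : R) : measurable_fun setT (fun r : X => (r < y)%R%:R : R).
Proof. by rewrite ray_lt; exact: measurable_indic. Qed.

Lemma measurable_gt_ray (y : R) : measurable_fun setT (fun r : X => (y < r)%R%:R : R).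
Proof.
have -> : (fun r : R => (y < r)%R%:R : R) = \1_(`]y, +oo[%classic).
  by apply/funext => r; rewrite indicE mem_setE in_itv/= andbT.
exact: measurable_indic.
Qed.

Lemma natr_bool_le1 (b : bool) : `|b%:R : R| <= 1.
Proof. by case: b; rewrite ?normr1 ?normr0. Qed.

Lemma Rintegral_ray (y : R) : \int[U]_r ((r < y)%R%:R : R) = clamp y.
Proof.
rewrite (_ : (fun r : R => (r < y)%R%:R : R) = \1_(`]-oo, y[%classic)); last exact: ray_lt.
rewrite /Rintegral integral_indic// setIT.
suff H : unit_interval_measure R `]-oo, y[%classic = (clamp y)%:E.
  exact: (congr1 fine H).
rewrite /unit_interval_measure /mrestr /clamp.
have [y0|y0] := leP y 0.
  rewrite (_ : _ `&` _ = set0).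
    by rewrite measure0 min_r ?(le_trans y0)// max_l.
  apply/seteqP; split=> // x []/=; rewrite !in_itv/= => xy /andP[x0 _].
  by have := lt_le_trans xy y0; rewrite ltNge x0.
have [y1|y1] := leP 1 y; last first.
  rewrite (_ : _ `&` _ = `[0, y[%classic).
    by rewrite lebesgue_measure_itv/= lte_fin y0 -EFinB subr0 max_r// ltW.
  apply/seteqP; split=> x /=; rewrite !in_itv/=; first by move=> [-> /andP[-> _]].
  by move=> /andP[-> xy]; rewrite xy; split=> //; rewrite ltW// (lt_trans xy).
rewrite max_r//; apply/eqP; rewrite eq_le; apply/andP; split.
  apply: (@le_trans _ _ (lebesgue_measure (`[0, 1]%classic : set R))).
    by apply: le_measure; rewrite ?inE//; exact: measurableI.
  by rewrite lebesgue_measure_itv/= lte_fin ltr01 -EFinB subr0.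
apply: (@le_trans _ _ (lebesgue_measure (`[0, 1[%classic : set R))).
  by rewrite lebesgue_measure_itv/= lte_fin ltr01 -EFinB subr0.
apply: le_measure; rewrite ?inE//; first exact: measurableI.
move=> x /=; rewrite !in_itv/= => /andP[-> x1]; split; last by rewrite ltW.
exact: lt_le_trans y1.
Qed.

Lemma Rintegral_ray2 (x y : R) : 0 <= x <= 1 ->
  \int[U]_r ((r < x)%R%:R * (r < y)%R%:R : R) = Num.min x (clamp y).
Proof.
move=> /andP[x0 x1]; transitivity (\int[U]_r ((r < Num.min x y)%R%:R : R)).
  by apply: eq_Rintegral => r _; rewrite lt_min; case: (r < x); rewrite ?mul1r ?mul0r.
rewrite Rintegral_ray /clamp.
by rewrite !minEle !maxEle; do !case: ifPn; rewrite -?ltNge; lra.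
Qed.

Lemma measurable_lt_pair d (T : measurableType d) (f g : T -> R) :
  measurable_fun setT f -> measurable_fun setT g ->
  measurable_fun setT (fun z => (f z < g z)%R%:R : R).
Proof.
move=> mf mg; have mA : measurable [set z | f z < g z].
  have := @measurable_fun_ltr _ _ _ setT f g mf mg measurableT [set true] (ltac:(by [])).
  by rewrite setTI; congr measurable; apply/seteqP; split=> z /=.
rewrite (_ : (fun z => _) = \1_[set z | f z < g z]); first exact: measurable_indic.
by apply/funext => z; rewrite indicE mem_setE.
Qed.

Section Tail.
Variables psi psi' : R -> R.
Hypotheses (dpsi : forall x : R, is_derive x 1 psi (psi' x)) (cpsi' : continuous psi').
Hypothesis psi0 : forall x, ~~ (0 < x < 1) -> psi x = 0.

Lemma derive_bounded : exists M : R, forall x, `|psi' x| <= M.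
Proof.
have cf : {within `[0, 1], continuous (fun x => `|psi' x|)}.
  apply: continuous_subspaceT => x; apply: cvg_norm; exact: cpsi'.
have [c _ H] := EVT_max (@ler01 R) cf.
exists `|psi' c| => x; have [x01|x01] := boolP (x \in `[0, 1]); first exact: H.
suff -> : psi' x = 0 by rewrite normr0.
have [_ <-] := dpsi x.
have E : \near x, psi x = cst 0 x.
  move: x01; rewrite in_itv/= negb_and -!ltNge => /orP[x0|x1].
    near=> y; apply: psi0; rewrite negb_and -!leNgt ltW//.
    by near: y; exact: lt_nbhsl.
  near=> y; apply: psi0; rewrite negb_and -!leNgt orbC ltW//.
  by near: y; exact: lt_nbhsr.
by rewrite (near_eq_derive _ E) derive_cst.
Unshelve. all: by end_near. Qed.

Lemma vanishing_bounded : exists M : R, forall x, `|psi x| <= M.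
Proof.
have cf : {within `[0, 1], continuous (fun x => `|psi x|)}.
  apply: continuous_subspaceT => x; apply: cvg_norm.
  by apply/differentiable_continuous/derivable1_diffP; have [] := dpsi x.
have [c _ H] := EVT_max (@ler01 R) cf.
exists `|psi c| => x; have [x01|x01] := boolP (0 < x < 1); last by rewrite psi0// normr0.
by apply: H; rewrite in_itv/=; case/andP: x01 => /ltW -> /ltW ->.
Qed.

Lemma derive_integral (a : R) : 0 <= a < 1 ->
  \int[leb]_(x in `[a, 1]) psi' x = - psi a.
Proof.
move=> /andP[a0 a1]; rewrite /Rintegral (@continuous_FTC2 _ psi' psi)//.
- by rewrite -EFinB /= (@psi0 1) ?ltxx ?andbF// sub0r.
- exact: continuous_subspaceT.
- have cpsi x : {for x, continuous psi}.
    by apply/differentiable_continuous/derivable1_diffP; have [] := dpsi x.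
  split.
  + by move=> x _; have [] := dpsi x.
  + exact: cvg_at_right_filter (cpsi a).
  + exact: cvg_at_left_filter (cpsi 1).
- by move=> x _; rewrite derive1E; have [_] := dpsi x.
Qed.

Lemma derive_tail (r : R) : \int[U]_s ((r < s)%R%:R * psi' s) = - psi r.
Proof.
have [M HM] := derive_bounded.
have m1 : measurable_fun setT (fun s : X => (r < s)%R%:R * psi' s).
  apply: measurable_funM; first exact: measurable_gt_ray.
  exact: continuous_measurable_fun.
rewrite Rintegral_unit_interval; last first.
  apply: (@integrableR_bounded _ _ _ _ _ M) => // s.
  by rewrite normrM -[leRHS]mul1r ler_pM// natr_bool_le1.
have [r0|r0] := ltP r 0.
  transitivity (\int[leb]_(s in `[0, 1]) psi' s).
    apply: eq_Rintegral => s; rewrite inE/= in_itv/= => /andP[s0 _].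
    by rewrite (lt_le_trans r0 s0) mul1r.
  rewrite derive_integral ?lexx ?ltr01// !psi0 ?ltxx//.
  by rewrite negb_and -leNgt ltW.
have [r1|r1] := ltP r 1; last first.
  rewrite psi0 ?negb_and -?leNgt ?r1 ?orbT// oppr0; apply: Rintegral_eq0 => s /=.
  rewrite in_itv/= => /andP[_ s1].
  by rewrite ltNge (le_trans s1 r1) mul0r.
rewrite -derive_integral ?r0//.
have ip a b : leb.-integrable `[a, b] (EFin \o psi').
  apply: continuous_compact_integrable; first exact: segment_compact.
  exact: continuous_subspaceT.
rewrite -Rintegral_itv_obnd_cbnd; last first.
  apply: integrableS (ip r 1) => //.
  by move=> s /=; rewrite !in_itv/= => /andP[/ltW -> ->].
rewrite [LHS]Rintegral_mkcond [RHS]Rintegral_mkcond.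
apply: eq_Rintegral => s _; rewrite !patchE !mem_setE !in_itv/=.
have [rs|sr] := ltP r s; last by rewrite mul0r if_same.
by rewrite mul1r (le_trans r0 (ltW rs)).
Qed.

End Tail.

(** The section at [y] of the kernel [1 + min]. *)
Definition kappa (y s : R) : R := 1 + Num.min y (clamp s).

(** The weak derivative of [kappa y]. *)
Definition kappa' (y s : R) : R := (s < y)%R%:R.

Lemma kappa_bounded y s : 0 <= y <= 1 -> `|kappa y s| <= 2.
Proof.
move=> /andP[y0 y1]; have /andP[s0 s1] := clamp01 s.
by rewrite /kappa minEle; case: ifP => _; rewrite ger0_norm; lra.
Qed.

Lemma continuous_kappa y : continuous (kappa y).
Proof.
move=> s; apply: cvgD; first exact: cvg_cst.
apply: continuous_min; first exact: cst_continuous.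
exact: continuous_clamp.
Qed.

Lemma measurable_kappa y : measurable_fun setT (kappa y : X -> R).
Proof. by apply: continuous_measurable_fun; exact: continuous_kappa. Qed.

(** Writing [min y x] as the integral over [r] of the indicators of [r < y]
    and [r < x], Fubini's theorem reduces the claim to [\int_r^1 psi' = - psi
    r]. *)
Lemma weak_derivative_kappa y : 0 <= y <= 1 -> weak_derivative1 (kappa y) (kappa' y).
Proof.
move=> y01 psi psi' dpsi cpsi' psi0.
have [M HM] := derive_bounded dpsi cpsi' psi0.
have mpsi' : measurable_fun setT (psi' : X -> R) by exact: continuous_measurable_fun.
pose F (z : X * X) : R := (z.2 < y)%R%:R * (z.2 < z.1)%R%:R * psi' z.1.
have m12 : measurable_fun setT (fun z : X * X => (z.2 < z.1)%R%:R : R).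
  by apply: measurable_lt_pair.
have mF : measurable_fun setT F.
  apply: measurable_funM; last exact: (measurableT_comp mpsi').
  apply: measurable_funM => //.
  exact: (measurableT_comp (measurable_lt_ray y)).
have FM z : `|F z| <= 1 * 1 * M.
  by rewrite !normrM !ler_pM ?natr_bool_le1// mulr_ge0.
have iF : (U \x U)%E.-integrable setT (EFin \o F).
  by apply: (@integrableR_bounded _ _ _ _ _ (1 * 1 * M)).
have i1 : integrableR U psi' by exact: (@integrableR_bounded _ _ _ _ _ M).
have E1 : \int[(U \x U)%E]_z F z = \int[U]_x (Num.min y (clamp x) * psi' x).
  rewrite (Rintegral_prod1 iF).2; apply: eq_Rintegral => x _.
  rewrite -Rintegral_ray2// -RintegralZr//.
  apply: (@integrableR_bounded _ _ _ _ _ (1 * 1)) => [|r].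
    by apply: measurable_funM; exact: measurable_lt_ray.
  by rewrite normrM ler_pM ?natr_bool_le1.
have E2 : \int[(U \x U)%E]_z F z = - \int[U]_r (kappa' y r * psi r).
  have [M' HM'] := vanishing_bounded dpsi psi0.
  rewrite (Rintegral_prod2 iF) -mulN1r -RintegralZl//; last first.
    apply: (@integrableR_bounded _ _ _ _ _ (1 * M')) => [|r].
      apply: measurable_funM; first exact: measurable_lt_ray.
      apply: continuous_measurable_fun => x.
      by apply/differentiable_continuous/derivable1_diffP; have [] := dpsi x.
    by rewrite normrM ler_pM// natr_bool_le1.
  apply: eq_Rintegral => r _.
  under eq_Rintegral do rewrite /F/= -mulrA.
  rewrite RintegralZl//; last first.
    apply: (@integrableR_bounded _ _ _ _ _ (1 * M)) => [|x].
      by apply: measurable_funM => //; exact: measurable_gt_ray.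
    by rewrite normrM ler_pM// natr_bool_le1.
  by rewrite (derive_tail dpsi cpsi' psi0) /kappa'; ring.
have E0 : \int[U]_x psi' x = 0.
  rewrite Rintegral_unit_interval// (derive_integral dpsi cpsi' psi0) ?lexx ?ltr01//.
  by rewrite psi0 ?oppr0// ltxx.
rewrite -E2 E1 /kappa.
under eq_Rintegral do rewrite mulrDl mul1r.
rewrite RintegralD// ?E0 ?add0r//.
apply: (@integrableR_bounded _ _ _ _ _ (1 * M)) => [|x].
  apply: measurable_funM => //; apply: continuous_measurable_fun => x.
  by apply: continuous_min; [exact: cst_continuous|exact: continuous_clamp].
have /andP[y0 y1] := y01; have /andP[x0 x1] := clamp01 x.
rewrite normrM ler_pM// ger0_norm; first by rewrite ge_min y1.
by rewrite le_min y0.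
Qed.

End OneVariable.

(** * Weak partial derivatives of products, and products as test functions *)

Section AlmostEverywhere.
Context d (T : measurableType d) (R : realType) (mu : probability T R).

Lemma ae_imply (P Q : T -> Prop) :
  {ae mu, forall x, P x} -> (forall x, P x -> Q x) -> {ae mu, forall x, Q x}.
Proof. by move=> aP PQ; apply: filterS aP. Qed.

Lemma ae_imply2 (P Q S : T -> Prop) :
  {ae mu, forall x, P x} -> {ae mu, forall x, Q x} ->
  (forall x, P x -> Q x -> S x) -> {ae mu, forall x, S x}.
Proof. by move=> aP aQ PQS; apply: filterS2 aP aQ. Qed.

Lemma ae_eq_Rintegral (f g : T -> R) :
  measurable_fun setT f -> measurable_fun setT g ->
  {ae mu, forall x, f x = g x} -> \int[mu]_x f x = \int[mu]_x g x.
Proof.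
move=> mf mg fg; rewrite /Rintegral; congr fine; apply: ae_eq_integral => //.
- exact/measurable_EFinP.
- exact/measurable_EFinP.
- by apply: ae_imply fg _ => x /= -> _.
Qed.

End AlmostEverywhere.

Section WeakPartials.
Variables (R : realType) (p : nat).
Local Notation X := (measurableTypeR R).
Local Notation V := 'rV[R]_p.
Local Notation C := (cube_measure R p).
Local Notation U := (unit_interval_measure R).

(** One coordinate at a time: [D] lists the factors that have already been
    differentiated, and [s] those still to be differentiated. *)
Lemma weak_partial_prod_fun (K K' : 'I_p -> R -> R) (M : R) (phi : V -> R) :
  test_function phi ->
  (forall v, weak_derivative1 (K v) (K' v)) ->
  (forall v, measurable_fun setT (K v : X -> R)) ->
  (forall v, measurable_fun setT (K' v : X -> R)) ->
  (forall v x, `|K v x| <= M) -> (forall v x, `|K' v x| <= M) ->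
  forall (s D : seq 'I_p), uniq s -> (forall v, v \in s -> v \notin D) ->
  \int[C]_t (\prod_v (if v \in D then K' v else K v) (tnth t v) *
             iter_partial s phi (row_of_tuple t)) =
  (-1) ^+ size s *
  \int[C]_t (\prod_v (if v \in s ++ D then K' v else K v) (tnth t v) * phi (row_of_tuple t)).
Proof.
move=> tphi KK mK mK' KM K'M; elim=> [|v s IH] D.
  by move=> _ _; rewrite expr0 mul1r.
rewrite /= => /andP[vs us] sD.
have vD : v \notin D by apply: sD; rewrite mem_head.
pose G w := if w \in D then K' w else K w.
have mG w : measurable_fun setT (G w : X -> R) by rewrite /G; case: ifP.
have GM w x : `|G w x| <= M by rewrite /G; case: ifP.
pose c (t : p.-tuple X) := \prod_(w | w != v) G w (tnth t w).
have mc : measurable_fun setT c.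
  rewrite (_ : c = fun t => \prod_w (if w == v then cst 1 else G w) (tnth t w)).
    by apply: (@measurable_prod_coord R p (fun w => if w == v then cst 1 else G w)) => w; case: ifP.
  apply/funext => t; rewrite [RHS](bigD1 v)//= eqxx mul1r.
  by apply: eq_bigr => w /negbTE ->.
have cN t : `|c t| <= \prod_(w < p | w != v) M.
  rewrite normr_prod; apply: ler_prod => w _.
  by rewrite normr_ge0 GM.
have cv t x : c (resample v (t, x)) = c t.
  by apply: eq_bigr => w /negbTE wv; rewrite tnth_resample wv.
have d1 x : derivable (iter_partial s phi) x (delta_mx 0 v).
  exact: test_iter_derivable.
have d2 : continuous (iter_partial s phi) by exact: test_iter_continuous.
have d3 : continuous (partial v (iter_partial s phi)).
  exact: (@test_iter_continuous _ _ _ tphi (v :: s)).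
have d4 x : ~ open_cube x -> iter_partial s phi x = 0 by exact: test_iter_eq0.
have H := @weak_partial_coord R p (K v) (K' v) v c M _ (iter_partial s phi)
  (KK v) (mK v) (mK' v) (KM v) (K'M v) mc cN cv d1 d2 d3 d4
  (test_iter_bounded tphi s) (test_iter_bounded tphi (v :: s)).
have E (G' : 'I_p -> R -> R) t : (forall w, w != v -> G' w = G w) ->
    \prod_w G' w (tnth t w) = G' v (tnth t v) * c t.
  move=> GG; rewrite (bigD1 v)//=; congr (_ * _).
  by apply: eq_bigr => w /GG ->.
transitivity (\int[C]_t (K v (tnth t v) * c t * partial v (iter_partial s phi) (row_of_tuple t))).
  by apply: eq_Rintegral => t _; rewrite (E G)// /G (negbTE vD).
rewrite H.
have sD' w : w \in s -> w \notin v :: D.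
  move=> ws; rewrite inE negb_or sD ?inE ?ws ?orbT// andbT.
  by apply: contraNneq vs => <-.
have := IH (v :: D) us sD'.
have -> : \int[C]_t (\prod_w (if w \in v :: D then K' w else K w) (tnth t w) *
    iter_partial s phi (row_of_tuple t)) =
    \int[C]_t (K' v (tnth t v) * c t * iter_partial s phi (row_of_tuple t)).
  apply: eq_Rintegral => t _.
  rewrite (E (fun w => if w \in v :: D then K' w else K w)) ?mem_head// => w wv.
  by rewrite inE (negbTE wv).
move=> ->; rewrite exprS mulN1r mulNr; congr (- (_ * _)).
apply: eq_Rintegral => t _; congr (_ * _); apply: eq_bigr => w _.
by rewrite mem_cat !inE mem_cat orbCA.
Qed.

Lemma is_weak_partial_prod_fun (K K' : 'I_p -> R -> R) (M : R) (a : {set 'I_p}) :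
  (forall v, weak_derivative1 (K v) (K' v)) ->
  (forall v, measurable_fun setT (K v : X -> R)) ->
  (forall v, measurable_fun setT (K' v : X -> R)) ->
  (forall v x, `|K v x| <= M) -> (forall v x, `|K' v x| <= M) ->
  is_weak_partial a (prod_fun K) (prod_fun (fun v => if v \in a then K' v else K v)).
Proof.
move=> KK mK mK' KM K'M phi tphi.
rewrite /cube_integral.
have := weak_partial_prod_fun tphi KK mK mK' KM K'M (enum_uniq (mem a)) (D := [::]) (fun _ _ => isT).
rewrite cats0 -cardE => H; etransitivity; first etransitivity; [|exact: H|].
  by apply: eq_Rintegral => t _; rewrite prod_fun_row.
congr (_ * _); apply: eq_Rintegral => t _; rewrite prod_fun_row; congr (_ * _).
by apply: eq_bigr => v _; rewrite mem_enum.
Qed.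

Lemma ae_interior : {ae C, forall t, forall v, 0 < tnth t v < 1}.
Proof.
pose A v : set (p.-tuple X) := [set t | 0 < tnth t v < 1].
pose B : set (p.-tuple X) := \bigcap_(v in [set: 'I_p]) A v.
have mB : measurable B.
  apply: fin_bigcap_measurable => // v _.
  have -> : A v = (fun t : p.-tuple X => tnth t v) @^-1` `]0, 1[%classic.
    by apply/seteqP; split=> t; rewrite /A /= in_itv.
  by rewrite -[X in measurable X]setTI; apply: (@measurable_coord R p v) => //; exact: measurable_itv.
have CB : C B = 1%E.
  have : \int[C]_t (\prod_v (\1_(`]0, 1[%classic) (tnth t v) : R)) = 1.
    rewrite (@Rintegral_cube_prod R p (fun=> \1_(`]0, 1[%classic)) (fun=> 1)) => [|v|v x].
    - rewrite big1// => v _; rewrite /Rintegral integral_indic// setIT.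
      exact: (congr1 fine (unit_interval_interior R)).
    - exact: measurable_indic.
    - exact: indic_le1.
  have -> : \int[C]_t (\prod_v (\1_(`]0, 1[%classic) (tnth t v) : R)) = \int[C]_t (\1_B t : R).
    apply: eq_Rintegral => t _; rewrite indicE.
    have [Bt|Bt] := boolP (t \in B).
      rewrite big1// => v _; rewrite indicE mem_setE in_itv/=.
      by move: Bt; rewrite inE => /(_ v I); rewrite /A /= => ->.
    move: Bt; rewrite notin_setE => /existsNP[v /not_implyP[_ tv]].
    rewrite (bigD1 v)//= indicE mem_setE in_itv/=.
    by move/negP/negbTE: tv => ->; rewrite mul0r.
  rewrite /Rintegral integral_indic// setIT => H.
  by rewrite -(@fineK _ (C B)) ?H// fin_num_measure.
exists (~` B); split; first exact: measurableC.
- have := probability_setC C mB; rewrite CB subee// => ->//.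
- move=> t /= H Bt; apply: H => v; exact: (Bt v I).
Qed.

Lemma prod_indicator_box (b : 'I_p -> R) (t : p.-tuple X) :
  (forall v, 0 < tnth t v < 1) ->
  \1_(box b) t = \prod_v (0 < tnth t v < Num.min (b v) 1)%R%:R :> R.
Proof.
move=> t01; rewrite box_indicator; apply: eq_bigr => v _.
rewrite indicE mem_setE in_itv/= lt_min; have /andP[-> ->] := t01 v.
by rewrite andbT.
Qed.

(** The fundamental lemma of the calculus of variations on the cube, for
    product test functions: they approximate the indicators of boxes. *)
Lemma ae_zero_tests (g : p.-tuple X -> R) : integrableR C g ->
  (forall theta : 'I_p -> R -> R, (forall v, test1 (theta v)) ->
    \int[C]_t (g t * \prod_v theta v (tnth t v)) = 0) ->
  {ae C, forall t, g t = 0}.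
Proof.
move=> ig g0; apply: ae_zero_boxes => // b.
have mg := integrableR_measurable ig.
pose th n v := mollified_indicator (Num.min (b v) 1) n.
have tth n v : test1 (th n v) by apply: test1_mollified; rewrite ge_min lexx orbT.
pose lim t : R := g t * \prod_v (0 < tnth t v < Num.min (b v) 1)%R%:R.
have mprod n : measurable_fun setT (fun t : p.-tuple X => \prod_v th n v (tnth t v)).
  by apply: (@measurable_prod_coord R p (th n)) => v; exact: test1_measurable.
have mlim : measurable_fun setT lim.
  apply: measurable_funM => //.
  apply: (@measurable_prod_coord R p (fun v x => (0 < x < Num.min (b v) 1)%R%:R)) => v.
  rewrite (_ : (fun x : R => _) = \1_(`]0, Num.min (b v) 1[%classic)).
    exact: measurable_indic.
  by apply/funext => x; rewrite indicE mem_setE in_itv.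
have H : (fun n => \int[C]_t (g t * \prod_v th n v (tnth t v))) @ \oo --> \int[C]_t lim t.
  apply: (@Rdominated_cvg _ _ _ C _ _ (fun t => `|g t|)) => //.
  - by move=> n; exact: measurable_funM.
  - exact: (integrable_norm ig).
  - move=> n t; rewrite normrM -[leRHS]mulr1 ler_wpM2l//.
    apply: le_trans (prod_bounded (fun v => mollified_norm (Num.min (b v) 1) n (tnth t v))) _.
    by rewrite big1.
  - move=> t; apply: cvgM; first exact: cvg_cst.
    apply: cvg_big => [|v _]; first exact: mul_continuous.
    exact: cvg_mollified.
have lim0 : \int[C]_t lim t = 0.
  apply/esym; apply: cvg_unique H => //.
  rewrite (_ : (fun n => _) = cst 0); first exact: cvg_cst.
  by apply/funext => n; exact: g0.
rewrite -lim0; apply: ae_eq_Rintegral => //.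
  apply: measurable_funM => //.
  by apply: measurable_indic; exact: measurable_box.
by apply: ae_imply ae_interior _ => t t01; rewrite /lim prod_indicator_box.
Qed.

End WeakPartials.

(** * Uniqueness of weak partial derivatives *)

Section SobolevSpace.
Variables (R : realType) (p : nat).
Local Notation X := (measurableTypeR R).
Local Notation V := 'rV[R]_p.
Local Notation C := (cube_measure R p).
Local Notation row := (@row_of_tuple R p).
Implicit Types (f g : V -> R) (a : {set 'I_p}).

Lemma L2_cubeE f : L2_cube f <-> sq_integrable C (f \o row).
Proof. exact: (Lfun_sq_integrable C (f \o row)). Qed.

Lemma L2_norm_sqr f : L2_cube f -> L2_norm f ^+ 2 = \int[C]_t (f (row t) ^+ 2).
Proof. by move=> /L2_cubeE f2; exact: (Lnorm_sqr f2). Qed.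

Lemma weak_partialP a f : sobolev_S1 f ->
  L2_cube (weak_partial a f) /\ is_weak_partial a f (weak_partial a f).
Proof. by move=> [_ /(_ a) H]; exact: (xgetPex (fun=> 0) H). Qed.

Lemma S1_norm_sqr f : sobolev_S1 f ->
  S1_norm f ^+ 2 = \sum_a \int[C]_t (weak_partial a f (row t) ^+ 2).
Proof.
move=> fS; rewrite sqr_sqrtr; last by apply: sumr_ge0 => a _; exact: sqr_ge0.
by apply: eq_bigr => a _; apply: L2_norm_sqr; case: (weak_partialP a fS).
Qed.

(** The difference of two weak partial derivatives has null integrals against
    products of test functions. *)
Lemma weak_partial_unique a f1 f2 g1 g2 :
  L2_cube f1 -> L2_cube f2 -> L2_cube g1 -> L2_cube g2 ->
  {ae C, forall t, f1 (row t) = f2 (row t)} ->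
  is_weak_partial a f1 g1 -> is_weak_partial a f2 g2 ->
  {ae C, forall t, g1 (row t) = g2 (row t)}.
Proof.
move=> /L2_cubeE[mf1 _] /L2_cubeE[mf2 _] /L2_cubeE g1_2 /L2_cubeE g2_2 f12 w1 w2.
have ig := sq_integrable_integrable (sq_integrable_sub g1_2 g2_2).
suff : {ae C, forall t, (g1 \o row) t - (g2 \o row) t = 0}.
  by move=> H; apply: ae_imply H _ => t /= /eqP; rewrite subr_eq0 => /eqP.
apply: ae_zero_tests => // theta ttheta.
have tphi := test_function_prod_fun ttheta.
have E : cube_integral (fun x => g1 x * prod_fun theta x) =
         cube_integral (fun x => g2 x * prod_fun theta x).
  have s0 : (-1) ^+ #|a| != 0 :> R by rewrite signr_eq0.
  apply: (mulfI s0); rewrite -w1// -w2//; apply: ae_eq_Rintegral.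
  - by apply: measurable_funM => //; exact: measurable_test_iter.
  - by apply: measurable_funM => //; exact: measurable_test_iter.
  - by apply: ae_imply f12 _ => t /= ->.
have iM (g : V -> R) : sq_integrable C (g \o row) ->
    integrableR C (fun t => g (row t) * prod_fun theta (row t)).
  move=> g_2; have [M HM] := test_iter_bounded tphi [::].
  apply: (sq_integrable_mul g_2); apply: (@sq_integrable_bounded _ _ _ _ _ M) => [|t]; last exact: HM.
  exact: (measurable_test_iter tphi [::]).
transitivity (\int[C]_t (g1 (row t) * prod_fun theta (row t) -
                         g2 (row t) * prod_fun theta (row t))).
  by apply: eq_Rintegral => t _; rewrite prod_fun_row mulrBl.
rewrite RintegralB//; [|exact: iM|exact: iM].
by apply/eqP; rewrite subr_eq0; apply/eqP; exact: E.
Qed.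

Lemma L2_norm_weak_partial a f1 f2 g : L2_cube f1 -> L2_cube g -> sobolev_S1 f2 ->
  {ae C, forall t, f1 (row t) = f2 (row t)} -> is_weak_partial a f1 g ->
  \int[C]_t (weak_partial a f2 (row t) ^+ 2) = \int[C]_t (g (row t) ^+ 2).
Proof.
move=> f1_2 g_2 f2S f12 w1; have [w_2 w2] := weak_partialP a f2S.
have H := weak_partial_unique f1_2 f2S.1 g_2 w_2 f12 w1 w2.
have [mg _] := (L2_cubeE g).1 g_2; have [mw _] := (L2_cubeE _).1 w_2.
apply: ae_eq_Rintegral.
- by rewrite (_ : (fun x => _) = (fun x => (weak_partial a f2 \o row) x ^+ 2))//; exact: measurable_funX.
- by rewrite (_ : (fun x => _) = (fun x => (g \o row) x ^+ 2))//; exact: measurable_funX.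
- by apply: ae_imply H _ => t ->.
Qed.

Lemma S1_norm_ae_eq f1 f2 : sobolev_S1 f1 -> sobolev_S1 f2 ->
  {ae C, forall t, f1 (row t) = f2 (row t)} -> S1_norm f1 = S1_norm f2.
Proof.
move=> f1S f2S f12; congr Num.sqrt; apply: eq_bigr => a _.
have [w1 W1] := weak_partialP a f1S; have [w2 _] := weak_partialP a f2S.
by rewrite (L2_norm_sqr w1) (L2_norm_sqr w2) (L2_norm_weak_partial f1S.1 w1 f2S f12 W1).
Qed.

End SobolevSpace.

(** * Kernels given by integrals of features *)

Section IntegralKernels.
Context d (T : measurableType d) (R : realType) (mu : probability T R) (Y : Type).
Implicit Types (k : T -> Y -> Y -> R) (W : seq (R * Y)).

Lemma kernel_form_integral k W : (forall x y, integrableR mu (fun s => k s x y)) ->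
  integrableR mu (fun s => kernel_form (k s) W) /\
  kernel_form (fun x y => \int[mu]_s k s x y) W = \int[mu]_s kernel_form (k s) W.
Proof.
move=> ik.
have i1 w w' : integrableR mu (fun s => w.1 * w'.1 * k s w.2 w'.2).
  exact: integrableRZ.
have i2 (w : R * Y) : integrableR mu (fun s => \sum_(w' <- W) w.1 * w'.1 * k s w.2 w'.2).
  by apply: integrableR_sum => w' _; exact: i1.
split; first by apply: integrableR_sum => w _; exact: i2.
rewrite /kernel_form /kernel_pairing Rintegral_sum//; apply: eq_bigr => w _.
rewrite Rintegral_sum//; apply: eq_bigr => w' _.
by rewrite RintegralZl//; exact: ik.
Qed.

Lemma loewner_integral k k' :
  (forall x y, integrableR mu (fun s => k s x y)) ->
  (forall x y, integrableR mu (fun s => k' s x y)) ->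
  (forall s, loewner_le (k s) (k' s)) ->
  loewner_le (fun x y => \int[mu]_s k s x y) (fun x y => \int[mu]_s k' s x y).
Proof.
move=> ik ik' kk'; apply/loewner_leP; split=> [x y|W].
  rewrite -!RintegralB//; [|exact: ik'|exact: ik|exact: ik'|exact: ik].
  apply: eq_Rintegral => s _.
  by have /loewner_leP[H _] := kk' s; exact: H.
have [i1 ->] := kernel_form_integral W ik; have [i2 ->] := kernel_form_integral W ik'.
by apply: le_Rintegral => // s _; exact: loewner_form.
Qed.

Lemma psd_integral k : (forall x y, integrableR mu (fun s => k s x y)) ->
  (forall s, psd_kernel (k s)) -> psd_kernel (fun x y => \int[mu]_s k s x y).
Proof.
move=> ik pk; apply/psd_kernel_form; split=> [x y|W].
  by apply: eq_Rintegral => s _; have [H _] := pk s; exact: H.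
have [_ ->] := kernel_form_integral W ik.
by apply: Rintegral_ge0 => s _; exact: psd_form_ge0.
Qed.

End IntegralKernels.

Section CubeFeatures.
Variables (R : realType) (p : nat) (Y : Type).
Local Notation X := (measurableTypeR R).
Local Notation C := (cube_measure R p).
Local Notation U := (unit_interval_measure R).
Variables (K : 'I_p -> Y -> X -> R) (M : R).
Hypotheses (mK : forall v y, measurable_fun setT (K v y))
  (KM : forall v y s, `|K v y s| <= M).

Lemma integrable_feature2 v x y : integrableR U (fun s => K v x s * K v y s).
Proof.
apply: (@integrableR_bounded _ _ _ _ _ (M * M)) => [|s].
  exact: measurable_funM.
by rewrite normrM ler_pM.
Qed.

Lemma psd_feature v : psd_kernel (fun x y => \int[U]_s (K v x s * K v y s)).
Proof.
apply: psd_integral => [x y|s]; first exact: integrable_feature2.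
exact: psd_rank1.
Qed.

Definition cube_feature (y : Y) (t : p.-tuple X) : R := \prod_v K v y (tnth t v).

Lemma measurable_cube_feature y : measurable_fun setT (cube_feature y).
Proof. exact: (@measurable_prod_coord R p (fun v => K v y)). Qed.

Lemma cube_feature_bounded y t : `|cube_feature y t| <= \prod_(v < p) M.
Proof. exact: prod_bounded. Qed.

Lemma sq_integrable_cube_feature y : sq_integrable C (cube_feature y).
Proof.
apply: (@sq_integrable_bounded _ _ _ _ _ (\prod_(v < p) M)) => [|t].
  exact: measurable_cube_feature.
exact: cube_feature_bounded.
Qed.

Lemma sq_integrable_eval_feature W :
  sq_integrable C (fun t => eval_points (cube_feature ^~ t) W).
Proof.
apply: sq_integrable_sum => w; apply: sq_integrable_scale.
exact: sq_integrable_cube_feature.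
Qed.

(** The Gram matrix of product features is the product of the Gram matrices. *)
Lemma sq_norm_eval_feature W :
  \int[C]_t (eval_points (cube_feature ^~ t) W ^+ 2) =
  kernel_form (fun x y => \prod_v \int[U]_s (K v x s * K v y s)) W.
Proof.
have ik x y : integrableR C (fun t => cube_feature x t * cube_feature y t).
  by apply: sq_integrable_mul; exact: sq_integrable_cube_feature.
have [_] := kernel_form_integral W ik.
under [in X in _ = X]eq_Rintegral do rewrite (kernel_form_rank1 (cube_feature ^~ _)).
move=> <-; apply: eq_bigr => w _; apply: eq_bigr => w' _; congr (_ * _).
rewrite -(@Rintegral_cube_prod _ _ (fun v s => K v w.2 s * K v w'.2 s) (fun=> M * M)).
- by apply: eq_Rintegral => t _; rewrite /cube_feature -big_split.
- by move=> v; exact: measurable_funM.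
- by move=> v x; rewrite normrM ler_pM.
Qed.

End CubeFeatures.

(** * Representing a function of one variable by its derivative *)

Lemma integrableR_snd d1 d2 (T1 : measurableType d1) (T2 : measurableType d2)
    (R : realType) (m1 : probability T1 R) (m2 : probability T2 R) (g : T2 -> R) :
  integrableR m2 g -> (m1 \x m2)%E.-integrable setT (EFin \o (fun z => g z.2)).
Proof.
move=> ig; have mg := integrableR_measurable ig.
apply/integrable21ltyP => /=.
  by apply/measurable_EFinP; exact: (measurableT_comp mg).
have -> : (\int[m2]_y \int[m1]_x `|(g y)%:E| = \int[m2]_y `|(g y)%:E|)%E.
  apply: eq_integral => y _.
  rewrite integral_cst//= -[RHS]mule1; congr (_ * _)%E.
  exact: (probability_setT m1).
by have /integrableP[] := ig.
Qed.

Section Bridge.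
Variable R : realType.
Local Notation X := (measurableTypeR R).
Local Notation U := (unit_interval_measure R).
Local Notation leb := (@lebesgue_measure R).
Variable rho : R -> R.
Hypotheses (trho : test1 rho) (rho0 : forall x, 0 <= rho x)
  (rho1 : \int[U]_x rho x = 1).

Definition weight_tail (u : R) : R := \int[U]_x ((u < x)%R%:R * rho x).

Let irho := test1_integrable trho.
Let mrho := test1_measurable trho.

Let itail (g : R -> R) u : test1 g -> integrableR U (fun x => (u < x)%R%:R * g x).
Proof.
move=> tg; have [M gM] := test1_bounded tg.
apply: (@integrableR_bounded _ _ _ _ _ (1 * M)) => [|x].
  by apply: measurable_funM; [exact: measurable_gt_ray|exact: test1_measurable].
by rewrite normrM ler_pM// natr_bool_le1.
Qed.

Lemma weight_tail01 u : 0 <= weight_tail u <= 1.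
Proof.
apply/andP; split; first by apply: Rintegral_ge0 => x _; exact: mulr_ge0.
rewrite -rho1; apply: le_Rintegral => //; first exact: itail.
by move=> x _; case: (u < x); rewrite ?mul1r ?mul0r.
Qed.

Lemma measurable_weight_tail : measurable_fun setT (weight_tail : X -> R).
Proof.
have [M rM] := test1_bounded trho.
pose F (z : X * X) : R := (z.1 < z.2)%R%:R * rho z.2.
have iF : (U \x U)%E.-integrable setT (EFin \o F).
  apply: (@integrableR_bounded _ _ _ _ _ (1 * M)) => [|z].
    apply: measurable_funM; first exact: measurable_lt_pair.
    exact: (measurableT_comp mrho).
  by rewrite normrM ler_pM// natr_bool_le1.
exact: integrableR_measurable (Rintegral_prod1 iF).1.
Qed.

(** The two kernels of the identity [psi x = \int rho psi + \int chi_x psi'],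
    which expresses a value by the function ([false]) and by its derivative
    ([true]). *)
Definition bridge (b : bool) (x u : R) : R :=
  if b then (u < x)%R%:R - weight_tail u else rho u.

Lemma measurable_bridge b :
  measurable_fun setT (fun z : X * X => bridge b z.1 z.2).
Proof.
case: b; last exact: (measurableT_comp mrho).
apply: measurable_funB; first exact: measurable_lt_pair.
exact: (measurableT_comp measurable_weight_tail).
Qed.

Lemma measurable_bridger b x : measurable_fun setT (bridge b x : X -> R).
Proof.
case: b; last exact: mrho.
by apply: measurable_funB; [exact: measurable_lt_ray|exact: measurable_weight_tail].
Qed.

Lemma measurable_bridgel b u : measurable_fun setT (fun x : X => bridge b x u).
Proof.
case: b; last exact: measurable_cst.
by apply: measurable_funB; [exact: measurable_gt_ray|exact: measurable_cst].
Qed.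

Lemma bridge_bounded : exists M : R, forall b x u, `|bridge b x u| <= M.
Proof.
have [M rM] := test1_bounded trho; exists (1 + `|M|) => -[] x u; last first.
  by rewrite (le_trans (rM u))// (le_trans (ler_norm M))// lerDr.
have /andP[t0 t1] := weight_tail01 u.
rewrite (@le_trans _ _ 1) ?lerDl//= ler_norml.
by case: (u < x); rewrite /=; lra.
Qed.

Definition bridge_transform (b : bool) (theta : R -> R) (u : R) : R :=
  \int[U]_x (bridge b x u * theta x).

Lemma test1_scale (c : R) (f : R -> R) : test1 f -> test1 (fun x => c * f x).
Proof.
move=> tf; rewrite (_ : (fun x => _) = (fun x => f x + (c - 1) * f x)).
  exact: test1_lincomb.
by apply/funext => x; ring.
Qed.

(** Integrating [theta] against [chi_x u] in [x] gives a primitive of [c rho -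
    theta], where [c] is the integral of [theta]; it is compactly supported
    because [c rho - theta] has integral zero. *)
Lemma bridge_transformE b theta : test1 theta ->
  test1 (bridge_transform b theta) /\
  (if b then ((bridge_transform b theta)^`())%classic else bridge_transform b theta) =
  (fun u => if b then (\int[U]_x theta x) * rho u - theta u
            else (\int[U]_x theta x) * rho u).
Proof.
move=> tt; set c := \int[U]_x theta x; have itt := test1_integrable tt.
case: b; last first.
  have E : bridge_transform false theta = fun u => c * rho u.
    by apply/funext => u; rewrite /bridge_transform /= RintegralZl// mulrC.
  by rewrite E; split=> //; exact: test1_scale.
pose g x := theta x + (- c) * rho x.
have tg : test1 g by exact: test1_lincomb.
have g0 : \int[U]_x g x = 0.
  rewrite RintegralD//; last exact: (integrableRZ (- c) irho).
  by rewrite RintegralZl// rho1 mulr1 subrr.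
pose G u := \int[leb]_(x in `[0, u]) g x.
have E : bridge_transform true theta = fun u => (- 1) * G u.
  apply/funext => u; rewrite mulN1r -primitive_tail// /bridge_transform /=.
  have -> : \int[U]_x (((u < x)%R%:R - weight_tail u) * theta x) =
      \int[U]_x ((u < x)%R%:R * theta x) - weight_tail u * c.
    under eq_Rintegral do rewrite mulrBl.
    by rewrite RintegralB//; [rewrite RintegralZl|exact: itail|exact: integrableRZ].
  have -> : \int[U]_x ((u < x)%R%:R * g x) =
      \int[U]_x ((u < x)%R%:R * theta x) + (- c) * weight_tail u.
    rewrite /weight_tail -RintegralZl//; last exact: itail.
    rewrite -RintegralD//; [|exact: itail|exact: (integrableRZ (- c) (itail u trho))].
    by apply: eq_Rintegral => x _; rewrite /g; ring.
  by ring.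
have [tG dG] := test1_primitive tg g0.
rewrite E; split; first exact: test1_scale.
have sG : smooth1 G by case: tG.
apply: is_derive_derive1 => x.
have H : is_derive x 1 G (g x) by rewrite -dG; exact: smooth1_is_derive.
have := is_deriveZ (- 1) H => H'.
apply: (is_derive_eq H'); rewrite /g /GRing.scale/=; ring.
Qed.

(** With [A = 1_(s < x)], [A' = 1_(s < y)] and [B] the tail of [rho] at [s],
    [(A - B) (A' - B)] is at most [2 A A' + 2 B ^ 2] in the Loewner order, the
    difference being the rank one kernel [(A + B) (A' + B)]; integrating in
    [s] turns [A A'] into [min (x, y)]. *)
Lemma bridge_kernel_le (Y : Type) (g : Y -> R) : (forall y, 0 <= g y <= 1) ->
  loewner_le (fun x y => \sum_(b : bool) \int[U]_s (bridge b (g x) s * bridge b (g y) s))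
    (fun x y => (\int[U]_s (rho s ^+ 2) + 2) * (1 + Num.min (g x) (g y))).
Proof.
move=> g01; have [M bM] := bridge_bounded.
have iR : integrableR U (fun s => weight_tail s * weight_tail s).
  apply: (@integrableR_bounded _ _ _ _ _ (1 * 1)) => [|s].
    by apply: measurable_funM; exact: measurable_weight_tail.
  by have /andP[t0 t1] := weight_tail01 s; rewrite normrM !ger0_norm// ler_pM.
have ir x y : integrableR U (fun s => (s < g x)%R%:R * (s < g y)%R%:R).
  apply: (@integrableR_bounded _ _ _ _ _ (1 * 1)) => [|s].
    by apply: measurable_funM; exact: measurable_lt_ray.
  by rewrite normrM ler_pM// natr_bool_le1.
have ib b x y : integrableR U (fun s => bridge b (g x) s * bridge b (g y) s).
  apply: (@integrableR_bounded _ _ _ _ _ (M * M)) => [|s].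
    by apply: measurable_funM; exact: measurable_bridger.
  by rewrite normrM ler_pM.
pose r := \int[U]_s (rho s ^+ 2); pose q := \int[U]_s (weight_tail s * weight_tail s).
have r0 : 0 <= r by apply: Rintegral_ge0 => s _; exact: sqr_ge0.
have q1 : 0 <= q <= 1.
  apply/andP; split; first by apply: Rintegral_ge0 => s _; exact: sqr_ge0.
  apply: (@le_trans _ _ (\int[U]_s (cst (1 : R) s))).
    apply: le_Rintegral => //; first exact: (integrableR_cst U 1).
    by move=> s _; have /andP[t0 t1] := weight_tail01 s; rewrite /= mulr_ile1.
  by rewrite Rintegral_cst//= (congr1 fine (probability_setT U)) mulr1.
apply: (@loewner_trans _ _ (fun x y => 2 * Num.min (g x) (g y) + (r + 2 * q))).
  have -> : (fun x y => \sum_(b : bool) \int[U]_s (bridge b (g x) s * bridge b (g y) s)) =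
      (fun x y => \int[U]_s (bridge true (g x) s * bridge true (g y) s) + r).
    by apply/funext => x; apply/funext => y; rewrite big_bool.
  have -> : (fun x y => 2 * Num.min (g x) (g y) + (r + 2 * q)) =
      (fun x y => \int[U]_s (2 * ((s < g x)%R%:R * (s < g y)%R%:R) +
        2 * (weight_tail s * weight_tail s)) + r).
    apply/funext => x; apply/funext => y.
    rewrite RintegralD//; [|exact: (integrableRZ 2 (ir x y))|exact: (integrableRZ 2 iR)].
    rewrite !RintegralZl//; last exact: ir.
    by rewrite Rintegral_ray2// (clamp_id (g01 y)) -/q; ring.
  apply: loewner_add; last by apply: loewner_refl.
  apply: loewner_integral => [x y|x y|s]; first exact: ib.
    by apply: integrableRD; exact: integrableRZ.
  rewrite /loewner_le (_ : (fun x y => _) = (fun x y =>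
    ((s < g x)%R%:R + weight_tail s) * ((s < g y)%R%:R + weight_tail s))).
    exact: psd_rank1.
  by apply/funext => x; apply/funext => y; rewrite /bridge; ring.
have -> : (fun x y => 2 * Num.min (g x) (g y) + (r + 2 * q)) =
    (fun x y => 2 * Num.min (g x) (g y) + (r + 2 * q) * 1).
  by apply/funext => x; apply/funext => y; rewrite mulr1.
rewrite (_ : (fun x y => (_ + 2) * _) =
   (fun x y => (r + 2) * Num.min (g x) (g y) + (r + 2) * 1)); last first.
  by apply/funext => x; apply/funext => y; rewrite -/r; ring.
apply: loewner_add; apply: loewner_scalel.
- by rewrite lerDr.
- by apply: psd_min => x; case/andP: (g01 x).
- by case/andP: q1; lra.
- exact: psd_cst.
Qed.

End Bridge.

(** * Representing Sobolev functions on the cube *)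

Section SobolevRepresentation.
Variables (R : realType) (p : nat).
Local Notation X := (measurableTypeR R).
Local Notation V := 'rV[R]_p.
Local Notation C := (cube_measure R p).
Local Notation U := (unit_interval_measure R).
Local Notation row := (@row_of_tuple R p).
Variable rho : R -> R.
Hypotheses (trho : test1 rho) (rho0 : forall x, 0 <= rho x)
  (rho1 : \int[U]_x rho x = 1).
Local Notation bridge := (bridge rho).

Lemma finite_cauchy_schwarz (I : finType) (A B E : I -> R) :
  (forall i t, 0 <= A i + 2 * t * B i + t ^+ 2 * E i) ->
  (\sum_i B i) ^+ 2 <= (\sum_i A i) * (\sum_i E i).
Proof.
move=> H; apply: discriminant_le => t.
by rewrite !mulr_sumr -!big_split/=; apply: sumr_ge0 => i _; exact: H.
Qed.

Variable D : {set 'I_p} -> p.-tuple X -> R.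
Hypothesis D2 : forall a, sq_integrable C (D a).

(** The tensor power of the identity behind [bridge], with [D a] in the place
    of the mixed derivative along the variables of [a]. *)
Definition bridge_sum (x : V) : R :=
  \sum_(a : {set 'I_p}) \int[C]_u ((\prod_v bridge (v \in a) (x 0 v) (tnth u v)) * D a u).

(** Cauchy-Schwarz over [a] and [u] separates the derivatives from the
    kernels. The Gram matrices of the kernels, products indexed by [a], sum up
    to the product over the variables of the sums of two one variable Gram
    matrices. *)
Lemma bridge_sum_dominated : kernel_dominated (@min_kernel R p)
  (fun x : unit_cube R p => bridge_sum (\val x))
  ((\int[U]_s (rho s ^+ 2) + 2) ^+ p * \sum_a \int[C]_u (D a u ^+ 2)).
Proof.
move=> W; have [M bM] := bridge_bounded trho rho0 rho1.
pose K (a : {set 'I_p}) v (x : unit_cube R p) (s : X) := bridge (v \in a) (\val x 0 v) s.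
have mK a v x : measurable_fun setT (K a v x) by exact: measurable_bridger.
have KM a v x s : `|K a v x s| <= M by exact: bM.
pose E a t := eval_points (cube_feature (K a) ^~ t) W.
have E2 a : sq_integrable C (E a) by exact: (sq_integrable_eval_feature (mK a) (KM a)).
have F2 a x := sq_integrable_cube_feature (mK a) (KM a) x.
have -> : eval_points (fun x : unit_cube R p => bridge_sum (\val x)) W =
    \sum_a \int[C]_t (D a t * E a t).
  rewrite eval_points_sum; apply: eq_bigr => a _.
  transitivity (\int[C]_t (\sum_(w <- W) w.1 * (cube_feature (K a) w.2 t * D a t))).
    rewrite Rintegral_sum; last first.
      by move=> w _; apply: integrableRZ; exact: (sq_integrable_mul (F2 a w.2) (D2 a)).
    apply: eq_bigr => w _; rewrite RintegralZl//.
    exact: (sq_integrable_mul (F2 a w.2) (D2 a)).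
  apply: eq_Rintegral => t _; rewrite mulrC /E /eval_points mulr_suml.
  by apply: eq_bigr => w _; rewrite mulrA.
apply: le_trans (finite_cauchy_schwarz
  (A := fun a => \int[C]_u (D a u ^+ 2)) (E := fun a => \int[C]_u (E a u ^+ 2)) _) _.
  move=> a t; rewrite -sq_normD//; exact: sq_norm_ge0.
rewrite [_ ^+ p * _]mulrC -mulrA ler_wpM2l//.
  by apply: sumr_ge0 => a _; exact: sq_norm_ge0.
rewrite -kernel_formZ.
have -> : \sum_a \int[C]_u (E a u ^+ 2) =
    kernel_form (fun x y : unit_cube R p => \prod_v \sum_(b : bool)
      \int[U]_s (bridge b (\val x 0 v) s * bridge b (\val y 0 v) s)) W.
  under eq_bigr do rewrite (sq_norm_eval_feature (mK _) (KM _)).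
  rewrite -kernel_form_sum; apply: eq_bigr => w _; apply: eq_bigr => w' _; congr (_ * _).
  under [RHS]eq_bigr do rewrite big_bool.
  rewrite bigA_distr; apply: eq_bigr => a _; apply: eq_bigr => v _.
  by rewrite /K; case: (v \in a).
apply: loewner_form; apply: (@loewner_prodZ R p _ _
  (fun v (x y : unit_cube R p) => 1 + Num.min (\val x 0 v) (\val y 0 v))).
- by rewrite addr_ge0//; apply: Rintegral_ge0 => s _; exact: sqr_ge0.
- move=> v; apply: psd_sum => b _.
  exact: (@psd_feature R p (unit_cube R p) (fun v x => bridge b (\val x 0 v)) M
    (fun v x => measurable_bridger trho b (\val x 0 v))
    (fun v x => bM b (\val x 0 v)) v).
- by move=> v; apply: bridge_kernel_le => // y; exact: unit_cube01.
Qed.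

Let integrand (a : {set 'I_p}) (P : p.-tuple X -> R) (z : p.-tuple X * p.-tuple X) : R :=
  (\prod_v bridge (v \in a) (tnth z.1 v) (tnth z.2 v)) * D a z.2 * P z.1.

Lemma measurable_bridge_prod (a : {set 'I_p}) :
  measurable_fun setT (fun z : p.-tuple X * p.-tuple X =>
    \prod_v bridge (v \in a) (tnth z.1 v) (tnth z.2 v)).
Proof.
apply: measurable_prod => v _.
have mp : measurable_fun setT (fun z : p.-tuple X * p.-tuple X => (tnth z.1 v, tnth z.2 v)).
  apply: measurable_fun_pair.
    exact: (measurableT_comp (measurable_coord v) measurable_fst).
  exact: (measurableT_comp (measurable_coord v) measurable_snd).
exact: (measurableT_comp (measurable_bridge trho (v \in a)) mp).
Qed.

Let integrable_integrand a (P : p.-tuple X -> R) (N : R) : measurable_fun setT P -> (forall t, `|P t| <= N) ->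
  (C \x C)%E.-integrable setT (EFin \o integrand a P).
Proof.
move=> mP PN; have [M bM] := bridge_bounded trho rho0 rho1.
have iD := integrableR_snd C (sq_integrable_integrable (D2 a)).
have mD := (D2 a).1.
apply: (@integrableR_dominated _ _ _ _ _ (fun z => (\prod_(v < p) M) * N * `|D a z.2|)).
- apply: measurable_funM; last exact: (measurableT_comp mP).
  apply: measurable_funM; first exact: measurable_bridge_prod.
  exact: (measurableT_comp mD).
- exact: (integrableRZ _ (integrable_norm iD)).
- move=> z; rewrite /integrand mulrAC normrM ler_wpM2r// normrM ler_pM//.
  by apply: prod_bounded => v; exact: bM.
Qed.

Lemma bridge_sum_row (t : p.-tuple X) : bridge_sum (row t) =
  \sum_a \int[C]_u integrand a (fun=> 1) (t, u).
Proof.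
apply: eq_bigr => a _; apply: eq_Rintegral => u _.
rewrite /integrand mulr1; congr (_ * _); apply: eq_bigr => v _.
by rewrite row_of_tupleE.
Qed.

Lemma integrable_bridge_sum : integrableR C (fun t => bridge_sum (row t)).
Proof.
rewrite (_ : (fun t => _) = fun t => \sum_a \int[C]_u integrand a (fun=> 1) (t, u)).
  apply: integrableR_sum => a _.
  have iF := @integrable_integrand a (fun=> 1) 1 (measurable_cst _) (fun _ => ltac:(by rewrite normr1)).
  exact: (Rintegral_prod1 iF).1.
by apply/funext => t; exact: bridge_sum_row.
Qed.

(** By Fubini's theorem the kernels act on the test function instead of on
    [D]. *)
Lemma bridge_sum_test (theta : 'I_p -> R -> R) : (forall v, test1 (theta v)) ->
  \int[C]_t (bridge_sum (row t) * \prod_v theta v (tnth t v)) =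
  \sum_a \int[C]_u (D a u * prod_fun (fun v => bridge_transform rho (v \in a) (theta v)) (row u)).
Proof.
move=> tt; have [M bM] := bridge_bounded trho rho0 rho1.
pose P (t : p.-tuple X) := \prod_v theta v (tnth t v).
have mP : measurable_fun setT P.
  by apply: (@measurable_prod_coord R p theta) => v; exact: test1_measurable.
have HB v : exists B : R, forall x, `|theta v x| <= B by exact: test1_bounded.
pose B v := projT1 (cid (HB v)).
have BP v x : `|theta v x| <= B v by exact: (projT2 (cid (HB v))).
have PN t : `|P t| <= \prod_v B v by apply: prod_bounded => v; exact: BP.
have iF a := integrable_integrand a mP PN.
have i1 t a : \int[C]_u integrand a P (t, u) = (\int[C]_u integrand a (fun=> 1) (t, u)) * P t.
  rewrite -RintegralZr//.
    by apply: eq_Rintegral => u _; rewrite /integrand/= mulr1.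
  have [M' HM'] : exists M' : R, forall u,
      `|\prod_v bridge (v \in a) (tnth t v) (tnth u v)| <= M'.
    by exists (\prod_(v < p) M) => u; apply: prod_bounded => v; exact: bM.
  apply: (@integrableR_dominated _ _ _ _ _ (fun u => M' * `|D a u|)).
  - apply: measurable_funM; last exact: measurable_cst.
    apply: measurable_funM; last exact: (D2 a).1.
    apply: (@measurable_prod_coord R p (fun v => bridge (v \in a) (tnth t v))) => v.
    exact: measurable_bridger.
  - apply: integrableRZ; apply: integrable_norm.
    exact: (sq_integrable_integrable (D2 a)).
  - by move=> u; rewrite /integrand /= mulr1 normrM ler_wpM2r.
transitivity (\int[C]_t (\sum_a \int[C]_u integrand a P (t, u))).
  apply: eq_Rintegral => t _; rewrite bridge_sum_row mulr_suml.
  by apply: eq_bigr => a _; rewrite i1.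
rewrite Rintegral_sum; last by move=> a _; exact: (Rintegral_prod1 (iF a)).1.
apply: eq_bigr => a _; rewrite -(Rintegral_prod1 (iF a)).2 (Rintegral_prod2 (iF a)).
apply: eq_Rintegral => u _; rewrite prod_fun_row.
rewrite -(@Rintegral_cube_prod R p
  (fun v x => bridge (v \in a) x (tnth u v) * theta v x) (fun v => M * B v)); last 2 first.
- move=> v; apply: measurable_funM; last exact: test1_measurable.
  exact: measurable_bridgel.
- by move=> v x; rewrite normrM ler_pM.
rewrite -RintegralZl//; last first.
  apply: (@integrableR_bounded _ _ _ _ _ (\prod_v (M * B v))).
    apply: (@measurable_prod_coord R p (fun v x => bridge (v \in a) x (tnth u v) * theta v x)) => v.
    apply: measurable_funM; last exact: test1_measurable.
    exact: measurable_bridgel.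
  by move=> t; apply: prod_bounded => v; rewrite normrM ler_pM.
by apply: eq_Rintegral => t _; rewrite /integrand big_split/= /P; ring.
Qed.

End SobolevRepresentation.

Section SobolevEvaluation.
Variables (R : realType) (p : nat).
Local Notation X := (measurableTypeR R).
Local Notation V := 'rV[R]_p.
Local Notation C := (cube_measure R p).
Local Notation U := (unit_interval_measure R).
Local Notation row := (@row_of_tuple R p).
Variable rho : R -> R.
Hypotheses (trho : test1 rho) (rho0 : forall x, 0 <= rho x)
  (rho1 : \int[U]_x rho x = 1).
Variable f : V -> R.
Hypothesis fS : sobolev_S1 f.

Let D a (t : p.-tuple X) : R := weak_partial a f (row t).

Let D2 a : sq_integrable C (D a).
Proof. by apply/L2_cubeE; case: (weak_partialP a fS). Qed.

(** Tested against a product of [theta v], the weak derivatives [D a] move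
    onto the transforms of the [theta v], whose derivatives are, up to sign,
    [theta v - c v * rho] for [v] in [a] and [c v * rho] otherwise. Summed
    over [a] these products give back the product of the [theta v]. *)
Lemma bridge_sum_ae : {ae C, forall t, bridge_sum rho D (row t) = f (row t)}.
Proof.
have f2 := (L2_cubeE f).1 fS.1.
have i1 := integrable_bridge_sum trho rho0 rho1 D2.
have i2 := sq_integrable_integrable f2.
suff H : {ae C, forall t, bridge_sum rho D (row t) - f (row t) = 0}.
  by apply: ae_imply H _ => t /eqP; rewrite subr_eq0 => /eqP.
apply: ae_zero_tests => [|theta tt]; first exact: (integrableRB i1 i2).
pose c v := \int[U]_x theta v x.
have bt (a : {set 'I_p}) (v : 'I_p) := bridge_transformE trho rho1 (v \in a) (tt v).
pose Psi (a : {set 'I_p}) := prod_fun (fun v => bridge_transform rho (v \in a) (theta v)) : V -> R.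
have tPsi a : test_function (Psi a) by apply: test_function_prod_fun => v; case: (bt a v).
have iM (g : p.-tuple X -> R) phi s : integrableR C g -> test_function phi ->
    integrableR C (fun t => g t * iter_partial s phi (row t)).
  move=> ig tphi; have [B tB] := test_iter_bounded tphi s.
  apply: (@integrableR_dominated _ _ _ _ _ (fun t => B * `|g t|)).
  - apply: measurable_funM; first exact: integrableR_measurable ig.
    exact: measurable_test_iter.
  - exact: (integrableRZ B (integrable_norm ig)).
  - by move=> t; rewrite normrM mulrC ler_wpM2r.
have iT (g : p.-tuple X -> R) : integrableR C g ->
    integrableR C (fun t => g t * \prod_v theta v (tnth t v)).
  move=> ig; have := iM g _ [::] ig (test_function_prod_fun tt).
  rewrite (_ : (fun t => _) = (fun t => g t * \prod_v theta v (tnth t v)))//.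
  by apply/funext => t; rewrite /= prod_fun_row.
under eq_Rintegral do rewrite mulrBl.
rewrite RintegralB//; [|exact: iT i1|exact: iT i2].
apply/eqP; rewrite subr_eq0; apply/eqP.
rewrite (bridge_sum_test trho rho0 rho1 D2 tt).
pose Q (a : {set 'I_p}) (t : p.-tuple X) := \prod_v
  (if v \in a then theta v (tnth t v) - c v * rho (tnth t v) else c v * rho (tnth t v)).
have QE a t : Q a t = (-1) ^+ #|a| * iter_partial (enum a) (Psi a) (row t).
  rewrite iter_partial_enum_prod_fun; last by move=> v; case: (bt a v) => -[].
  rewrite prod_fun_row -prodr_const big_mkcond/= -big_split/=; apply: eq_bigr => v _.
  have [_ E] := bt a v.
  have -> : (if v \in a then ((bridge_transform rho (v \in a) (theta v))^`())%classic
      else bridge_transform rho (v \in a) (theta v)) (tnth t v) =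
      (if v \in a then c v * rho (tnth t v) - theta v (tnth t v) else c v * rho (tnth t v)).
    by rewrite E; case: (v \in a).
  by case: (v \in a); ring.
have iQ a : integrableR C (fun t => f (row t) * Q a t).
  rewrite (_ : (fun t => _) = (fun t => (-1) ^+ #|a| *
      (f (row t) * iter_partial (enum a) (Psi a) (row t)))).
    by apply: integrableRZ; exact: iM.
  by apply/funext => t; rewrite QE; ring.
transitivity (\sum_(a : {set 'I_p}) \int[C]_u (f (row u) * Q a u)).
  apply: eq_bigr => a _; have [_ w] := weak_partialP a fS.
  have s0 : (-1) ^+ #|a| != 0 :> R by rewrite signr_eq0.
  have W : \int[C]_u (f (row u) * iter_partial (enum a) (Psi a) (row u)) =
    (-1) ^+ #|a| * \int[C]_u (D a u * Psi a (row u)) by exact: (w _ (tPsi a)).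
  apply: (mulfI s0); rewrite -W -RintegralZl//; last exact: iQ.
  apply: eq_Rintegral => u _.
  by rewrite QE [in RHS]mulrCA [in RHS](mulrA ((-1) ^+ #|a|)) -expr2 sqrr_sign mul1r.
rewrite -Rintegral_sum//; apply: eq_Rintegral => t _; rewrite -mulr_sumr; congr (_ * _).
by rewrite -bigA_distr; apply: eq_bigr => v _; exact: subrK.
Qed.

End SobolevEvaluation.

(** * Continuous functions on the closed cube *)

Section SobolevDominated.
Variables (R : realType) (p : nat).
Local Notation C := (cube_measure R p).
Local Notation U := (unit_interval_measure R).
Local Notation row := (@row_of_tuple R p).

(** The Sobolev space is contained in the space of the pivot kernel. *)
Lemma sobolev_dominated : exists2 A : R, 0 < A & forall f, sobolev_S1 f ->
  exists2 h : unit_cube R p -> R,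
    kernel_dominated (@min_kernel R p) h (A * S1_norm f ^+ 2) &
    {ae C, forall t, forall x : unit_cube R p, \val x = row t -> f (row t) = h x}.
Proof.
have [rho [trho rho0 rho1]] := @test1_weight R.
exists ((\int[U]_s (rho s ^+ 2) + 2) ^+ p).
  rewrite exprn_gt0// ltr_wpDl//; apply: Rintegral_ge0 => s _; exact: sqr_ge0.
move=> f fS; pose D (a : {set 'I_p}) t := weak_partial a f (row t).
have D2 a : sq_integrable C (D a) by apply/L2_cubeE; case: (weak_partialP a fS).
exists (fun x => bridge_sum rho D (\val x)).
  rewrite S1_norm_sqr//; exact: bridge_sum_dominated.
by apply: ae_imply (bridge_sum_ae trho rho0 rho1 fS) _ => t <- x ->.
Qed.

End SobolevDominated.

Section CubePoints.
Variables (R : realType) (p : nat).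
Local Notation X := (measurableTypeR R).
Local Notation V := 'rV[R]_p.
Local Notation C := (cube_measure R p).
Local Notation U := (unit_interval_measure R).
Local Notation row := (@row_of_tuple R p).

Lemma clamp_row_cube (x : V) : (\row_v clamp (x 0 v) : V) \in unit_cube R p.
Proof. by rewrite inE => v; rewrite mxE clamp01. Qed.

Definition clamp_point (x : V) : unit_cube R p := SigSub (clamp_row_cube x).

Lemma clamp_pointE (x : V) v : \val (clamp_point x) 0 v = clamp (x 0 v).
Proof. by rewrite mxE. Qed.

Lemma clamp_point_val (x : unit_cube R p) : clamp_point (\val x) = x.
Proof.
by apply/val_inj/rowP => v; rewrite clamp_pointE clamp_id// unit_cube01.
Qed.

Lemma clamp_lipschitz (s t : R) : `|clamp s - clamp t| <= `|s - t|.
Proof.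
have E (r : R) : [\/ r <= 0 /\ clamp r = 0, 0 <= r <= 1 /\ clamp r = r | 1 <= r /\ clamp r = 1].
  rewrite /clamp; have [r0|r0] := leP r 0.
    by constructor 1; rewrite min_r ?(le_trans r0)// max_l.
  have [r1|r1] := leP r 1.
    by constructor 2; rewrite max_r ?(ltW r0).
  by constructor 3; rewrite (ltW r1) max_r.
have := ler_norm (s - t); have := ler_norm (t - s); rewrite distrC ler_norml.
by case: (E s) => -[Hs ->]; case: (E t) => -[Ht ->]; lra.
Qed.

Lemma continuous_clamp_point : continuous clamp_point.
Proof.
have H : continuous (fun x : V => (\row_v clamp (x 0 v) : V)).
  move=> x A /nbhs_ballP[e /= e0 He]; apply/nbhs_ballP; exists e => //= y [_ xy].
  apply: He; split=> // i v; rewrite !mxE /ball/=; apply: le_lt_trans (xy i v).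
  by rewrite (ord1 i); exact: clamp_lipschitz.
by apply/continuousP => _ [B oB <-]; exact: ((continuousP _).1 H B oB).
Qed.

Lemma continuous_val_cube : continuous (\val : unit_cube R p -> V).
Proof. exact: initial_continuous. Qed.

Lemma continuous_extension (h : unit_cube R p -> R) : continuous h ->
  continuous (fun x : V => h (clamp_point x)).
Proof.
move=> ch x; apply: (@continuous_comp _ _ _ clamp_point h); last exact: ch.
exact: continuous_clamp_point.
Qed.

(** Around a point of the closed cube where the functions differ there is a
    box inside the open cube, of positive measure, on which they differ. *)
Lemma continuous_ae_eq (h h' : unit_cube R p -> R) : continuous h -> continuous h' ->
  {ae C, forall t, forall x : unit_cube R p, \val x = row t -> h x = h' x} ->
  h = h'.
Proof.
move=> ch ch' hh'; apply/funext => x0; apply: contrapT => /eqP x0N.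
have cd : continuous (fun x : V => h (clamp_point x) - h' (clamp_point x)).
  by move=> x; apply: continuousB; exact: continuous_extension.
have : \forall x \near \val x0, h (clamp_point x) - h' (clamp_point x) != 0.
  have := cd (\val x0); rewrite /continuous_at clamp_point_val => cd0.
  apply: (cd0 [set r | r != 0]); apply: open_nbhs_nbhs; split; first exact: open_neq.
  by rewrite /= subr_eq0.
move=> /nbhs_ballP[e /= e0 He].
pose a v := Num.max 0 (\val x0 0 v - e); pose b v := Num.min 1 (\val x0 0 v + e).
have ab v : 0 <= a v /\ a v < b v /\ b v <= 1.
  rewrite /a /b; have /andP[x00 x01] := unit_cube01 x0 v.
  by rewrite minEle maxEle; do 2 case: ifPn; rewrite -?ltNge; lra.
have B t : (forall v, a v < tnth t v < b v) ->
    h (clamp_point (row t)) - h' (clamp_point (row t)) != 0.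
  move=> tab; apply: He; split=> // i v; rewrite (ord1 i) row_of_tupleE.
  have := tab v; rewrite /a /b gt_max lt_min => /andP[/andP[_ H1] /andP[_ H2]].
  by rewrite /ball/= ltr_norml; lra.
have : \int[C]_t (\prod_v (\1_(`]a v, b v[%classic) (tnth t v) : R)) = 0.
  transitivity (\int[C]_t (cst (0 : R) t)); last exact: Rintegral_eq0.
  apply: ae_eq_Rintegral => //.
    apply: (@measurable_prod_coord R p (fun v => \1_(`]a v, b v[%classic))) => v.
    exact: measurable_indic.
  apply: ae_imply2 hh' (ae_interior R p) _ => t Ht t01.
  have [/B/negP[]|/existsNP[v /negP tv]] := pselect (forall v, a v < tnth t v < b v).
    rewrite subr_eq0; apply/eqP; apply: Ht; apply/rowP => v.
    by rewrite clamp_pointE row_of_tupleE clamp_id//; case/andP: (t01 v) => /ltW -> /ltW.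
  by rewrite (bigD1 v)//= indicE mem_setE in_itv/= (negbTE tv) mul0r.
rewrite (@Rintegral_cube_prod R p (fun v => \1_(`]a v, b v[%classic)) (fun=> 1)); last 2 first.
- by move=> v; exact: measurable_indic.
- by move=> v x; exact: indic_le1.
move/eqP; apply/negP/prodf_neq0 => v _; have [a0 [a_b b1]] := ab v.
rewrite /Rintegral integral_indic// setIT.
suff H : unit_interval_measure R `]a v, b v[%classic = (b v - a v)%:E.
  by rewrite (congr1 fine H)/= subr_eq0 gt_eqF.
rewrite /unit_interval_measure /mrestr setIidl.
  by rewrite lebesgue_measure_itv/= lte_fin a_b.
move=> s /=; rewrite !in_itv/= => /andP[/ltW sa /ltW sb].
by rewrite (le_trans a0)// (le_trans sb).
Qed.

(** Domination at two point masses bounds [(h x - h y) ^ 2] by the form of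
    their difference, which is continuous and vanishes at [y = x]. *)
Lemma kernel_dominated_continuous (h : unit_cube R p -> R) (M : R) : 0 <= M ->
  kernel_dominated (@min_kernel R p) h M -> continuous h.
Proof.
move=> M0 hM x.
have K2 y : (h x - h y) ^+ 2 <=
    M * (min_kernel x x - 2 * min_kernel x y + min_kernel y y).
  have := hM [:: (1, x); (- 1, y)].
  rewrite /eval_points /kernel_form /kernel_pairing !(big_cons, big_nil)/=.
  have -> : min_kernel y x = min_kernel x y by apply: eq_bigr => v _; rewrite minC.
  set kxx := min_kernel x x; set kxy := min_kernel x y; set kyy := min_kernel y y.
  rewrite (_ : 1 * h x + _ = h x - h y); last by ring.
  by move=> H; apply: (le_trans H); rewrite le_eqVlt; apply/orP; left; apply/eqP; ring.
pose Q (z : V) := M * (min_kernel x x -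
  2 * prod_fun (fun v s => 1 + Num.min (\val x 0 v) s) z + prod_fun (fun v s => 1 + s) z).
have cQ : continuous Q.
  have c1 : continuous (prod_fun (fun v s => 1 + Num.min (\val x 0 v) s)).
    apply: continuous_prod_fun => v s; apply: cvgD; first exact: cvg_cst.
    by apply: continuous_min; [exact: cst_continuous|exact: cvg_id].
  have c2 : continuous (prod_fun (fun (_ : 'I_p) (s : R) => 1 + s)).
    by apply: continuous_prod_fun => v s; apply: cvgD; [exact: cvg_cst|exact: cvg_id].
  move=> z; have cc (r : R) : {for z, continuous (fun _ : V => r)} by exact: cst_continuous.
  exact: (continuousM (cc M) (continuousD
    (continuousB (cc (min_kernel x x)) (continuousM (cc 2) (c1 z))) (c2 z))).
have QE (y : unit_cube R p) :
    Q (\val y) = M * (min_kernel x x - 2 * min_kernel x y + min_kernel y y).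
  congr (_ * (_ + _)); apply: eq_bigr => v _; by rewrite minxx.
have Q0 : Q (\val x) = 0 by rewrite QE; ring.
have cq : continuous (fun y : unit_cube R p => Q (\val y)).
  move=> y; apply: (@continuous_comp _ _ _ (\val : unit_cube R p -> V) Q).
    exact: continuous_val_cube.
  exact: cQ.
move=> A /nbhs_ballP[e /= e0 He].
have : nbhs x [set y : unit_cube R p | Q (\val y) < e ^+ 2].
  apply: (cq x [set r | r < e ^+ 2]); apply: open_nbhs_nbhs; split; first exact: open_lt.
  by rewrite /= Q0 exprn_gt0.
apply: filterS => y /= yQ; apply: He; rewrite /ball/=.
rewrite -(ltr_pXn2r (n := 2))// ?nnegrE ?(ltW e0)// real_normK ?num_real//.
by apply: le_lt_trans yQ; rewrite QE.
Qed.

End CubePoints.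

(** * Dominated functions are Sobolev functions *)

Section SquareIntegrableLimits.
Context d (T : measurableType d) (R : realType) (mu : probability T R).

Lemma sq_integrable_cvg_mul (u : nat -> T -> R) (g phi : T -> R) :
  (forall n, sq_integrable mu (u n)) -> sq_integrable mu g -> sq_integrable mu phi ->
  (fun n => \int[mu]_x ((u n x - g x) ^+ 2)) @ \oo --> 0 ->
  (fun n => \int[mu]_x (u n x * phi x)) @ \oo --> \int[mu]_x (g x * phi x).
Proof.
move=> u2 g2 phi2 ug.
pose b := \int[mu]_x (phi x ^+ 2); have b0 : 0 <= b by exact: sq_norm_ge0.
have H : (fun n => (\int[mu]_x (u n x * phi x) - \int[mu]_x (g x * phi x)) ^+ 2) @ \oo --> 0.
  apply: (@squeeze_cvgr _ _ _ _ (fun=> 0) (fun n => \int[mu]_x ((u n x - g x) ^+ 2) * b)).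
  - apply: nearW => n; rewrite sqr_ge0/=.
    rewrite -RintegralB//; [|exact: sq_integrable_mul|exact: sq_integrable_mul].
    under [X in X ^+ 2]eq_Rintegral do rewrite -mulrBl.
    by apply: sq_integrable_cauchy_schwarz => //; exact: sq_integrable_sub.
  - exact: cvg_cst.
  - by rewrite -[X in _ --> X](mul0r b); apply: cvgM => //; exact: cvg_cst.
apply/cvgrPdist_lt => e e0; have e20 : 0 < e ^+ 2 by rewrite exprn_gt0.
move/cvgrPdist_lt : H => /(_ _ e20); apply: filterS => n /=.
rewrite sub0r normrN ger0_norm ?sqr_ge0// => H.
rewrite -(ltr_pXn2r (n := 2))// ?nnegrE ?(ltW e0)// real_normK ?num_real//.
by rewrite -sqrrN opprB.
Qed.

Lemma sq_norm_limit (u : nat -> T -> R) (g : T -> R) (c : R) :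
  (forall n, sq_integrable mu (u n)) -> sq_integrable mu g ->
  (fun n => \int[mu]_x ((u n x - g x) ^+ 2)) @ \oo --> 0 ->
  (forall n, \int[mu]_x (u n x ^+ 2) <= c) ->
  \int[mu]_x (g x ^+ 2) <= 2 * c.
Proof.
move=> u2 g2 ug uc.
have H : (fun n => 2 * \int[mu]_x ((u n x - g x) ^+ 2) + 2 * c) @ \oo --> 2 * c.
  rewrite -[X in _ --> X]add0r -[X in _ --> X + _](mulr0 2).
  by apply: cvgD; [apply: cvgM => //; exact: cvg_cst|exact: cvg_cst].
apply: (ler_cvg_to (cvg_cst _) H).
apply: nearW => n /=.
have -> : \int[mu]_x (g x ^+ 2) = \int[mu]_x (((g x - u n x) + u n x) ^+ 2).
  by apply: eq_Rintegral => x _; rewrite subrK.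
apply: (le_trans (sq_norm_triangle _ (u2 n))); first exact: sq_integrable_sub.
apply: lerD; last by rewrite ler_pM2l.
rewrite ler_pM2l// le_eqVlt; apply/orP; left; apply/eqP.
by apply: eq_Rintegral => x _; ring.
Qed.

End SquareIntegrableLimits.

Section DominatedSobolev.
Variables (R : realType) (p : nat).
Local Notation X := (measurableTypeR R).
Local Notation V := 'rV[R]_p.
Local Notation C := (cube_measure R p).
Local Notation U := (unit_interval_measure R).
Local Notation row := (@row_of_tuple R p).
Local Notation Y := (unit_cube R p).
Implicit Types (a : {set 'I_p}) (W : seq (R * Y)).

(** The factors of the section of the pivot at [y], differentiated along the
    variables in [a]. *)
Definition kappa_feature (a : {set 'I_p}) (v : 'I_p) (y : Y) : R -> R :=
  if v \in a then kappa' (\val y 0 v) else kappa (\val y 0 v).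

Lemma measurable_kappa_feature a v y :
  measurable_fun setT (kappa_feature a v y : X -> R).
Proof.
by rewrite /kappa_feature; case: ifP => _; [exact: measurable_lt_ray|exact: measurable_kappa].
Qed.

Lemma kappa_feature_bounded a v y s : `|kappa_feature a v y s| <= 2.
Proof.
rewrite /kappa_feature; case: ifP => _; last exact: kappa_bounded (unit_cube01 _ _).
by rewrite (le_trans (natr_bool_le1 _ _))// ler1n.
Qed.

Let mK := measurable_kappa_feature.
Let KM := kappa_feature_bounded.

(** For the derivatives the Gram matrix is [min]. For the sections themselves
    it is the integral of rank one kernels, each of which is bounded by
    [loewner_section]; the point [None] stands for the value of the
    integration variable. *)
Lemma kappa_feature_le a v :
  loewner_le (fun x y => \int[U]_s (kappa_feature a v x s * kappa_feature a v y s))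
    (fun x y : Y => 2 * (1 + Num.min (\val x 0 v) (\val y 0 v))).
Proof.
have g01 (y : Y) : 0 <= \val y 0 v <= 1 by exact: unit_cube01.
have pm := psd_1Dmin g01.
rewrite /kappa_feature; case: (v \in a); last first.
  have E (x y : Y) : 2 * (1 + Num.min (\val x 0 v) (\val y 0 v)) =
      \int[U]_s (cst (2 * (1 + Num.min (\val x 0 v) (\val y 0 v))) s).
    by rewrite Rintegral_cst//= (congr1 fine (probability_setT U)) mulr1.
  rewrite (_ : (fun x y : Y => 2 * _) = (fun x y : Y =>
      \int[U]_s (cst (2 * (1 + Num.min (\val x 0 v) (\val y 0 v))) s))); last first.
    by apply/funext => x; apply/funext => y; exact: E.
  apply: loewner_integral => [x y|x y|s].
  - apply: (@integrableR_bounded _ _ _ _ _ (2 * 2)) => [|s].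
      by apply: measurable_funM; exact: measurable_kappa.
    by rewrite normrM ler_pM// kappa_bounded.
  - exact: (integrableR_cst U).
  - pose g' (z : option Y) := if z is Some y then \val y 0 v else clamp s.
    have g'01 z : 0 <= g' z <= 1 by case: z => [y|]; [exact: unit_cube01|exact: clamp01].
    have := loewner_comp Some (loewner_section None (psd_1Dmin g'01)).
    rewrite [g' None]/= minxx => H.
    apply: (@loewner_trans _ _ (fun x y : Y =>
      (1 + clamp s) * (1 + Num.min (\val x 0 v) (\val y 0 v)))).
      rewrite (_ : (fun x y : Y => kappa _ _ * _) = (fun x y : Y =>
        (1 + Num.min (clamp s) (\val x 0 v)) * (1 + Num.min (clamp s) (\val y 0 v))))//.
      by apply/funext => x; apply/funext => y; rewrite /kappa !(minC (clamp s)).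
    apply: loewner_scalel => //.
    by have /andP[_ s1] := clamp01 s; rewrite [leRHS](_ : 2 = 1 + 1)// lerD2l.
rewrite (_ : (fun x y : Y => \int[U]_s _) = (fun x y : Y => Num.min (\val x 0 v) (\val y 0 v))).
  apply: (loewner_trans (loewner_min_1Dmin (fun y : Y => \val y 0 v))).
  have := @loewner_scalel _ _ 1 2 _ (ler1n _ 2) pm.
  rewrite (_ : (fun x y : Y => 1 * _) = (fun x y : Y => 1 + Num.min (\val x 0 v) (\val y 0 v)))//.
  by apply/funext => x; apply/funext => y; rewrite mul1r.
by apply/funext => x; apply/funext => y; rewrite /kappa' Rintegral_ray2// clamp_id.
Qed.

Lemma kappa_features_le a :
  loewner_le (fun x y => \prod_v \int[U]_s (kappa_feature a v x s * kappa_feature a v y s))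
    (fun x y : Y => 2 ^+ p * min_kernel x y).
Proof.
apply: (@loewner_prodZ R p 2 _ (fun v (x y : Y) => 1 + Num.min (\val x 0 v) (\val y 0 v))) => //.
- by move=> v; exact: (psd_feature (mK a) (KM a)).
- by move=> v; exact: kappa_feature_le.
Qed.

Definition kappa_sum a W (x : V) : R :=
  eval_points (fun y => prod_fun (fun v => kappa_feature a v y) x) W.

Lemma kappa_sum_row a W (t : p.-tuple X) :
  kappa_sum a W (row t) = eval_points (cube_feature (kappa_feature a) ^~ t) W.
Proof. by apply: eq_bigr => w _; rewrite prod_fun_row. Qed.

Lemma sq_integrable_kappa_sum a W : sq_integrable C (fun t => kappa_sum a W (row t)).
Proof.
rewrite (_ : (fun t => _) = fun t => eval_points (cube_feature (kappa_feature a) ^~ t) W).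
  exact: (sq_integrable_eval_feature (mK a) (KM a)).
by apply/funext => t; rewrite kappa_sum_row.
Qed.

(** Mixed differentiation is bounded from the form of the pivot to [L^2]. *)
Lemma sq_norm_kappa_sum a W :
  \int[C]_t (kappa_sum a W (row t) ^+ 2) <= 2 ^+ p * kernel_form (@min_kernel R p) W.
Proof.
under eq_Rintegral do rewrite kappa_sum_row.
rewrite (sq_norm_eval_feature (mK a) (KM a)) -kernel_formZ.
exact: loewner_form (kappa_features_le a).
Qed.

Lemma kappa_sum_difference a W W' x :
  kappa_sum a (difference_points W W') x = kappa_sum a W x - kappa_sum a W' x.
Proof. by rewrite /kappa_sum eval_points_cat eval_points_scale mulN1r. Qed.

Lemma is_weak_partial_kappa_sum a W :
  is_weak_partial a (kappa_sum finset.set0 W) (kappa_sum a W).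
Proof.
move=> phi tphi.
have wy (y : Y) : is_weak_partial a (prod_fun (fun v => kappa_feature finset.set0 v y))
    (prod_fun (fun v => kappa_feature a v y)).
  have -> : (fun v => kappa_feature finset.set0 v y) = (fun v => kappa (\val y 0 v)).
    by apply/funext => v; rewrite /kappa_feature finset.in_set0.
  apply: (@is_weak_partial_prod_fun R p (fun v => kappa (\val y 0 v)) (fun v => kappa' (\val y 0 v)) 2) => [v|v|v|v x|v x].
  - by apply: weak_derivative_kappa; exact: unit_cube01.
  - exact: measurable_kappa.
  - exact: measurable_lt_ray.
  - by apply: kappa_bounded; exact: unit_cube01.
  - by rewrite (le_trans (natr_bool_le1 _ _))// ler1n.
have iM b y s : integrableR C (fun t => prod_fun (fun v => kappa_feature b v y) (row t) *
    iter_partial s phi (row t)).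
  have [B tB] := test_iter_bounded tphi s.
  apply: (@integrableR_bounded _ _ _ _ _ (\prod_(v < p) 2 * B)) => [|t].
    apply: measurable_funM; last exact: measurable_test_iter.
    rewrite (_ : (fun t => _) = cube_feature (kappa_feature b) y).
      exact: measurable_cube_feature (mK b) y.
    by apply/funext => t; rewrite prod_fun_row.
  rewrite normrM ler_pM// prod_fun_row; apply: prod_bounded => v; exact: KM.
have E b s : cube_integral (fun x => kappa_sum b W x * iter_partial s phi x) =
    \sum_(w <- W) w.1 * cube_integral (fun x =>
      prod_fun (fun v => kappa_feature b v w.2) x * iter_partial s phi x).
  transitivity (\int[C]_t (\sum_(w <- W) w.1 *
      (prod_fun (fun v => kappa_feature b v w.2) (row t) * iter_partial s phi (row t)))).
    apply: eq_Rintegral => t _; rewrite /kappa_sum /eval_points mulr_suml.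
    by apply: eq_bigr => w _; rewrite mulrA.
  rewrite Rintegral_sum; last by move=> w _; apply: integrableRZ; exact: iM.
  by apply: eq_bigr => w _; rewrite RintegralZl//; exact: iM.
rewrite E (E a [::]) mulr_sumr; apply: eq_bigr => w _.
by rewrite (wy w.2 phi tphi) mulrCA.
Qed.

Lemma kappa_sum0_row W (t : p.-tuple X) :
  kappa_sum finset.set0 W (row t) = eval_points (min_kernel (clamp_point (row t))) W.
Proof.
apply: eq_bigr => w _; rewrite prod_fun_row; congr (_ * _).
apply: eq_bigr => v _; rewrite /kappa_feature finset.in_set0 /kappa clamp_pointE.
by rewrite row_of_tupleE minC.
Qed.

Lemma min_kernel_le (x y : Y) : min_kernel x y <= 2 ^+ p.
Proof.
rewrite -[X in _ ^+ X](card_ord p) -prodr_const; apply: ler_prod => v _.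
have /andP[x0 x1] := unit_cube01 x v; have /andP[y0 y1] := unit_cube01 y v.
by rewrite minEle; case: ifP => _; apply/andP; split; lra.
Qed.

Definition tuple_of_row (x : V) : p.-tuple X := [tuple x 0 v | v < p].

Lemma row_of_tupleK : cancel row tuple_of_row.
Proof. by move=> t; apply: eq_from_tnth => v; rewrite tnth_mktuple row_of_tupleE. Qed.

Section Approximation.
Variables (h : Y -> R) (M : R).
Hypotheses (M0 : 0 <= M) (hM : kernel_dominated (@min_kernel R p) h M).
Variable W : nat -> seq (R * Y).
Hypotheses
  (Wh : forall n x, (h x - eval_points (min_kernel x) (W n)) ^+ 2 <=
                    n.+1%:R^-1 * min_kernel x x)
  (WC : forall n m, kernel_form (@min_kernel R p) (difference_points (W n) (W m)) <=
                    2 * (n.+1%:R^-1 + m.+1%:R^-1))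
  (WM : forall n, kernel_form (@min_kernel R p) (W n) <= 4 * M).

Definition extension (x : V) : R := h (clamp_point x).

Lemma L2_extension : L2_cube extension.
Proof.
apply/L2_cubeE; apply: (@sq_integrable_bounded _ _ _ _ _ (1 + M * 2 ^+ p)) => [|t].
  apply: measurable_continuous_row; apply: continuous_extension.
  exact: kernel_dominated_continuous hM.
have := hM [:: (1, clamp_point (row t))].
rewrite eval_points1 kernel_form1 mul1r expr1n mul1r => H.
have := le_trans H (ler_wpM2l M0 (min_kernel_le _ _)).
rewrite -real_normK ?num_real// /extension /=.
move: `|_| (normr_ge0 (h (clamp_point (row t)))) (M * 2 ^+ p) => r r0 c rc.
by have [|r1] := leP r 1; nra.
Qed.

(** The approximation is even uniform, the diagonal of the pivot being
    bounded. *)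
Lemma cvg_kappa_sum0 :
  (fun n => \int[C]_t ((kappa_sum finset.set0 (W n) (row t) - extension (row t)) ^+ 2))
    @ \oo --> 0.
Proof.
apply: (@squeeze_cvgr _ _ _ _ (fun=> 0) (fun n => n.+1%:R^-1 * 2 ^+ p)).
- apply: nearW => n; rewrite sq_norm_ge0/=.
  apply: (@le_trans _ _ (\int[C]_t (cst (n.+1%:R^-1 * 2 ^+ p : R) t))).
    apply: le_Rintegral => //.
    + apply: (sq_integrable_sub (sq_integrable_kappa_sum _ _) _).2.
      by apply/L2_cubeE; exact: L2_extension.
    + exact: (integrableR_cst C).
    + move=> t _; rewrite kappa_sum0_row -sqrrN opprB.
      by apply: (le_trans (Wh _ _)); rewrite ler_wpM2l// min_kernel_le.
  by rewrite Rintegral_cst//= (congr1 fine (probability_setT C)) mulr1.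
- exact: cvg_cst.
- rewrite -[X in _ --> X](mul0r (2 ^+ p)); apply: cvgM; last exact: cvg_cst.
  exact: cvg_harmonic.
Qed.

(** The mixed derivatives of the approximations form a Cauchy sequence in
    [L^2], by linearity and [sq_norm_kappa_sum]; the identity that defines
    weak derivatives passes to the limit on both sides. *)
Lemma kappa_sum_limit (a : {set 'I_p}) : exists g : V -> R, [/\ L2_cube g,
  is_weak_partial a extension g & \int[C]_t (g (row t) ^+ 2) <= 2 * (2 ^+ p * (4 * M))].
Proof.
pose u n (t : p.-tuple X) := kappa_sum a (W n) (row t).
have u2 n : sq_integrable C (u n) by exact: sq_integrable_kappa_sum.
have [e e0|g g2 ug] := sq_integrable_complete u2.
  pose B : R := 2 ^+ p * 4; have B0 : 0 < B by rewrite mulr_gt0// exprn_gt0.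
  have eB : 0 < e / B by rewrite divr_gt0.
  have [N _ HN] := near_infty_natSinv_lt (PosNum eB).
  exists N => m n Nm Nn.
  have -> : \int[C]_t ((u m t - u n t) ^+ 2) =
      \int[C]_t (kappa_sum a (difference_points (W m) (W n)) (row t) ^+ 2).
    by apply: eq_Rintegral => t _; rewrite kappa_sum_difference.
  apply: (le_lt_trans (sq_norm_kappa_sum _ _)).
  apply: (@le_lt_trans _ _ (2 ^+ p * (2 * (m.+1%:R^-1 + n.+1%:R^-1)))).
    by rewrite ler_wpM2l// exprn_ge0.
  have Hm : m.+1%:R^-1 < e / B := HN m Nm; have Hn : n.+1%:R^-1 < e / B := HN n Nn.
  rewrite (_ : _ * _ = B * (2^-1 * (m.+1%:R^-1 + n.+1%:R^-1))); last first.
    by rewrite /B; set i := m.+1%:R^-1; set j := n.+1%:R^-1; field.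
  rewrite mulrC -ltr_pdivlMr//; move: (m.+1%:R^-1) (n.+1%:R^-1) Hm Hn => i j.
  move: (e / B) => r; lra.
exists (g \o tuple_of_row).
have gE : (g \o tuple_of_row) \o row = g by apply/funext => t /=; rewrite row_of_tupleK.
split; first by apply/L2_cubeE; rewrite gE.
  move=> phi tphi.
  have t2 s : sq_integrable C (fun t => iter_partial s phi (row t)).
    have [B tB] := test_iter_bounded tphi s.
    apply: (@sq_integrable_bounded _ _ _ _ _ B) => [|t]; last exact: tB.
    exact: measurable_test_iter.
  have f2 := (L2_cubeE extension).1 L2_extension.
  have H1 := sq_integrable_cvg_mul (fun n => sq_integrable_kappa_sum finset.set0 (W n)) f2 (t2 (enum a))
    cvg_kappa_sum0.
  have H2 := sq_integrable_cvg_mul u2 g2 (t2 [::]) ug.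
  have H3 : (fun n => (-1) ^+ #|a| * \int[C]_t (u n t * phi (row t))) @ \oo -->
      (-1) ^+ #|a| * \int[C]_t (g t * phi (row t)).
    by apply: cvgM; [exact: cvg_cst|exact: H2].
  rewrite /cube_integral; apply: (cvg_unique _ H1) => //.
  rewrite (_ : (fun n => _) = (fun n => (-1) ^+ #|a| * \int[C]_t (u n t * phi (row t)))).
    rewrite (_ : \int[C]_t ((g \o tuple_of_row) (row t) * phi (row t)) =
      \int[C]_t (g t * phi (row t)))//.
    by apply: eq_Rintegral => t _; rewrite /= row_of_tupleK.
  by apply/funext => n; exact: (@is_weak_partial_kappa_sum a (W n) phi tphi).
rewrite (_ : \int[C]_t _ = \int[C]_t (g t ^+ 2)); last first.
  by apply: eq_Rintegral => t _; rewrite /= row_of_tupleK.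
apply: (sq_norm_limit u2 g2 ug) => n; apply: (le_trans (sq_norm_kappa_sum _ _)).
by rewrite ler_wpM2l// exprn_ge0.
Qed.

End Approximation.

(** The converse of [sobolev_dominated], with control of the norm. *)
Lemma dominated_sobolev : exists2 A : R, 0 < A & forall (h : Y -> R) (M : R), 0 <= M ->
  kernel_dominated (@min_kernel R p) h M ->
  exists f, [/\ sobolev_S1 f, continuous_representative f h & S1_norm f ^+ 2 <= A * M].
Proof.
exists (#|{set 'I_p}|%:R * (2 * (2 ^+ p * 4))) => [|h M M0 hM].
  rewrite !mulr_gt0// ?exprn_gt0// ltr0n.
  by apply/card_gt0P; exists finset.set0.
have [W [Wh WC WM]] := dominated_approximation (psd_min_kernel R p) M0 hM.
have Hg a := kappa_sum_limit M0 hM Wh WC WM a.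
have fS : sobolev_S1 (extension h).
  split; first exact: L2_extension M0 hM.
  by move=> a; have [g [g2 gw _]] := Hg a; exists g.
exists (extension h); split=> //.
  split; first exact: kernel_dominated_continuous hM.
  apply: aeW => t x xt.
  by rewrite /extension -xt clamp_point_val.
rewrite S1_norm_sqr// (_ : _ * M = \sum_(a : {set 'I_p}) (2 * (2 ^+ p * (4 * M)))); last first.
  by rewrite sumr_const -mulr_natl; ring.
apply: ler_sum => a _; have [g [g2 gw gM]] := Hg a.
by rewrite (L2_norm_weak_partial (L2_extension M0 hM) g2 fS _ gw)//; exact: aeW.
Qed.

End DominatedSobolev.

(** * The norm equivalence and the theorem *)

Lemma kernel_dominated_loewner (R : realType) (X : Type) (k k' : X -> X -> R) (a M : R)
    (h : X -> R) : 0 <= M -> loewner_le k (fun x y => a * k' x y) ->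
  kernel_dominated k h M -> kernel_dominated k' h (M * a).
Proof.
move=> M0 kk' hM W; apply: (le_trans (hM W)).
by rewrite -mulrA ler_wpM2l// -kernel_formZ loewner_form.
Qed.

Section NormEquivalence.
Variables (R : realType) (p : nat) (c C : R).
Local Notation Y := (unit_cube R p).
Hypotheses (c0 : 0 < c) (C0 : 0 < C).

Lemma continuous_representative_unique (f : 'rV[R]_p -> R) (h h' : Y -> R) :
  continuous_representative f h -> continuous_representative f h' -> h = h'.
Proof.
move=> [ch fh] [ch' fh']; apply: (continuous_ae_eq ch ch').
by apply: ae_imply2 fh fh' _ => t H H' x xt; rewrite -H// -H'.
Qed.

(** The bounds of [sobolev_dominated] and [dominated_sobolev] give the two
    inequalities for suitably constructed companions. Uniqueness of the
    continuous representative, respectively of the weak derivatives, gives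
    them for all companions. *)
Lemma rkhs_norm_equivalent (k : Y -> Y -> R) (H : set (Y -> R))
    (ip : (Y -> R) -> (Y -> R) -> R) :
  loewner_le (fun x y => c * min_kernel x y) k ->
  loewner_le k (fun x y => C * min_kernel x y) ->
  rkhs_of k H ip -> norm_equivalent_S1 H ip.
Proof.
move=> ck kC rk.
have [A A0 HA] := @sobolev_dominated R p; have [B B0 HB] := @dominated_sobolev R p.
have mk : loewner_le (@min_kernel R p) (fun x y => c^-1 * k x y).
  have cV : 0 <= c^-1 by rewrite invr_ge0 ltW.
  have := loewner_scale cV ck.
  rewrite (_ : (fun x y => c^-1 * (c * _)) = @min_kernel R p)//.
  by apply/funext => x; apply/funext => y; rewrite mulKf// gt_eqF.
have up f : sobolev_S1 f -> exists h, [/\ H h, continuous_representative f h &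
    ip h h <= 4 * (A * S1_norm f ^+ 2 * c^-1)].
  move=> fS; have [h hM fh] := HA f fS.
  have M0 : 0 <= A * S1_norm f ^+ 2 by rewrite mulr_ge0 ?sqr_ge0// ltW.
  have [|Hh ih] := dominated_rkhs rk _ (kernel_dominated_loewner M0 mk hM).
    by rewrite mulr_ge0// invr_ge0 ltW.
  exists h; split=> //; split=> //.
  exact: kernel_dominated_continuous hM.
have ip0 h : H h -> 0 <= ip h h by exact: (hfs_ip_ge0 (rkhs_hilbert rk)).
have low h : H h -> exists f, [/\ sobolev_S1 f, continuous_representative f h &
    S1_norm f ^+ 2 <= B * (ip h h * C)].
  move=> Hh; apply: HB; first by rewrite mulr_ge0 ?ip0// ltW.
  exact: (kernel_dominated_loewner (ip0 h Hh) kC (rkhs_dominated rk Hh)).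
split.
- by move=> f /up[h [Hh fh _]]; exists h.
- by move=> h /low[f [fS fh _]]; exists f.
pose a := B * C; pose b := 4 * (A * c^-1).
have a0 : 0 < a by rewrite mulr_gt0.
have b0 : 0 < b by rewrite !mulr_gt0// invr_gt0.
exists (Num.sqrt a)^-1, (Num.sqrt b); split.
- by rewrite invr_gt0 sqrtr_gt0.
- by rewrite sqrtr_gt0.
move=> f h fS Hh fh.
apply/andP; split.
  have [f' [f'S f'h f'le]] := low h Hh.
  have -> : S1_norm f = S1_norm f'.
    apply: S1_norm_ae_eq => //; have ff' := ae_imply2 fh.2 f'h.2 (fun t => @conj _ _).
    apply: ae_imply2 ff' (ae_interior R p) _ => t [H1 H2] t01.
    pose x := clamp_point (row_of_tuple t).
    have xt : \val x = row_of_tuple t.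
      apply/rowP => w; rewrite clamp_pointE clamp_id// row_of_tupleE.
      by have /andP[/ltW -> /ltW ->] := t01 w.
    by rewrite (H1 x xt) (H2 x xt).
  have s0 : 0 <= S1_norm f' by exact: sqrtr_ge0.
  move: (S1_norm f') s0 f'le => s s0 sle.
  rewrite mulrC ler_pdivrMr ?sqrtr_gt0// -sqrtrM ?ip0//.
  have := ler_wsqrtr sle; rewrite sqrtr_sqr ger0_norm//.
  by rewrite (_ : B * (ip h h * C) = ip h h * a)//; rewrite /a; ring.
have [h' [Hh' fh' h'le]] := up f fS.
have -> : h = h' by exact: continuous_representative_unique fh fh'.
have s0 : 0 <= S1_norm f by exact: sqrtr_ge0.
move: (S1_norm f) s0 h'le => s s0 sle.
have := ler_wsqrtr sle; rewrite (_ : 4 * _ = b * s ^+ 2); last by rewrite /b; ring.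
by rewrite sqrtrM ?(ltW b0)// sqrtr_sqr ger0_norm.
Qed.

End NormEquivalence.

Theorem proposition3p3 (R : realType) (p : nat) (sigma2 : R)
    (fD : nat -> R) (fV : 'I_p -> R) (fS : R -> R)
    (p_ge1 : (1 <= p)%N) (sigma2_gt0 : 0 < sigma2)
    (fD_pmf : depth_pmf fD) (fV_pmf : variable_pmf fV)
    (fS_density : split_density fS)
    (depth_ge_p : (0 < depth_tail fD p)%E)
    (depth_moment_p : (depth_moment fD p < +oo)%E)
    (cdf_lipschitz : [lipschitz (split_cdf fS t) | t in `[0%R : R, 1%R]]) :
  (exists c C : R, [/\ 0 < c, c < C &
    forall (d : measure_display) (T : measurableType d) (P : probability T R)
      (D : T -> nat) (V : nat -> T -> 'I_p) (S : nat -> T -> R),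
      symmetric_tree_draw fD fV fS P D V S ->
      loewner_le (fun u u' => c * laplace_kernel u u')
        (bart_kernel sigma2 P D V S) /\
      loewner_le (bart_kernel sigma2 P D V S)
        (fun u u' => C * laplace_kernel u u')]) /\
  (forall (d : measure_display) (T : measurableType d) (P : probability T R)
      (D : T -> nat) (V : nat -> T -> 'I_p) (S : nat -> T -> R),
      symmetric_tree_draw fD fV fS P D V S ->
      forall (H : set (unit_cube R p -> R))
        (ip : (unit_cube R p -> R) -> (unit_cube R p -> R) -> R),
        rkhs_of (bart_kernel sigma2 P D V S) H ip ->
        norm_equivalent_S1 H ip).
Proof.
have [c [C [c0 C0 bounds]]] := bart_min_bounds p_ge1 sigma2_gt0 fD_pmf fV_pmf fS_density
  depth_ge_p depth_moment_p cdf_lipschitz.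
have [A A0 minA] := @min_le_laplace R p.
split; last first.
  move=> d T P D V S draw H ip rk; have [lo hi] := bounds d T P D V S draw.
  exact: (rkhs_norm_equivalent c0 C0 lo hi rk).
have q0 : 0 < 4 ^+ p :> R by rewrite exprn_gt0.
(* the second term makes the upper constant larger than the lower one *)
exists (c / 4 ^+ p), (C * A + c / 4 ^+ p); split; first by rewrite divr_gt0.
  by rewrite ltrDr mulr_gt0.
move=> d T P D V S draw; have [lo hi] := bounds d T P D V S draw; split.
  apply: loewner_trans lo.
  have cq : 0 <= c / 4 ^+ p by rewrite divr_ge0 ?ltW.
  have := loewner_scale cq (@laplace_le_min R p).
  rewrite (_ : (fun x y => c / _ * (4 ^+ p * _)) = (fun x y => c * min_kernel x y))//.
  by apply/funext => x; apply/funext => y; rewrite mulrA divfK// gt_eqF.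
apply: (loewner_trans hi); apply: (loewner_trans (loewner_scale (ltW C0) minA)).
rewrite (_ : (fun x y => C * (A * _)) = (fun x y => C * A * laplace_kernel x y)).
  by apply: loewner_scalel; [rewrite lerDl divr_ge0 ?ltW|exact: psd_laplace].
by apply/funext => x; apply/funext => y; rewrite mulrA.
Qed.
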